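(* Let $\mathfrak g$ be a $Q$-type Lie superalgebra. For any $z\in\mathcal Z(\hat U)$ one has $$\deg z=\deg\mathrm{HC}(z).$$ In other words, any $z\in\mathcal Z(\hat U)$ takes the form $z=\sum_{\nu\in Q^+}z(\nu)$ where $z(\nu)\in J'(\nu)$ is such that $\deg z(\nu)\le\deg z(0)$.
   Context: The base field is $\mathbb C$. For $n\times n$ matrices $A,B$ put $X_{A,B}=\begin{pmatrix}A&B\\ B&A\end{pmatrix}$. The Lie superalgebra $\mathfrak q(n)=\{X_{A,B}\}$ has even part $\{X_{A,0}\}$, odd part $\{X_{0,B}\}$ and brackets $[X_{A,0},X_{A',0}]=X_{[A,A'],0}$, $[X_{A,0},X_{0,B}]=X_{0,[A,B]}$, $[X_{0,B},X_{0,B'}]=X_{BB'+B'B,0}$. Put $\mathfrak{sq}(n)=\{X_{A,B}:\operatorname{tr}B=0\}$, $\mathfrak{pq}(n)=\mathfrak q(n)/\mathbb C\,\mathrm{Id}$, $\mathfrak{psq}(n)=\mathfrak{sq}(n)/\mathbb C\,\mathrm{Id}$. A $Q$-type Lie superalgebra is one of $\mathfrak q(n),\mathfrak{sq}(n)$ ($n\ge 2$), $\mathfrak{pq}(n),\mathfrak{psq}(n)$ ($n\geq 3$). Triangular decomposition $\mathfrak g=\mathfrak n^-\oplus\mathfrak h\oplus\mathfrak n^+$: $\mathfrak h$ (resp. $\mathfrak n^+$, $\mathfrak n^-$) consists of the (images of) $X_{A,B}$ with $A,B$ diagonal (resp. strictly upper triangular, strictly lower triangular); $\mathfrak b^-=\mathfrak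 h+\mathfrak n^-$. $Q^+=\sum_{\alpha\in\Delta^+}\mathbb Z_{\ge0}\alpha$, where $\Delta^+=\{\varepsilon_i-\varepsilon_j\}_{i<j}$ are the $\mathfrak h_{\overline 0}$-weights of $\mathfrak n^+$; the height of $\nu=\sum k_i\alpha_i$ ($\alpha_i$ simple) is $\sum k_i$. Completion: for $\nu\in Q^+$ put $J'(\nu)=\mathcal U(\mathfrak b^-)\,\mathcal U(\mathfrak n^+)_\nu$ ($\mathcal U(\mathfrak n^+)_\nu$ is the weight space of weight $\nu$). By PBW, $\mathcal U(\mathfrak g)=\bigoplus_{\nu\in Q^+}J'(\nu)$. $\hat U$ is the completion of $\mathcal U(\mathfrak g)$ whose underlying space is $\hat U=\prod_{\nu\in Q^+}J'(\nu)$; its elements are written as formal sums $u=\sum_{\nu\in Q^+}u_\nu$, $u_\nu\in J'(\nu)$. The associative algebra structure and the adjoint action of $\mathfrak g$ extend uniquely by continuity from $\mathcal U(\mathfrak g)$ to $\hat U$ (neighbourhoods of zero being elements all of whose components $u_\nu$ of height less than $k$ vanish; in $\mathcal U(\mathfrak g)$ these are left ideals). $\mathcal Z(\hat U)=\hat U^{\mathfrak g}$ is the (super)centre: the elements annihilated by the adjoint action of $\mathfrak g$. $\mathrm{HC}:\hat U\to\mathcal U(\mathfrak h)$ is the projection along $\hat U=\mathcal U(\mathfrak h)\oplus(\mathfrak n^-\mathcal U(\mathfrak b^-)+\hat U\mathfrak n^+)$. For $u\in\mathcal U(\mathfrak g)$, $\deg u$ is the degree with respect to the canonical (PBW) filtration;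 for $u=\sum u_\nu\in\hat U$, $\deg u=\sup_\nu\deg u_\nu$ ($\infty$ if unbounded). *)

(* Defs.v *)
From HB Require Import structures.
From mathcomp Require Import all_boot all_order all_algebra.
From mathcomp Require Import boolp classical_sets functions fsbigop reals constructive_ereal ereal.
From mathcomp Require Import complex ring.

Set Implicit Arguments.
Unset Strict Implicit.
Unset Printing Implicit Defensive.

Import GRing.Theory Num.Theory.
Local Open Scope ring_scope.
Local Open Scope quotient_scope.
Local Open Scope classical_set_scope.

(* The Z/2-grading of V is given by the projection ev onto the even part along
   the odd part; b = false means even, b = true means odd. *)
Definition homog (V : zmodType) (ev : V -> V) (b : bool) (x : V) :=
  if b then ev x = 0 else ev x = x.

Record lieSuper (F : fieldType) := LieSuper {
  ls_car :> lmodType F;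
  ls_ev : ls_car -> ls_car;
  ls_br : ls_car -> ls_car -> ls_car;
  ls_ev_lin : linear ls_ev;
  ls_ev_idem : forall x, ls_ev (ls_ev x) = ls_ev x;
  ls_br_linl : forall z, linear (ls_br^~ z);
  ls_br_linr : forall z, linear (ls_br z);
  ls_br_homog : forall a b x y, homog ls_ev a x -> homog ls_ev b y ->
    homog ls_ev (a (+) b) (ls_br x y);
  ls_anti : forall a b x y, homog ls_ev a x -> homog ls_ev b y ->
    ls_br x y = - ((-1) ^+ (a && b) *: ls_br y x);
  ls_jacobi : forall a b x y z, homog ls_ev a x -> homog ls_ev b y ->
    ls_br x (ls_br y z) =
    ls_br (ls_br x y) z + (-1) ^+ (a && b) *: ls_br y (ls_br x z)
}.

Section SubLie.
Variables (F : fieldType) (L : lieSuper F) (S : submodClosed L).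
Hypothesis evS : forall x, x \in S -> ls_ev x \in S.
Hypothesis brS : forall x y, x \in S -> y \in S -> ls_br x y \in S.

Definition subcar := {x : L | x \in S}.
HB.instance Definition _ := SubChoice.on subcar.
HB.instance Definition _ := [SubChoice_isSubLmodule of subcar by <:].

Definition sub_ev (x : subcar) : subcar := exist _ (ls_ev (val x)) (evS (valP x)).
Definition sub_br (x y : subcar) : subcar :=
  exist _ (ls_br (val x) (val y)) (brS (valP x) (valP y)).

Lemma sub_homog b (x : subcar) : homog sub_ev b x <-> homog (@ls_ev _ L) b (val x).
Proof.
by case: b; split=> [/(congr1 val)|h] //=; apply: val_inj.
Qed.

Lemma sub_ev_lin : linear sub_ev.
Proof. by move=> a x y; apply: val_inj; exact: ls_ev_lin. Qed.
Lemma sub_ev_idem x : sub_ev (sub_ev x) = sub_ev x.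
Proof. by apply: val_inj; rewrite /= ls_ev_idem. Qed.
Lemma sub_br_linl z : linear (sub_br^~ z).
Proof. by move=> a x y; apply: val_inj; exact: ls_br_linl. Qed.
Lemma sub_br_linr z : linear (sub_br z).
Proof. by move=> a x y; apply: val_inj; exact: ls_br_linr. Qed.
Lemma sub_br_homog a b x y : homog sub_ev a x -> homog sub_ev b y ->
  homog sub_ev (a (+) b) (sub_br x y).
Proof. by rewrite !sub_homog; apply: ls_br_homog. Qed.
Lemma sub_anti a b x y : homog sub_ev a x -> homog sub_ev b y ->
  sub_br x y = - ((-1) ^+ (a && b) *: sub_br y x).
Proof.
rewrite !sub_homog => hx hy; apply: val_inj.
exact: ls_anti hx hy.
Qed.
Lemma sub_jacobi a b x y z : homog sub_ev a x -> homog sub_ev b y ->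
  sub_br x (sub_br y z) =
  sub_br (sub_br x y) z + (-1) ^+ (a && b) *: sub_br y (sub_br x z).
Proof.
rewrite !sub_homog => hx hy; apply: val_inj.
exact: ls_jacobi hx hy.
Qed.

Definition subLie := LieSuper sub_ev_lin sub_ev_idem sub_br_linl sub_br_linr
  sub_br_homog sub_anti sub_jacobi.
End SubLie.

Section QuotientLie.
Variables (F : fieldType) (L : lieSuper F) (I : zmodClosed L).
Hypothesis scaleI : forall a x, x \in I -> a *: x \in I.
Hypothesis evI : forall x, x \in I -> ls_ev x \in I.
Hypothesis brIl : forall x y, x \in I -> ls_br x y \in I.
Hypothesis brIr : forall x y, y \in I -> ls_br x y \in I.

Definition quocar of (forall a x, x \in I -> a *: x \in I) := Quotient.quot I.
Local Notation Q := (quocar scaleI).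
HB.instance Definition _ := Choice.on Q.
HB.instance Definition _ := GRing.Zmodule.on Q.

Definition quo_pi (x : L) : Q := \pi_(Quotient.quot I) x.

Lemma quo_piP x y : quo_pi x = quo_pi y <-> x - y \in I.
Proof. by rewrite Quotient.idealrBE; split=> /eqP. Qed.
Lemma quo_piD x y : quo_pi (x + y) = quo_pi x + quo_pi y.
Proof. exact: Quotient.pi_add. Qed.
Lemma quo_ind (P : Q -> Prop) : (forall x, P (quo_pi x)) -> forall q, P q.
Proof. by move=> h q; rewrite -[q](@reprK _ (Quotient.quot I)); apply: h. Qed.

Definition quo_scale (a : F) (q : Q) : Q := quo_pi (a *: repr q).
Lemma quo_scaleE a x : quo_scale a (quo_pi x) = quo_pi (a *: x).
Proof.
apply/quo_piP; rewrite -scalerBr; apply: scaleI.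
by apply/quo_piP; rewrite /quo_pi reprK.
Qed.
Lemma quo_scaleA a b v : quo_scale a (quo_scale b v) = quo_scale (a * b) v.
Proof. by elim/quo_ind: v => x; rewrite !quo_scaleE scalerA. Qed.
Lemma quo_scale1 : left_id 1 quo_scale.
Proof. by elim/quo_ind=> x; rewrite quo_scaleE scale1r. Qed.
Lemma quo_scaleDr : right_distributive quo_scale +%R.
Proof.
move=> a; elim/quo_ind=> x; elim/quo_ind=> y.
by rewrite -quo_piD !quo_scaleE scalerDr quo_piD.
Qed.
Lemma quo_scaleDl v : {morph quo_scale^~ v : a b / a + b}.
Proof. by move=> a b; elim/quo_ind: v => x; rewrite !quo_scaleE scalerDl quo_piD. Qed.
HB.instance Definition _ := GRing.Zmodule_isLmodule.Build F Q
  quo_scaleA quo_scale1 quo_scaleDr quo_scaleDl.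

Lemma quo_piP_lin : linear quo_pi.
Proof. by move=> a x y; rewrite quo_piD -quo_scaleE. Qed.
HB.instance Definition _ := GRing.isLinear.Build F L Q _ quo_pi quo_piP_lin.

Let evB x y : @ls_ev _ L (x - y) = ls_ev x - ls_ev y.
Proof. by rewrite addrC -scaleN1r ls_ev_lin scaleN1r addrC. Qed.
Let brBl x y z : @ls_br _ L (x - y) z = ls_br x z - ls_br y z.
Proof. by rewrite addrC -scaleN1r ls_br_linl scaleN1r addrC. Qed.
Let brBr x y z : @ls_br _ L z (x - y) = ls_br z x - ls_br z y.
Proof. by rewrite addrC -scaleN1r ls_br_linr scaleN1r addrC. Qed.

Definition quo_ev (q : Q) : Q := quo_pi (ls_ev (repr q)).
Definition quo_br (q r : Q) : Q := quo_pi (ls_br (repr q) (repr r)).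

Lemma quo_evE x : quo_ev (quo_pi x) = quo_pi (ls_ev x).
Proof.
apply/quo_piP; rewrite -evB; apply: evI.
by apply/quo_piP; rewrite /quo_pi reprK.
Qed.
Lemma quo_brE x y : quo_br (quo_pi x) (quo_pi y) = quo_pi (ls_br x y).
Proof.
have reprI z : repr (quo_pi z) - z \in I.
  by apply/quo_piP; rewrite /quo_pi reprK.
apply/quo_piP; rewrite -(subrKA (ls_br x (repr (quo_pi y)))) -brBl -brBr.
by apply: rpredD; [apply: brIl | apply: brIr].
Qed.

Lemma quo_homog b (q : Q) : homog quo_ev b q ->
  exists2 x, homog (@ls_ev _ L) b x & q = quo_pi x.
Proof.
elim/quo_ind: q => x; case: b => /=; rewrite quo_evE => hx.
- exists (x - ls_ev x); first by rewrite /= evB ls_ev_idem subrr.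
  by rewrite linearB /= hx subr0.
- by exists (ls_ev x); rewrite //= ls_ev_idem.
Qed.
Lemma homog_quo b x : homog (@ls_ev _ L) b x -> homog quo_ev b (quo_pi x).
Proof. by case: b => /=; rewrite quo_evE => ->; rewrite ?linear0. Qed.

Lemma quo_ev_lin : linear quo_ev.
Proof.
move=> a; elim/quo_ind=> x; elim/quo_ind=> y.
by rewrite -linearP !quo_evE ls_ev_lin linearP.
Qed.
Lemma quo_ev_idem x : quo_ev (quo_ev x) = quo_ev x.
Proof. by elim/quo_ind: x => x; rewrite !quo_evE ls_ev_idem. Qed.
Lemma quo_br_linl z : linear (quo_br^~ z).
Proof.
move=> a; elim/quo_ind=> x; elim/quo_ind=> y; elim/quo_ind: z => z.
by rewrite -linearP !quo_brE ls_br_linl linearP.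
Qed.
Lemma quo_br_linr z : linear (quo_br z).
Proof.
move=> a; elim/quo_ind=> x; elim/quo_ind=> y; elim/quo_ind: z => z.
by rewrite -linearP !quo_brE ls_br_linr linearP.
Qed.
Lemma quo_br_homog a b x y : homog quo_ev a x -> homog quo_ev b y ->
  homog quo_ev (a (+) b) (quo_br x y).
Proof.
move=> /quo_homog[x' hx ->] /quo_homog[y' hy ->].
by rewrite quo_brE; apply/homog_quo/ls_br_homog.
Qed.
Lemma quo_anti a b x y : homog quo_ev a x -> homog quo_ev b y ->
  quo_br x y = - ((-1) ^+ (a && b) *: quo_br y x).
Proof.
move=> /quo_homog[x' hx ->] /quo_homog[y' hy ->].
by rewrite !quo_brE (ls_anti hx hy) linearN linearZ.
Qed.
Lemma quo_jacobi a b x y z : homog quo_ev a x -> homog quo_ev b y ->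
  quo_br x (quo_br y z) =
  quo_br (quo_br x y) z + (-1) ^+ (a && b) *: quo_br y (quo_br x z).
Proof.
move=> /quo_homog[x' hx ->] /quo_homog[y' hy ->]; elim/quo_ind: z => z.
by rewrite !quo_brE (ls_jacobi _ hx hy) linearD linearZ.
Qed.

Definition quoLie := LieSuper quo_ev_lin quo_ev_idem quo_br_linl quo_br_linr
  quo_br_homog quo_anti quo_jacobi.
End QuotientLie.

Section QType.
Variables (F : fieldType) (n : nat).

(* The pair (A, B) stands for the matrix X_{A,B} = qX (A, B). *)
Definition qmx := ('M[F]_n * 'M[F]_n)%type.
HB.instance Definition _ := GRing.Lmodule.on qmx.
Implicit Types x y z : qmx.

Definition qX x : 'M[F]_(n + n) := block_mx x.1 x.2 x.2 x.1.

Definition q_ev x : qmx := (x.1, 0).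
Definition q_br x y : qmx :=
  ((x.1 *m y.1 - y.1 *m x.1) + (x.2 *m y.2 + y.2 *m x.2),
   (x.1 *m y.2 - y.2 *m x.1) + (x.2 *m y.1 - y.1 *m x.2)).

Let mulmxPl a (A B C : 'M[F]_n) : (a *: A + B) *m C = a *: (A *m C) + B *m C.
Proof. by rewrite mulmxDl -scalemxAl. Qed.
Let mulmxPr a (A B C : 'M[F]_n) : C *m (a *: A + B) = a *: (C *m A) + C *m B.
Proof. by rewrite mulmxDr -scalemxAr. Qed.

Local Ltac mxnc :=
  rewrite /= ?(mul0mx, mulmx0, add0r, addr0, oppr0) ?(mulmxPl, mulmxPr)
    ?(mulmxDl, mulmxDr, mulmxBl, mulmxBr, mulNmx, mulmxN, mulmxA, mul0mx, mulmx0);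
  repeat match goal with |- context [?A *m ?B] => move: (A *m B) => ? end;
  rewrite ?(add0r, addr0, oppr0) ?scaleN1r ?scale1r;
  apply/matrixP => ? ?; rewrite !mxE; ring.

Lemma q_homogP b x : homog q_ev b x <-> if b then x.1 = 0 else x.2 = 0.
Proof.
case: x b => A B []; rewrite /homog /q_ev /=; split=> [[]|->] //.
Qed.

Lemma q_brX a b x y : homog q_ev a x -> homog q_ev b y ->
  qX (q_br x y) = qX x *m qX y - (-1) ^+ (a && b) *: (qX y *m qX x).
Proof.
rewrite !q_homogP /qX !mulmx_block scale_block_mx opp_block_mx add_block_mx.
by case: a; case: b => /= -> ->; congr block_mx; mxnc.
Qed.

Lemma q_ev_lin : linear q_ev.
Proof. by move=> a x y; congr pair; rewrite /= scaler0 addr0. Qed.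
Lemma q_ev_idem x : q_ev (q_ev x) = q_ev x. Proof. by []. Qed.
Lemma q_br_linl z : linear (q_br^~ z).
Proof. by move=> a [? ?] [? ?]; case: z => ? ?; congr pair; mxnc. Qed.
Lemma q_br_linr z : linear (q_br z).
Proof. by move=> a [? ?] [? ?]; case: z => ? ?; congr pair; mxnc. Qed.
Lemma q_br_homog a b x y : homog q_ev a x -> homog q_ev b y ->
  homog q_ev (a (+) b) (q_br x y).
Proof. by rewrite !q_homogP; case: a; case: b => /= -> ->; mxnc. Qed.
Lemma q_anti a b x y : homog q_ev a x -> homog q_ev b y ->
  q_br x y = - ((-1) ^+ (a && b) *: q_br y x).
Proof.
rewrite !q_homogP; case: x y => ? ? [? ?].
by case: a; case: b => /= -> ->; congr pair; mxnc.
Qed.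
Lemma q_jacobi a b x y z : homog q_ev a x -> homog q_ev b y ->
  q_br x (q_br y z) =
  q_br (q_br x y) z + (-1) ^+ (a && b) *: q_br y (q_br x z).
Proof.
rewrite !q_homogP; case: x y z => ? ? [? ?] [? ?].
by case: a; case: b => /= -> ->; congr pair; mxnc.
Qed.
End QType.

Section QTypeLie.
Variables (F : fieldType) (n : nat).
Local Notation qmx := (qmx F n).

Definition qLie := LieSuper (@q_ev_lin F n) (@q_ev_idem F n) (@q_br_linl F n)
  (@q_br_linr F n) (@q_br_homog F n) (@q_anti F n) (@q_jacobi F n).

Definition sq_pred : {pred qLie} := fun x : qmx => \tr x.2 == 0.
Lemma sq_closed : GRing.subsemimod_closed sq_pred.
Proof.
split; first split.
- by rewrite unfold_in linear0.
- move=> x y; rewrite !unfold_in => /eqP hx /eqP hy.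
  by rewrite /= linearD /= hx hy addr0.
- move=> a x; rewrite !unfold_in => /eqP hx.
  by rewrite /= linearZ /= hx mulr0.
Qed.
HB.instance Definition _ := GRing.isSubSemiModClosed.Build F qLie sq_pred sq_closed.

Lemma sq_ev (x : qLie) : x \in sq_pred -> ls_ev x \in sq_pred.
Proof. by move=> _; rewrite unfold_in linear0. Qed.
Lemma sq_br (x y : qLie) : x \in sq_pred -> y \in sq_pred -> ls_br x y \in sq_pred.
Proof.
move=> _ _; rewrite unfold_in /= linearD !linearB /=.
by rewrite !(mxtrace_mulC y.2, mxtrace_mulC y.1) !subrr addr0.
Qed.
Definition sqLie := subLie sq_ev sq_br.

(* The line spanned by the identity matrix X_{1,0}. *)
Definition qId : {pred qLie} := fun x : qmx => is_scalar_mx x.1 && (x.2 == 0).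
Lemma qIdP (x : qLie) : reflect (exists a, x = (a%:M, 0) :> qmx) (x \in qId).
Proof.
rewrite unfold_in; apply: (iffP andP) => [[/is_scalar_mxP[a h] /eqP h2]|[a ->]].
  by exists a; case: x h h2 => ? ? /= -> ->.
by rewrite eqxx scalar_mx_is_scalar.
Qed.
Lemma qId_closed : zmod_closed qId.
Proof.
split; first by apply/qIdP; exists 0; rewrite raddf0.
move=> x y /qIdP[a ->] /qIdP[b ->]; apply/qIdP; exists (a - b).
by congr pair; rewrite /= ?raddfB ?subr0.
Qed.
HB.instance Definition _ := GRing.isZmodClosed.Build qLie qId qId_closed.

Lemma qId_scale a (x : qLie) : x \in qId -> a *: x \in qId.
Proof.
move=> /qIdP[b ->]; apply/qIdP; exists (a * b).
by congr pair; rewrite /= ?scale_scalar_mx ?scaler0.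
Qed.
Lemma qId_ev (x : qLie) : x \in qId -> ls_ev x \in qId.
Proof. by move=> /qIdP[b ->]; apply/qIdP; exists b. Qed.
Lemma qId_brl (x y : qLie) : x \in qId -> ls_br x y \in qId.
Proof.
move=> /qIdP[b ->]; apply/qIdP; exists 0.
by congr pair; rewrite /= !scalar_mxC !mul0mx !mulmx0 !subrr !addr0 ?raddf0.
Qed.
Lemma qId_brr (x y : qLie) : y \in qId -> ls_br x y \in qId.
Proof.
move=> /qIdP[b ->]; apply/qIdP; exists 0.
by congr pair; rewrite /= !scalar_mxC !mul0mx !mulmx0 !subrr !addr0 ?raddf0.
Qed.
Definition pqLie := quoLie qId_scale qId_ev qId_brl qId_brr.

Definition sqId : {pred sqLie} := fun x => sval x \in qId.
Lemma sqId_closed : zmod_closed sqId.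
Proof.
split; first exact: (rpred0 qId).
by move=> x y hx hy; apply: (rpredB (S := qId) hx hy).
Qed.
HB.instance Definition _ := GRing.isZmodClosed.Build sqLie sqId sqId_closed.
Lemma sqId_scale a (x : sqLie) : x \in sqId -> a *: x \in sqId.
Proof. exact: (@qId_scale a (sval x)). Qed.
Lemma sqId_ev (x : sqLie) : x \in sqId -> ls_ev x \in sqId.
Proof. exact: (@qId_ev (sval x)). Qed.
Lemma sqId_brl (x y : sqLie) : x \in sqId -> ls_br x y \in sqId.
Proof. exact: (@qId_brl (sval x) (sval y)). Qed.
Lemma sqId_brr (x y : sqLie) : y \in sqId -> ls_br x y \in sqId.
Proof. exact: (@qId_brr (sval x) (sval y)). Qed.
Definition psqLie := quoLie sqId_scale sqId_ev sqId_brl sqId_brr.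
End QTypeLie.

Variant qkind := KQ | KSQ | KPQ | KPSQ.

Definition qtype_rank (k : qkind) (n : nat) : bool :=
  match k with KQ | KSQ => 2 <= n | KPQ | KPSQ => 3 <= n end%N.

Definition qtypeLie (F : fieldType) (k : qkind) (n : nat) : lieSuper F :=
  match k with
  | KQ => qLie F n | KSQ => sqLie F n | KPQ => pqLie F n | KPSQ => psqLie F n
  end.

(* qtype_image M x: the matrix X_M lies in q(n), resp. sq(n), and x is its image
   in the Lie superalgebra. *)
Definition qtype_image (F : fieldType) (k : qkind) (n : nat) :
    qmx F n -> qtypeLie F k n -> Prop :=
  match k return qmx F n -> qtypeLie F k n -> Prop with
  | KQ => fun M x => x = M
  | KSQ => fun M x => sval x = M
  | KPQ => fun M x => x = quo_pi (@qId_scale F n) M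
  | KPSQ => fun M x =>
      exists2 y : sqLie F n, sval y = M & x = quo_pi (@sqId_scale F n) y
  end.

Section Enveloping.
Variables (F : fieldType) (L : lieSuper F).

(* U(L) is the unital associative algebra presented by the generators UGen x
   (x in L) and the relations UEgenP (linearity of x |-> UGen x) and UEbr
   (x y - (-1)^(|x||y|) y x = [x, y]); the other constructors of ueq say that
   it is a congruence and that the quotient is an algebra. *)
Inductive uterm :=
  | UGen of L | UCst of F | UAdd of uterm & uterm | UMul of uterm & uterm.

Inductive ueq : uterm -> uterm -> Prop :=
  | UErefl s : ueq s s
  | UEsym s t : ueq s t -> ueq t s
  | UEtrans s t u : ueq s t -> ueq t u -> ueq s u
  | UEadd s s' t t' : ueq s s' -> ueq t t' -> ueq (UAdd s t) (UAdd s' t')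
  | UEmul s s' t t' : ueq s s' -> ueq t t' -> ueq (UMul s t) (UMul s' t')
  | UEaddA s t u : ueq (UAdd s (UAdd t u)) (UAdd (UAdd s t) u)
  | UEaddC s t : ueq (UAdd s t) (UAdd t s)
  | UEadd0 s : ueq (UAdd (UCst 0) s) s
  | UEaddN s : ueq (UAdd (UMul (UCst (-1)) s) s) (UCst 0)
  | UEmulA s t u : ueq (UMul s (UMul t u)) (UMul (UMul s t) u)
  | UEmul1 s : ueq (UMul (UCst 1) s) s
  | UEmulDl s t u : ueq (UMul (UAdd s t) u) (UAdd (UMul s u) (UMul t u))
  | UEmulDr s t u : ueq (UMul s (UAdd t u)) (UAdd (UMul s t) (UMul s u))
  | UEcstD a b : ueq (UCst (a + b)) (UAdd (UCst a) (UCst b))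
  | UEcstM a b : ueq (UCst (a * b)) (UMul (UCst a) (UCst b))
  | UEcstC a s : ueq (UMul (UCst a) s) (UMul s (UCst a))
  | UEgenP a x y : ueq (UGen (a *: x + y)) (UAdd (UMul (UCst a) (UGen x)) (UGen y))
  | UEbr a b x y : homog (@ls_ev _ L) a x -> homog (@ls_ev _ L) b y ->
      ueq (UMul (UGen x) (UGen y))
        (UAdd (UMul (UCst ((-1) ^+ (a && b))) (UMul (UGen y) (UGen x)))
              (UGen (ls_br x y))).

HB.instance Definition _ := gen_eqMixin uterm.
HB.instance Definition _ := gen_choiceMixin uterm.

Definition ueqb (s t : uterm) : bool := `[< ueq s t >].
Lemma ueqb_equiv : equiv_class_of ueqb.
Proof.
split=> [s|s t|t s u].
- exact/asboolP/UErefl.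
- by apply/asboolP/asboolP; apply: UEsym.
- by move=> /asboolP h1 /asboolP h2; apply/asboolP; apply: UEtrans h1 h2.
Qed.
Canonical ueqb_equiv_rel := EquivRelPack ueqb_equiv.
Canonical ueqb_encModRel := defaultEncModRel ueqb.

Definition uea := {eq_quot ueqb}.
HB.instance Definition _ := Choice.on uea.

Definition uea_pi (s : uterm) : uea := \pi_uea s.
Lemma uea_piP s t : uea_pi s = uea_pi t <-> ueq s t.
Proof. by split=> [/eqmodP/asboolP|h] //; apply/eqmodP/asboolP. Qed.
Lemma uea_ind (P : uea -> Prop) : (forall s, P (uea_pi s)) -> forall u, P u.
Proof. by move=> h u; rewrite -[u]reprK; apply: h. Qed.
Lemma uea_reprP s : ueq (repr (uea_pi s)) s.
Proof. by apply/uea_piP; rewrite /uea_pi reprK. Qed.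

Definition uea_add (u v : uea) := uea_pi (UAdd (repr u) (repr v)).
Definition uea_mul (u v : uea) := uea_pi (UMul (repr u) (repr v)).
Definition uea_cst a := uea_pi (UCst a).
Definition uea_scale a (u : uea) := uea_mul (uea_cst a) u.
Definition uea_opp u := uea_scale (-1) u.

Lemma uea_addE s t : uea_add (uea_pi s) (uea_pi t) = uea_pi (UAdd s t).
Proof. by apply/uea_piP/UEadd; apply: uea_reprP. Qed.
Lemma uea_mulE s t : uea_mul (uea_pi s) (uea_pi t) = uea_pi (UMul s t).
Proof. by apply/uea_piP/UEmul; apply: uea_reprP. Qed.

Local Ltac ueas := repeat elim/uea_ind=> ?;
  rewrite /uea_opp /uea_scale /uea_cst ?(uea_addE, uea_mulE); apply/uea_piP.

Lemma uea_addA : associative uea_add. Proof. by ueas; constructor. Qed.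
Lemma uea_addC : commutative uea_add. Proof. by ueas; constructor. Qed.
Lemma uea_add0 : left_id (uea_cst 0) uea_add. Proof. by ueas; constructor. Qed.
Lemma uea_addN : left_inverse (uea_cst 0) uea_opp uea_add.
Proof. by ueas; constructor. Qed.
HB.instance Definition _ :=
  GRing.isZmodule.Build uea uea_addA uea_addC uea_add0 uea_addN.

Lemma uea_mulA : associative uea_mul. Proof. by ueas; constructor. Qed.
Lemma uea_mul1 : left_id (uea_cst 1) uea_mul. Proof. by ueas; constructor. Qed.
Lemma uea_cstC a u : uea_mul (uea_cst a) u = uea_mul u (uea_cst a).
Proof. by elim/uea_ind: u => s; ueas; constructor. Qed.
Lemma uea_1mul : right_id (uea_cst 1) uea_mul.
Proof. by move=> u; rewrite -uea_cstC uea_mul1. Qed.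
Lemma uea_mulDl : left_distributive uea_mul uea_add. Proof. by ueas; constructor. Qed.
Lemma uea_mulDr : right_distributive uea_mul uea_add. Proof. by ueas; constructor. Qed.

Section Eval.
Variables (A : algType F) (f : L -> A).
Fixpoint ueval (s : uterm) : A :=
  match s with
  | UGen x => f x
  | UCst a => a%:A
  | UAdd s t => ueval s + ueval t
  | UMul s t => ueval s * ueval t
  end.

Hypothesis f_lin : linear f.
Hypothesis f_br : forall a b x y,
  homog (@ls_ev _ L) a x -> homog (@ls_ev _ L) b y ->
  f x * f y = (-1) ^+ (a && b) *: (f y * f x) + f (ls_br x y).

Lemma ueval_ueq s t : ueq s t -> ueval s = ueval t.
Proof.
elim=> //=.
- by move=> > _ -> _ ->.
- by move=> > _ -> _ ->.
- by move=> > _ -> _ ->.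
- by move=> *; rewrite addrA.
- by move=> *; rewrite addrC.
- by move=> *; rewrite scale0r add0r.
- by move=> *; rewrite scaleN1r mulN1r addNr scale0r.
- by move=> *; rewrite mulrA.
- by move=> *; rewrite scale1r mul1r.
- by move=> *; rewrite mulrDl.
- by move=> *; rewrite mulrDr.
- by move=> *; rewrite scalerDl.
- by move=> *; rewrite -scalerAl mul1r scalerA.
- by move=> *; rewrite -scalerAl -scalerAr mul1r mulr1.
- by move=> *; rewrite f_lin -scalerAl mul1r.
- by move=> > h1 h2; rewrite -scalerAl mul1r; apply: f_br.
Qed.
End Eval.

Lemma uea_1neq0 : uea_cst 1 != 0.
Proof.
apply/eqP => /uea_piP h; have := @ueval_ueq F^o (fun=> 0) _ _ _ _ h.
rewrite /= scale1r scale0r => h10; have /eqP := oner_neq0 F; apply; apply: h10.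
- by move=> a x y; rewrite scaler0 addr0.
- by move=> *; rewrite mulr0 scaler0 addr0.
Qed.
HB.instance Definition _ := GRing.Zmodule_isNzRing.Build uea
  uea_mulA uea_mul1 uea_1mul uea_mulDl uea_mulDr uea_1neq0.

Lemma uea_scaleA a b u : uea_scale a (uea_scale b u) = uea_scale (a * b) u.
Proof.
rewrite /uea_scale uea_mulA; congr uea_mul.
by rewrite /uea_cst uea_mulE; apply/esym/uea_piP; constructor.
Qed.
Lemma uea_scale1 : left_id 1 uea_scale. Proof. exact: uea_mul1. Qed.
Lemma uea_scaleDr : right_distributive uea_scale +%R.
Proof. by move=> a u v; apply: uea_mulDr. Qed.
Lemma uea_scaleDl u : {morph uea_scale^~ u : a b / a + b}.
Proof.
move=> a b; rewrite /uea_scale -[RHS]uea_mulDl; congr uea_mul.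
by rewrite /uea_cst uea_addE; apply/uea_piP; constructor.
Qed.
HB.instance Definition _ := GRing.Zmodule_isLmodule.Build F uea
  uea_scaleA uea_scale1 uea_scaleDr uea_scaleDl.
Lemma uea_scaleAl a (u v : uea) : a *: (u * v) = (a *: u) * v.
Proof. exact: uea_mulA. Qed.
HB.instance Definition _ := GRing.Lmodule_isLalgebra.Build F uea uea_scaleAl.
Lemma uea_scaleAr a (u v : uea) : a *: (u * v) = u * (a *: v).
Proof.
rewrite /GRing.scale /= /uea_scale.
by rewrite uea_mulA [RHS]uea_mulA; congr uea_mul; apply: uea_cstC.
Qed.
HB.instance Definition _ := GRing.Lalgebra_isAlgebra.Build F uea uea_scaleAr.

Definition uiota (x : L) : uea := uea_pi (UGen x).

Lemma uiota_lin : linear uiota.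
Proof.
move=> a x y; rewrite /uiota /GRing.scale /= /uea_scale /uea_cst uea_mulE.
by rewrite [RHS]uea_addE; apply/uea_piP; constructor.
Qed.
Lemma uiota_br a b x y : homog (@ls_ev _ L) a x -> homog (@ls_ev _ L) b y ->
  uiota x * uiota y = (-1) ^+ (a && b) *: (uiota y * uiota x) + uiota (ls_br x y).
Proof.
move=> hx hy; rewrite /uiota /GRing.scale /= /uea_scale /uea_cst.
rewrite [X in X = _]uea_mulE [X in uea_mul _ X]uea_mulE uea_mulE [RHS]uea_addE.
by apply/uea_piP; constructor.
Qed.

(* The algebra morphism U(L) -> A extending a linear map f : L -> A which is
   compatible with the brackets (see ulift_iota, uliftM, ulift_lin). *)
Definition ulift (A : algType F) (f : L -> A) (u : uea) : A := ueval f (repr u).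

Section Lift.
Variables (A : algType F) (f : L -> A).
Hypothesis f_lin : linear f.
Hypothesis f_br : forall a b x y,
  homog (@ls_ev _ L) a x -> homog (@ls_ev _ L) b y ->
  f x * f y = (-1) ^+ (a && b) *: (f y * f x) + f (ls_br x y).

Lemma uliftE s : ulift f (uea_pi s) = ueval f s.
Proof. exact/ueval_ueq/uea_reprP. Qed.
Lemma ulift_iota x : ulift f (uiota x) = f x.
Proof. by rewrite uliftE. Qed.
Lemma uliftM u v : ulift f (u * v) = ulift f u * ulift f v.
Proof.
elim/uea_ind: u => s; elim/uea_ind: v => t.
by rewrite [X in ulift f X]uea_mulE !uliftE.
Qed.
Lemma ulift_lin : linear (ulift f).
Proof.
move=> a; elim/uea_ind=> s; elim/uea_ind=> t.
rewrite {1}/GRing.scale /= /uea_scale /uea_cst uea_mulE [X in ulift f X]uea_addE.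
by rewrite !uliftE /= -scalerAl mul1r.
Qed.
End Lift.

(* The parity automorphism of U(L): x |-> (-1)^|x| x on homogeneous x in L. *)
Definition lparity (x : L) : L := ls_ev x - (x - ls_ev x).
Definition uparity : uea -> uea := ulift (fun x => uiota (lparity x)).

Lemma lparity_homog b x : homog (@ls_ev _ L) b x -> lparity x = (-1) ^+ b *: x.
Proof.
rewrite /lparity; case: b => /= ->;
  by rewrite ?subr0 ?sub0r ?subrr ?scaleN1r ?subr0 ?scale1r.
Qed.
Lemma uiota_lparity_lin : linear (fun x => uiota (lparity x)).
Proof.
move=> a x y; rewrite -uiota_lin /lparity ls_ev_lin; congr uiota.
by rewrite !scalerBr [RHS]addrACA -opprD [in RHS](addrACA (a *: x)) -opprD.
Qed.
Lemma uiota_lparity_br a b x y :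
  homog (@ls_ev _ L) a x -> homog (@ls_ev _ L) b y ->
  uiota (lparity x) * uiota (lparity y) =
  (-1) ^+ (a && b) *: (uiota (lparity y) * uiota (lparity x))
  + uiota (lparity (ls_br x y)).
Proof.
have uiotaZ c v : uiota (c *: v) = c *: uiota v.
  have uiota0 : uiota 0 = 0.
    by have := uiota_lin (-1) 0 0; rewrite scaler0 addr0 scaleN1r addNr.
  by rewrite -[X in uiota X]addr0 uiota_lin uiota0 addr0.
move=> hx hy; rewrite (lparity_homog hx) (lparity_homog hy).
rewrite (lparity_homog (ls_br_homog hx hy)) !uiotaZ -!scalerAl -!scalerAr.
rewrite (uiota_br hx hy) !scalerDr !scalerA signr_addb; congr (_ *: _ + _).
by case: a b {hx hy} => [] []; rewrite /= ?expr0 ?expr1 ?mulr1 ?mul1r.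
Qed.
Lemma uparity_iota x : uparity (uiota x) = uiota (lparity x).
Proof. exact: ulift_iota uiota_lparity_lin uiota_lparity_br x. Qed.
Lemma uparityM u v : uparity (u * v) = uparity u * uparity v.
Proof. exact: uliftM uiota_lparity_lin uiota_lparity_br u v. Qed.
Lemma uparity_lin : linear uparity.
Proof. exact: ulift_lin uiota_lparity_lin uiota_lparity_br. Qed.
End Enveloping.

Definition linspan (F : fieldType) (V : lmodType F) (S : set V) : set V :=
  [set v | exists2 s : seq (F * V), (forall p, p \in s -> S p.2) &
                                    v = \sum_(p <- s) p.1 *: p.2].

(* The subalgebra of U(L) generated by a; for a subalgebra a of L it is the
   image of U(a) in U(L). *)
Definition Uof (F : fieldType) (L : lieSuper F) (a : set L) : set (uea L) :=
  linspan [set \prod_(x <- s) uiota x | s in [set s : seq L | forall x, x \in s -> a x]].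

(* The canonical filtration of U(L). *)
Definition Ufilt (F : fieldType) (L : lieSuper F) (p : nat) : set (uea L) :=
  linspan [set \prod_(x <- s) uiota x | s in [set s : seq L | (size s <= p)%N]].

(* Elements sum_i k_i alpha_i of Q^+ are given by their coordinates k_i on the
   simple roots alpha_i = eps_i - eps_{i+1}, which form a basis of Q^+. *)
Definition Qplus (n : nat) := {ffun 'I_n.-1 -> nat}.
HB.instance Definition _ n := GRing.Nmodule.on (Qplus n).

Definition height n (nu : Qplus n) : nat := (\sum_(i < n.-1) nu i)%N.

Definition ord_lo n (i : 'I_n.-1) : 'I_n := widen_ord (leq_pred n) i.
Lemma ord_hi_proof n (i : 'I_n.-1) : (i.+1 < n)%N.
Proof. by case: n i => [|n] [i hi]. Qed.
Definition ord_hi n (i : 'I_n.-1) : 'I_n := Ordinal (ord_hi_proof i).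

(* The value of nu on the diagonal matrix D. *)
Definition Qval (F : fieldType) n (nu : Qplus n) (D : 'M[F]_n) : F :=
  \sum_(i < n.-1) (nu i)%:R *
    (D (ord_lo i) (ord_lo i) - D (ord_hi i) (ord_hi i)).

Definition strict_upper (F : fieldType) n (A : 'M[F]_n) :=
  forall i j : 'I_n, (j <= i)%N -> A i j = 0.
Definition strict_lower (F : fieldType) n (A : 'M[F]_n) :=
  forall i j : 'I_n, (i <= j)%N -> A i j = 0.

Section Completion.
Variables (R : realType) (k : qkind) (n : nat).
Local Notation C := R[i].
Local Notation g := (qtypeLie C k n).
Local Notation U := (uea g).
Local Notation Qp := (Qplus n).
Implicit Types (nu : Qp) (u w z : Qp -> U).

Definition g_of (P : 'M[C]_n -> Prop) : set g :=
  [set x | exists A B, [/\ P A, P B & qtype_image (A, B) x]].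
Definition hh : set g := g_of is_diag_mx.
Definition nplus : set g := g_of (@strict_upper C n).
Definition nminus : set g := g_of (@strict_lower C n).
Definition bminus : set g := [set x + y | x in hh & y in nminus].

(* U(n^+)_nu, the weights being taken for the adjoint action of h_0. *)
Definition Unplus nu : set U :=
  [set u | Uof nplus u /\
     forall (D : 'M[C]_n) (h : g), is_diag_mx D -> qtype_image (D, 0) h ->
       uiota h * u - u * uiota h = Qval nu D *: u].

Definition J nu : set U := linspan [set a * b | a in Uof bminus & b in Unplus nu].

(* An element of the completion is the family of its components. *)
Definition Uhat : set (Qp -> U) := [set u | forall nu, J nu (u nu)].

(* The elements of U(g) whose components of height < m vanish. *)
Definition nbhs0 (m : nat) : set U :=
  linspan [set a | exists2 nu, (m <= height nu)%N & J nu a].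

Definition trunc (m : nat) u : U :=
  \sum_(nu \in [set nu | (height nu < m)%N]) u nu.

Definition Uhat_cvg (s : nat -> U) w :=
  Uhat w /\
  forall m, exists N, forall p, (N <= p)%N -> nbhs0 m (s p - trunc m w).

(* w is the value at u of the extension by continuity of f : U(g) -> U(g). *)
Definition Uhat_ext (f : U -> U) u w := Uhat_cvg (fun p => f (trunc p u)) w.

(* On homogeneous elements, ad x a = x a - (-1)^(|x||a|) a x. *)
Definition ad (x : g) (a : U) : U :=
  uiota x * a - (a * uiota (ls_ev x) + uparity a * uiota (x - ls_ev x)).

Definition Zhat : set (Qp -> U) :=
  [set z | Uhat z /\ forall x, Uhat_ext (ad x) z (fun=> 0)].

Definition nminusU : set U := linspan [set uiota y * a | y in nminus & a in Uof bminus].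

Definition Uhat_nplus : set (Qp -> U) :=
  linspan [set w | exists u x,
    [/\ Uhat u, nplus x & Uhat_ext (fun a => a * uiota x) u w]].

Definition in0 (a : U) : Qp -> U := fun nu => if nu == 0 then a else 0.

(* Projection onto U(h) along n^- U(b^-) + Uhat n^+, the two summands U(h) and
   n^- U(b^-) sitting in the component of weight 0; xget picks the h of the
   decomposition. *)
Definition HC u : U :=
  xget 0 [set h | Uof hh h /\
    exists a w, [/\ nminusU a, Uhat_nplus w & u = in0 h + (in0 a + w)]].

(* deg 0 = -oo. *)
Definition degU (a : U) : \bar R :=
  if a == 0 then -oo%E else ereal_inf [set (p%:R)%:E | p in [set p | Ufilt p a]].

Definition deg u : \bar R := ereal_sup [set degU (u nu) | nu in setT].

End Completion.

(* Main.v *)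
(* Write deg for the PBW degree. The U(h)-component of a central z is its component
   z(0). If the z(nu) of height < k have degree <= d, let z_k be the sum of the
   components of height k and s its leading symbol, in the supersymmetric algebra;
   suppose deg z_k > d. Let b be the maximal height of a positive root vector occurring
   in s. For y of weight -b, the part of height k - b of ad y (z) vanishes and only
   involves z_k modulo lower degree. In terms of the root vectors x, x' (even, odd)
   of a root of height b this gives
     h d_x s + H d_x' s = 0   and   H d_x s + h' d_x' s = 0,
   with h = E_jj - E_ii, h' = E_jj + E_ii and H odd. As H^2 = 0, h h' d_x s = 0, so
   that d_x s = d_x' s = 0, since the even vectors h and h' are not zero divisors. *)
Require Import Defs.
From HB Require Import structures.
From mathcomp Require Import all_boot all_order all_algebra.
From mathcomp Require Import boolp classical_sets functions fsbigop reals.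
From mathcomp Require Import constructive_ereal ereal complex ring zify.
Set Implicit Arguments.
Unset Strict Implicit.
Unset Printing Implicit Defensive.
Import Order.TTheory GRing.Theory Num.Theory.
Local Open Scope ring_scope.
Local Open Scope classical_set_scope.

(** Symbols make sense only through PBW, which must be proved for U(g) given by generators and
    relations. Independence of the ordered monomials comes from an oscillator module: g acts by
    derivations on polynomials, translated to an even point whose orbit map is injective. On the
    vacuum, the top component of a word is then a product of creation operators, and differentiation
    separates such products. For q and sq the point lies in n copies of the natural module; in pq
    and psq the identity is 0, so supermatrices under the supercommutator replace it.

    The height b must be maximal because [ad y] turns a letter of height S < b into one of negative
    height, at a cost of at most S, whereas a letter of height S > b would also cost exactly b.
    Since z is an infinite sum, the argument runs on truncations, and the tail stays above height k
    - b because [ad y] lowers heights by at most b.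

    The condition n >= 3 in the quotients enters at h': for n = 2 it is the identity, hence 0.

    That z(0) lies in U(h) is a weight argument: it has weight 0 and only involves letters of b^-,
    none of positive height. *)

Section LinearClosure.
Variables (F : fieldType) (V : lmodType F).

Definition lclosed (P : set V) := P 0 /\ forall a x y, P x -> P y -> P (a *: x + y).

Lemma lclosedD P x y : lclosed P -> P x -> P y -> P (x + y).
Proof. by case=> _ h px py; rewrite -[x]scale1r; apply: h. Qed.
Lemma lclosedZ P a x : lclosed P -> P x -> P (a *: x).
Proof. by case=> h0 h px; rewrite -[_ *: x]addr0; apply: h. Qed.
Lemma lclosedB P x y : lclosed P -> P x -> P y -> P (x - y).
Proof. by case=> _ h px py; rewrite addrC -scaleN1r; apply: h. Qed.
Lemma lclosed_sum P (I : Type) (s : seq I) (Q : pred I) (f : I -> V) :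
  lclosed P -> (forall i, Q i -> P (f i)) -> P (\sum_(i <- s | Q i) f i).
Proof.
by move=> hP hf; apply: big_ind => //; [case: hP | move=> x y; apply: lclosedD].
Qed.
Lemma lclosed_sum_seq P (I : eqType) (s : seq I) (f : I -> V) :
  lclosed P -> (forall i, i \in s -> P (f i)) -> P (\sum_(i <- s) f i).
Proof. by move=> hP hf; rewrite big_seq; apply: lclosed_sum. Qed.

Lemma linspan_closed S : lclosed (@linspan F V S).
Proof.
split; first by exists [::] => //; rewrite big_nil.
move=> a x y [s hs ->] [t ht ->].
exists ([seq (a * p.1, p.2) | p <- s] ++ t).
  move=> p; rewrite mem_cat => /orP[/mapP[q hq ->]|]; [exact: (hs _ hq) | exact: ht].
rewrite big_cat big_map scaler_sumr; congr (_ + _).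
by apply: eq_bigr => p _; rewrite scalerA.
Qed.
Lemma linspan_in S x : S x -> @linspan F V S x.
Proof.
move=> hx; exists [:: (1, x)]; last by rewrite big_seq1 scale1r.
by move=> p; rewrite inE => /eqP ->.
Qed.
Lemma linspan_sub S P : lclosed P -> S `<=` P -> @linspan F V S `<=` P.
Proof.
by move=> hP hS x [s hs ->]; apply: lclosed_sum_seq => // p /hs/hS; exact: lclosedZ.
Qed.
End LinearClosure.

(** * Creation and annihilation operators *)

(* A function on monomials is a formal element of the supersymmetric algebra on
   the generators T. Only the parity of the exponent of an odd generator enters in
   the operators, so that the (anti)commutation relations hold without assuming
   that these exponents are at most 1. *)
Section Fock.
Variables (F : fieldType) (T : finType) (par : T -> bool) (bf : rel T).
Hypothesis bf_irr : irreflexive bf.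
Hypothesis bf_tot : forall a b, a != b -> bf a b = ~~ bf b a.

Definition mon := {ffun T -> nat}.
Definition fock := mon -> F^o.
HB.instance Definition _ := GRing.Lmodule.on fock.
Implicit Types (m : mon) (f g : fock) (a b : T).

Lemma fock0 m : (0 : fock) m = 0. Proof. by []. Qed.
Lemma fockD f g m : (f + g) m = f m + g m. Proof. by []. Qed.
Lemma fockN f m : (- f) m = - f m. Proof. by []. Qed.
Lemma fockZ (k : F) f m : (k *: f) m = k * f m. Proof. by []. Qed.
Definition fockE := (fock0, fockD, fockN, fockZ).

Definition upd m a k : mon := [ffun b => if b == a then k else m b].
(* The sign of moving the generator a to its place in the monomial m. *)
Definition sgn a m : F := (-1) ^+ (par a * \sum_(b | bf b a && par b) m b).

(** Elements are coefficient functions, so an operator is given by what it reads: creation reads a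
    lowered exponent, annihilation a raised one. The common form lets [fop_comm] treat all pairs of
    operators at once. *)
Definition fop (c : nat -> F) (tau : nat -> nat) a f : fock :=
  fun m => c (m a) * sgn a m * f (upd m a (tau (m a))).

(** Multiplication by [a] and derivation along [a] on coefficients. For odd [a] creation is nonzero
    only at odd exponents and annihilation only at even ones, as in a Grassmann algebra. *)
Definition cr_coef a k : F :=
  if k is k'.+1 then (if par a then (~~ odd k')%:R else 1) else 0.
Definition an_coef a k : F := if par a then (~~ odd k)%:R else k.+1%:R.
Definition crea a := fop (cr_coef a) predn a.
Definition anni a := fop (an_coef a) succn a.

Lemma fop_linear c tau a : linear (fop c tau a).
Proof.
move=> k f g; apply/funext => m; by rewrite /fop !fockE mulrDr mulrCA.
Qed.
HB.instance Definition _ c tau a :=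
  GRing.isLinear.Build F fock fock _ (fop c tau a) (@fop_linear c tau a).
HB.instance Definition _ a := GRing.Linear.on (crea a).
HB.instance Definition _ a := GRing.Linear.on (anni a).

Lemma upd_id m a : upd m a (m a) = m.
Proof. by apply/ffunP=> b; rewrite ffunE; case: eqP => // ->. Qed.
Lemma upd_upd m a k l : upd (upd m a k) a l = upd m a l.
Proof. by apply/ffunP=> b; rewrite !ffunE; case: eqP. Qed.
Lemma updC m a b k l : a != b -> upd (upd m a k) b l = upd (upd m b l) a k.
Proof.
move=> ab; apply/ffunP=> c; rewrite !ffunE.
by case: (eqVneq c b) => [->|//]; rewrite eq_sym (negPf ab).
Qed.
Lemma upd_neq m a b k : b != a -> upd m a k b = m b.
Proof. by move=> h; rewrite ffunE (negPf h). Qed.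
Lemma upd_eq m a k : upd m a k a = k. Proof. by rewrite ffunE eqxx. Qed.

Lemma sgn_upd_bf a b m k : bf a b -> odd k = ~~ odd (m a) ->
  sgn b (upd m a k) = (-1) ^+ (par a && par b) * sgn b m.
Proof.
move=> hab hk; rewrite /sgn; case pb: (par b); last by rewrite andbF !mul0n mulr1.
rewrite !mul1n andbT; case pa: (par a); last first.
  rewrite mul1r; congr (_ ^+ _); apply: eq_bigr => c /andP[_ pc].
  by rewrite upd_neq //; apply: contraTneq pc => ->; rewrite pa.
rewrite (bigD1 a) /=; last by rewrite hab pa.
rewrite [in RHS](bigD1 a) /=; last by rewrite hab pa.
rewrite upd_eq !exprD mulrA -[(-1) ^+ k]signr_odd hk signrN signr_odd expr1.
rewrite mulN1r; congr (- _ * _).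
by congr (_ ^+ _); apply: eq_bigr => c /andP[_ ca]; rewrite upd_neq.
Qed.

Lemma sgn_upd_nbf a b m k : ~~ bf a b -> sgn b (upd m a k) = sgn b m.
Proof.
move=> h; rewrite /sgn; congr (_ ^+ (_ * _)); apply: eq_bigr => c /andP[hc _].
by rewrite upd_neq //; apply: contraTneq hc => ->.
Qed.

Lemma sgnK a m : sgn a m * sgn a m = 1.
Proof. by rewrite -expr2 sqrr_sign. Qed.

(** Signs only see parities of exponents, so a shift has to change the parity wherever its
    coefficient is nonzero. [predn] fails to do so at 0, where [cr_coef] vanishes. *)
Definition flips (c : nat -> F) (tau : nat -> nat) :=
  forall k, c k != 0 -> odd (tau k) = ~~ odd k.

(** Of two distinct generators one precedes the other; shifting the earlier one alters the sign of
    the later one and not conversely, which yields the single factor. *)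
Lemma fop_comm c tau c' tau' a b f : flips c tau -> flips c' tau' -> a != b ->
  fop c tau a (fop c' tau' b f) = (-1) ^+ (par a && par b) *: fop c' tau' b (fop c tau a f).
Proof.
move=> h h' ab; apply/funext => m; rewrite fockE /fop.
rewrite (upd_neq _ _ ab) (@upd_neq m a b) 1?eq_sym // -(updC _ _ _ ab).
have [->|ca] := eqVneq (c (m a)) 0; first by rewrite !(mul0r, mulr0).
have [->|cb] := eqVneq (c' (m b)) 0; first by rewrite !(mul0r, mulr0).
have {h}ha := h _ ca; have {h'}hb := h' _ cb.
case hab: (bf a b).
  rewrite (sgn_upd_bf hab ha) sgn_upd_nbf; last first.
    by move: hab; rewrite (bf_tot ab).
  by ring.
move: hab; rewrite (bf_tot ab) => /negbFE hba.
rewrite [sgn b _]sgn_upd_nbf; last by rewrite (bf_tot ab) hba.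
rewrite (sgn_upd_bf hba hb) !(andbC (par b)).
have := sqrr_sign F (par a && par b); rewrite expr2.
set e := (-1) ^+ _ => hs; rewrite -[LHS]mul1r -hs. ring.
Qed.

Lemma cr_flips a : flips (cr_coef a) predn.
Proof. by case=> [|k]; rewrite /cr_coef /= ?eqxx // negbK. Qed.
Lemma an_flips a : flips (an_coef a) succn.
Proof. by []. Qed.

Lemma crea_anti a b f :
  crea a (crea b f) = (-1) ^+ (par a && par b) *: crea b (crea a f).
Proof.
have [<-|ab] := eqVneq a b; last exact: fop_comm (@cr_flips a) (@cr_flips b) ab.
case pa: (par a); last by rewrite scale1r.
rewrite /= expr1 scaleN1r; suff -> : crea a (crea a f) = 0 by rewrite oppr0.
apply/funext => m; rewrite fockE /crea /fop upd_eq /cr_coef pa.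
case: (m a) => [|[|k]] /=; rewrite ?(mul0r, mulr0) //.
by rewrite negbK; case: (odd k) => /=; rewrite ?(mul0r, mulr0).
Qed.

Lemma anni_anti a b f :
  anni a (anni b f) = (-1) ^+ (par a && par b) *: anni b (anni a f).
Proof.
have [<-|ab] := eqVneq a b; last exact: fop_comm (@an_flips a) (@an_flips b) ab.
case pa: (par a); last by rewrite scale1r.
rewrite /= expr1 scaleN1r; suff -> : anni a (anni a f) = 0 by rewrite oppr0.
apply/funext => m; rewrite fockE /anni /fop upd_eq /an_coef pa /=.
by rewrite negbK; case: (odd (m a)) => /=; rewrite ?(mul0r, mulr0).
Qed.

Lemma sgn_upd_self a m k : sgn a (upd m a k) = sgn a m.
Proof. by rewrite sgn_upd_nbf ?bf_irr. Qed.

(** For [a = b] this is k + 1 = 1 + k at exponent k of an even generator; for an odd one, exactly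
    one of the two composites is nonzero at each parity of the exponent. *)
Lemma anni_crea a b f : anni a (crea b f) =
  (a == b)%:R *: f + (-1) ^+ (par a && par b) *: crea b (anni a f).
Proof.
have [<-|ab] := eqVneq a b; last first.
  by rewrite scale0r add0r; apply: fop_comm (@an_flips a) (@cr_flips b) ab.
rewrite scale1r; apply/funext => m; rewrite !fockE /anni /crea /fop !upd_eq !upd_upd !sgn_upd_self.
have e x y z : x * sgn a m * (y * sgn a m * z) = x * y * z.
  by rewrite -[RHS]mul1r -(sgnK a m); ring.
rewrite !e /an_coef /cr_coef; case pa: (par a) => /=.
  case E: (m a) => [|k] /=; first by have -> : upd m a 0 = m; [rewrite -[in RHS](upd_id m a) E | ring].
  by rewrite !negbK -{1 2}E upd_id; case: (odd k) => /=; ring.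
case E: (m a) => [|k] /=; first by have -> : upd m a 0 = m; [rewrite -[in RHS](upd_id m a) E | ring].
have -> : upd m a k.+1 = m by rewrite -[in RHS](upd_id m a) E.
by rewrite -[k.+2%:R]natr1; ring.
Qed.

Definition vac : fock := fun m => (m == 0)%:R.
Lemma anni_vac a : anni a vac = 0.
Proof.
apply/funext => m; rewrite fockE /anni /fop /vac.
suff /negPf -> : upd m a (m a).+1 != 0 by rewrite mulr0.
by apply/eqP => /ffunP/(_ a); rewrite upd_eq ffunE.
Qed.
End Fock.

HB.instance Definition _ (F : fieldType) (L : lieSuper F) :=
  GRing.isLinear.Build F L (uea L) _ (@uiota F L) (@uiota_lin F L).

(** * Modules over U(L) *)

Section Action.
Variables (F : fieldType) (L : lieSuper F) (W : lmodType F) (rho : L -> W -> W).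
Hypothesis rho_linl : forall w, linear (rho^~ w).
Hypothesis rho_linr : forall x, linear (rho x).
Hypothesis rho_br : forall a b x y w,
  homog (@ls_ev _ L) a x -> homog (@ls_ev _ L) b y ->
  rho x (rho y w) = (-1) ^+ (a && b) *: rho y (rho x w) + rho (ls_br x y) w.

(** Acting term by term avoids the algebra of endomorphisms of [W] that [ulift] would require. *)
Fixpoint uact (s : uterm L) (w : W) : W :=
  match s with
  | UGen x => rho x w
  | UCst a => a *: w
  | UAdd s t => uact s w + uact t w
  | UMul s t => uact s (uact t w)
  end.

Lemma uact_linear s : linear (uact s).
Proof.
elim: s => /= [x|b|s hs t ht|s hs t ht] a v w.
- exact: rho_linr.
- by rewrite scalerDr !scalerA mulrC.
- by rewrite hs ht scalerDr addrACA.
- by rewrite ht hs.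
Qed.

Lemma uact_ueq s t : ueq s t -> uact s =1 uact t.
Proof.
elim=> //=.
- by move=> > _ h w; rewrite h.
- by move=> > _ h _ h' w; rewrite h h'.
- by move=> > _ h _ h' w; rewrite h h'.
- by move=> > _ h _ h' w; rewrite h h'.
- by move=> >; rewrite addrA.
- by move=> >; rewrite addrC.
- by move=> >; rewrite scale0r add0r.
- by move=> >; rewrite scaleN1r addNr scale0r.
- by move=> >; rewrite ?scale1r.
- by move=> s1 t1 u1 w; rewrite -{1}[uact t1 w]scale1r uact_linear scale1r.
- by move=> >; rewrite scalerDl.
- by move=> >; rewrite scalerA.
- move=> a s1 w; rewrite -[in RHS](addr0 (a *: w)) uact_linear.
  have := uact_linear s1 (-1) 0 0; rewrite scaler0 addr0 scaleN1r addNr => ->.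
  by rewrite addr0.
- by move=> >; rewrite rho_linl.
- by move=> > h h' w; apply: rho_br.
Qed.

Definition act (u : uea L) (w : W) := uact (repr u) w.
Lemma actE s w : act (uea_pi s) w = uact s w.
Proof. exact/uact_ueq/uea_reprP. Qed.
Lemma act_iota x w : act (uiota x) w = rho x w. Proof. exact: actE. Qed.
Lemma act1 w : act 1 w = w. Proof. by rewrite [LHS]actE /= scale1r. Qed.
Lemma actM u v w : act (u * v) w = act u (act v w).
Proof.
elim/uea_ind: u => s; elim/uea_ind: v => t.
by rewrite [X in act X]uea_mulE !actE.
Qed.
Lemma act_linl w : linear (act^~ w).
Proof.
move=> a; elim/uea_ind=> s; elim/uea_ind=> t.
rewrite {1}/GRing.scale /= /uea_scale /uea_cst uea_mulE [X in act X]uea_addE.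
by rewrite !actE.
Qed.
End Action.

Definition enum_before (T : finType) (a b : T) := (enum_rank a < enum_rank b)%N.
Lemma enum_before_irr T : irreflexive (@enum_before T).
Proof. by move=> a; apply: ltnn. Qed.
Lemma enum_before_tot (T : finType) (a b : T) :
  a != b -> enum_before a b = ~~ enum_before b a.
Proof.
move=> ab; rewrite /enum_before -leqNgt ltn_neqAle.
by rewrite (inj_eq val_inj) (inj_eq enum_rank_inj) ab.
Qed.

(* The Lie superalgebra acts on polynomial functions on V (x) F^K, for V a
   matrix representation r, by derivations; the annihilation operators are
   translated to an even point v0, so that acting on the vacuum records x.v0. *)
Section Oscillator.
Variables (F : fieldType) (L : lieSuper F) (I K : finType) (par : I -> bool).
Variables (r : L -> I -> I -> F) (v0 : I -> K -> F).
Hypothesis r_lin : forall a x y i j, r (a *: x + y) i j = a * r x i j + r y i j.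
Hypothesis r_par : forall b x i j, homog (@ls_ev _ L) b x -> r x i j != 0 ->
  b = par i (+) par j.
Hypothesis r_br : forall a b x y i j,
  homog (@ls_ev _ L) a x -> homog (@ls_ev _ L) b y ->
  r (ls_br x y) i j = \sum_l r x i l * r y l j - (-1) ^+ (a && b) * \sum_l r y i l * r x l j.
Hypothesis v0_par : forall i k, v0 i k != 0 -> par i = false.

Definition opar (p : I * K) := par p.1.
Local Notation J := (I * K)%type.
Local Notation W := (fock F J).
Local Notation cr := (crea (F := F) opar (@enum_before J)).
Local Notation an := (anni (F := F) opar (@enum_before J)).
Let irr := @enum_before_irr J.
Let tot := @enum_before_tot J.
Implicit Types (f : W) (p q : J) (x y : L).

Definition tan p f : W := an p f + v0 p.1 p.2 *: f.
Lemma tan_linear p : linear (tan p).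
Proof.
move=> a f g; rewrite /tan linearP /= !scalerDr !scalerA addrACA.
by rewrite [v0 _ _ * a]mulrC -!scalerA -scalerDr.
Qed.
HB.instance Definition _ p := GRing.isLinear.Build F W W _ (tan p) (tan_linear p).

(** Since the point [v0] is even, the scalar term of [tan] may carry any sign that [an] produces;
    translation thus preserves the supercommutation relations. *)
Let v0_sgn p (b : bool) : v0 p.1 p.2 = (-1) ^+ (opar p && b) * v0 p.1 p.2.
Proof.
have [->|h] := eqVneq (v0 p.1 p.2) 0; first by rewrite mulr0.
by rewrite /opar (v0_par h) mul1r.
Qed.

Lemma tan_crea p q f : tan p (cr q f) =
  (p == q)%:R *: f + (-1) ^+ (opar p && opar q) *: cr q (tan p f).
Proof.
rewrite /tan anni_crea // linearD /= linearZ /= scalerDr addrA; congr (_ + _).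
by rewrite scalerA -v0_sgn.
Qed.

Lemma tan_anti p q f : tan p (tan q f) = (-1) ^+ (opar p && opar q) *: tan q (tan p f).
Proof.
have e p' q' : tan p' (tan q' f) = an p' (an q' f) + (v0 p'.1 p'.2 *: an q' f
    + (v0 q'.1 q'.2 *: an p' f + (v0 p'.1 p'.2 * v0 q'.1 q'.2) *: f)).
  rewrite [tan q' f]/tan linearD linearZ /= /tan scalerDr scalerA -!addrA.
  by rewrite [v0 q'.1 _ * _]mulrC.
rewrite !e anni_anti // !scalerDr; congr (_ + _).
rewrite addrCA; congr (_ + _); first by rewrite scalerA andbC -v0_sgn.
congr (_ + _); first by rewrite scalerA -v0_sgn.
rewrite !scalerA; congr (_ *: _).
by rewrite mulrCA -v0_sgn mulrC.
Qed.

Local Notation P := (I * I * K)%type.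
Definition lo (t : P) : J := (t.1.1, t.2).
Definition hi (t : P) : J := (t.1.2, t.2).
Definition rc x (t : P) := r x t.1.1 t.1.2.

Definition osc x f : W := \sum_t rc x t *: cr (lo t) (tan (hi t) f).

Let crZ p (c : F) f : cr p (c *: f) = c *: cr p f. Proof. exact: linearZ. Qed.
Let tanZ p (c : F) f : tan p (c *: f) = c *: tan p f. Proof. exact: linearZ. Qed.

Lemma osc_linl f : linear (osc^~ f).
Proof.
move=> a x y; rewrite /osc scaler_sumr -big_split; apply: eq_bigr => t _.
by rewrite /rc r_lin scalerDl scalerA.
Qed.
Lemma osc_linr x : linear (osc x).
Proof.
move=> a f g; rewrite /osc scaler_sumr -big_split; apply: eq_bigr => t _.
by rewrite !linearP.
Qed.

(** Normal ordering of two quadratic operators: [osc_main] has one contraction and is the operator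
    of the matrix product ([osc_mainE]); [osc_rest] has none, is supersymmetric in x and y
    ([osc_rest_sym]), and cancels in the supercommutator. *)
Let osc_main x y f : W := \sum_t \sum_u (rc x t * rc y u * (hi t == lo u)%:R) *:
  cr (lo t) (tan (hi u) f).
Let osc_rest x y f : W := \sum_t \sum_u
  (rc x t * rc y u * (-1) ^+ (opar (hi t) && opar (lo u))) *:
  cr (lo t) (cr (lo u) (tan (hi t) (tan (hi u) f))).

Let osc_comp x y f : osc x (osc y f) = osc_main x y f + osc_rest x y f.
Proof.
rewrite /osc_main /osc_rest -big_split; apply: eq_bigr => t _ /=.
rewrite -big_split /= /osc !linear_sum /=; apply: eq_bigr => u _.
by rewrite tanZ tan_crea !crZ linearD /= !crZ !scalerDr !scalerA !mulrA.
Qed.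

Let osc_rest_sym a b x y f : homog (@ls_ev _ L) a x -> homog (@ls_ev _ L) b y ->
  osc_rest x y f = (-1) ^+ (a && b) *: osc_rest y x f.
Proof.
move=> hx hy; rewrite /osc_rest exchange_big scaler_sumr; apply: eq_bigr => u _ /=.
rewrite scaler_sumr; apply: eq_bigr => t _.
have [h|tx] := eqVneq (rc x t) 0; first by rewrite h !(mul0r, mulr0, scale0r, scaler0).
have [h|uy] := eqVneq (rc y u) 0; first by rewrite h !(mul0r, mulr0, scale0r, scaler0).
rewrite (r_par hx tx) (r_par hy uy) crea_anti // tan_anti // !crZ !scalerA.
congr (_ *: _); rewrite [rc y u * _]mulrC -!mulrA; rewrite [RHS]mulrCA; congr (_ * _).
rewrite [RHS]mulrCA; congr (_ * _); rewrite /opar /lo /hi /= -!signr_addb.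
by case: (par _); case: (par _); case: (par _); case: (par _).
Qed.

Let sum3 (G : P -> W) : \sum_t G t = \sum_i \sum_j \sum_k G (i, j, k).
Proof. by rewrite [RHS]pair_bigA [RHS]pair_bigA; apply: eq_bigr => [[[i j] k]]. Qed.

Let sum_lo p (G : P -> W) : \sum_(u | p == lo u) G u = \sum_j G (p.1, j, p.2).
Proof.
rewrite big_mkcond sum3 (bigD1 p.1) //= [X in _ + X]big1 ?addr0.
  apply: eq_bigr => j _; rewrite (bigD1 p.2) //= big1 ?addr0.
    by rewrite /lo /= -surjective_pairing eqxx.
  by move=> k hk; rewrite /lo /= -pair_eqE /pair_eq /= [_ == k]eq_sym (negPf hk) andbF.
move=> i hi; rewrite big1 // => j _; rewrite big1 // => k _.
by rewrite /lo /= -pair_eqE /pair_eq /= [_ == i]eq_sym (negPf hi).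
Qed.

Let osc_mainE x y f :
  osc_main x y f = \sum_t (\sum_l r x t.1.1 l * r y l t.1.2) *: cr (lo t) (tan (hi t) f).
Proof.
rewrite /osc_main !sum3; apply: eq_bigr => i _.
transitivity (\sum_l \sum_k \sum_j (r x i l * r y l j) *: cr (i, k) (tan (j, k) f)).
  apply: eq_bigr => l _; apply: eq_bigr => k _.
  rewrite -(sum_lo (l, k) (fun u => (r x i u.1.1 * rc y u) *: cr (i, k) (tan (hi u) f))).
  rewrite [RHS]big_mkcond; apply: eq_bigr => u _ /=.
  rewrite /hi /=; case: eqP => [e|_]; last by rewrite mulr0 scale0r.
  by rewrite mulr1 /rc /=; case: e => ->.
rewrite exchange_big [RHS]exchange_big; apply: eq_bigr => k _ /=.
rewrite exchange_big; apply: eq_bigr => j _ /=.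
by rewrite scaler_suml.
Qed.

Lemma osc_br a b x y f : homog (@ls_ev _ L) a x -> homog (@ls_ev _ L) b y ->
  osc x (osc y f) = (-1) ^+ (a && b) *: osc y (osc x f) + osc (ls_br x y) f.
Proof.
move=> hx hy; rewrite !osc_comp (osc_rest_sym f hx hy) scalerDr addrAC; congr (_ + _).
rewrite !osc_mainE /osc scaler_sumr -big_split; apply: eq_bigr => t _ /=.
rewrite scalerA -scalerDl; congr (_ *: _).
by rewrite /rc (r_br _ _ hx hy) addrC subrK.
Qed.
End Oscillator.

(** * Ordered monomials in the enveloping algebra *)

Section Degree.
Variable T : finType.
Implicit Types (m : mon T) (a : T).

Definition mdeg m := (\sum_a m a)%N.
Lemma mdeg_upd m a k : (mdeg (upd m a k) + m a = mdeg m + k)%N.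
Proof.
rewrite /mdeg (bigD1 a) //= upd_eq [in RHS](bigD1 a) //=.
rewrite (eq_bigr m) => [|b hb]; last by rewrite upd_neq.
by rewrite addnC (addnC k) addnA.
Qed.

Definition incr m a : mon T := upd m a (m a).+1.
Lemma mdeg_incr m a : mdeg (incr m a) = (mdeg m).+1.
Proof. by have := mdeg_upd m a (m a).+1; rewrite /incr; lia. Qed.
Definition valid (par : pred T) m := [forall a, par a ==> (m a <= 1)%N].
Definition supported (B : pred T) m := [forall a, (0 < m a)%N ==> B a].
Lemma supported_incr (B : pred T) m a : B a -> supported B m -> supported B (incr m a).
Proof.
move=> ha /forallP h; apply/forallP => b; rewrite ffunE.
by case: eqP => [->|_]; rewrite ?ha ?implybT //; apply: h.
Qed.
Lemma valid_upd (par : pred T) m a k :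
  valid par m -> (par a -> (k <= 1)%N) -> valid par (upd m a k).
Proof.
move=> /forallP h ha; apply/forallP => b; rewrite ffunE; case: eqP => [->|_]; last exact: h.
by apply/implyP.
Qed.

End Degree.

Section Words.
Variables (T : finType) (ts : seq T).
Hypothesis ts_uniq : uniq ts.
Hypothesis ts_all : forall a, a \in ts.
Implicit Types (m : mon T) (w : seq T) (a b : T).

Definition before a b := (index a ts < index b ts)%N.
Lemma before_irr : irreflexive before. Proof. by move=> a; apply: ltnn. Qed.
Lemma before_tot a b : a != b -> before a b = ~~ before b a.
Proof.
move=> ab; rewrite /before -leqNgt ltn_neqAle; case: eqP => // h.
by case/eqP: ab; rewrite -(nth_index a (ts_all a)) h nth_index.
Qed.

Definition mword m : seq T := flatten [seq nseq (m a) a | a <- ts].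

Lemma big_ts (P : pred T) (G : T -> nat) : (\sum_(a <- ts | P a) G a = \sum_(a | P a) G a)%N.
Proof.
apply: perm_big; apply: uniq_perm; rewrite ?index_enum_uniq //.
by move=> a; rewrite ts_all mem_index_enum.
Qed.

Lemma count_flatten_nseq (P : pred T) m s :
  count P (flatten [seq nseq (m a) a | a <- s]) = (\sum_(a <- s | P a) m a)%N.
Proof.
elim: s => [|a s IH]; first by rewrite big_nil.
by rewrite /= count_cat IH count_nseq big_cons; case: (P a) => //=; rewrite mul1n.
Qed.
Lemma count_mword (P : pred T) m : count P (mword m) = (\sum_(a | P a) m a)%N.
Proof. by rewrite /mword count_flatten_nseq big_ts. Qed.
Lemma size_mword m : size (mword m) = mdeg m.
Proof. by rewrite -count_predT count_mword. Qed.
Lemma mem_flatten_nseq m s a :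
  (a \in flatten [seq nseq (m b) b | b <- s]) = (a \in s) && (0 < m a)%N.
Proof.
elim: s => [|b s IH] //=; rewrite mem_cat IH mem_nseq inE.
by have [->|_] := eqVneq a b; rewrite ?andbT ?andbF //=; case: (0 < m b)%N; rewrite ?andbF.
Qed.
Lemma mem_mword m a : (a \in mword m) = (0 < m a)%N.
Proof. by rewrite mem_flatten_nseq ts_all. Qed.
(** The letters around the block of [a] do not depend on its length, so the exponent of [a] can be
    changed in place; the odd letters of [W1] give the exponent in [sgn]. *)
Lemma mword_split (par : pred T) m a : exists W1 W2,
  [/\ forall k, mword (upd m a k) = W1 ++ nseq k a ++ W2,
      count par W1 = (\sum_(b | before b a && par b) m b)%N, a \notin W1 & a \notin W2].
Proof.
have tsE : ts = take (index a ts) ts ++ a :: drop (index a ts).+1 ts.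
  by rewrite -{1}(cat_take_drop (index a ts) ts) (drop_nth a) ?index_mem // nth_index.
move: ts_uniq; rewrite {1}tsE cat_uniq /= negb_or => /and3P[u1 /andP[a1 _] /andP[a2 u2]].
exists (flatten [seq nseq (m b) b | b <- take (index a ts) ts]),
  (flatten [seq nseq (m b) b | b <- drop (index a ts).+1 ts]).
have eqf s k : a \notin s -> [seq nseq (upd m a k b) b | b <- s] = [seq nseq (m b) b | b <- s].
  move=> h; apply/eq_in_map => b hb; rewrite upd_neq //.
  by apply: contraNneq h => <-.
split=> [k|||]; rewrite ?mem_flatten_nseq ?(negPf a1) ?(negPf a2) //.
  by rewrite /mword [X in map _ X]tsE map_cat flatten_cat /= !eqf ?upd_eq.
rewrite count_flatten_nseq -big_ts [in RHS]tsE big_cat big_cons /= before_irr /=.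
rewrite [X in (_ + X)%N]big1_seq ?addn0.
  rewrite big_seq_cond [RHS]big_seq_cond; apply: eq_bigl => b.
  case h: (b \in take _ _) => //=; rewrite /before.
  by move: h; rewrite in_take_leq ?index_size // => ->.
move=> b /andP[/andP[h _] hb]; move: h; rewrite /before -in_take_leq ?index_size //.
move: ts_uniq; rewrite {1}tsE cat_uniq /= negb_or => /and3P[_ /andP[_ /hasPn/(_ b hb)]].
by move=> /negP.
Qed.

Lemma all_mword (B : pred T) m : all B (mword m) = supported B m.
Proof.
apply/allP/forallP => [h a|h a]; first by apply/implyP; rewrite -mem_mword; apply: h.
by rewrite mem_mword; apply/implyP/h.
Qed.

End Words.

(** [sb_seq] fixes the order of the letters in PBW monomials; it is kept as data because
    non-positive letters will have to precede positive ones. [sb_two] serves for squares of odd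
    elements, which are half of a bracket. *)
Record superBasis (F : fieldType) (L : lieSuper F) := SuperBasis {
  sb_idx : finType;
  sb_par : sb_idx -> bool;
  sb_elt : sb_idx -> L;
  sb_co : L -> sb_idx -> F;
  sb_seq : seq sb_idx;
  sb_two : 2%:R != 0 :> F;
  sb_homog : forall a, homog (@ls_ev _ L) (sb_par a) (sb_elt a);
  sb_co_lin : forall k x y t, sb_co (k *: x + y) t = k * sb_co x t + sb_co y t;
  sb_co_elt : forall a b, sb_co (sb_elt a) b = (a == b)%:R;
  sb_sum : forall x, x = \sum_t sb_co x t *: sb_elt t;
  sb_uniq : uniq sb_seq;
  sb_all : forall a, a \in sb_seq
}.

Section Monomials.
Variables (F : fieldType) (L : lieSuper F) (X : superBasis L).
Local Notation T := (sb_idx X).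
Local Notation par := (@sb_par F L X).
Local Notation e := (@sb_elt F L X).
Local Notation co := (@sb_co F L X).
Local Notation ts := (@sb_seq F L X).
Local Notation before := (before ts).
Local Notation mword := (mword ts).
Local Notation valid := (valid par).
Let ts_uniq := @sb_uniq F L X.
Let ts_all := @sb_all F L X.
Let e_par := @sb_homog F L X.
Let co_sum := @sb_sum F L X.
Local Notation U := (uea L).
Local Notation mon := (mon T).
Implicit Types (m : mon) (w : seq T) (a b : T) (B : pred T) (u v : U).

Definition wprod w : U := \prod_(a <- w) uiota (e a).
Definition mono m : U := wprod (mword m).

Lemma wprod_cat w w' : wprod (w ++ w') = wprod w * wprod w'.
Proof. exact: big_cat. Qed.
Lemma wprod_cons a w : wprod (a :: w) = uiota (e a) * wprod w.
Proof. exact: big_cons. Qed.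
Lemma wprod_nil : wprod [::] = 1. Proof. exact: big_nil. Qed.

Lemma uiota_sum x : uiota x = \sum_t co x t *: uiota (e t).
Proof. by rewrite {1}(co_sum x) linear_sum; apply: eq_bigr => t _; rewrite linearZ. Qed.

Lemma bracket_word a b : uiota (e a) * uiota (e b) =
  (-1) ^+ (par a && par b) *: (uiota (e b) * uiota (e a)) + uiota (ls_br (e a) (e b)).
Proof. exact: uiota_br. Qed.

Definition bclosed B := forall a b t, B a -> B b -> co (ls_br (e a) (e b)) t != 0 -> B t.

Definition Ulow B p : set U := linspan [set wprod w | w in [set w | all B w /\ (size w <= p)%N]].

Lemma Ulow_closed B p : lclosed (Ulow B p). Proof. exact: linspan_closed. Qed.
Lemma Ulow_word B p w : all B w -> (size w <= p)%N -> Ulow B p (wprod w).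
Proof. by move=> h h'; apply: linspan_in; exists w. Qed.
Lemma Ulow_leq B p q u : (p <= q)%N -> Ulow B p u -> Ulow B q u.
Proof.
move=> pq; apply: linspan_sub => [|_ [w [hw hs] <-]]; first exact: Ulow_closed.
by apply: Ulow_word => //; apply: leq_trans pq.
Qed.
Lemma UlowM B p q u v : Ulow B p u -> Ulow B q v -> Ulow B (p + q) (u * v).
Proof.
move=> hu hv; move: u hu; apply: linspan_sub => [|_ [w [hw hs] <-]].
  by split=> [|a x y hx hy]; rewrite /= ?mul0r ?mulrDl -?scalerAl;
    case: (Ulow_closed B (p + q)) => // _; apply.
move: v hv; apply: linspan_sub => [|_ [w' [hw' hs'] <-]].
  by split=> [|a x y hx hy]; rewrite /= ?mulr0 ?mulrDr -?scalerAr;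
    case: (Ulow_closed B (p + q)) => // _; apply.
rewrite -wprod_cat; apply: Ulow_word; first by rewrite all_cat hw hw'.
by rewrite size_cat leq_add.
Qed.

Lemma Ulow_br B a b : bclosed B -> B a -> B b -> Ulow B 1 (uiota (ls_br (e a) (e b))).
Proof.
move=> hB ha hb; rewrite uiota_sum; apply: lclosed_sum => [|t _]; first exact: Ulow_closed.
have [->|ht] := eqVneq (co (ls_br (e a) (e b)) t) 0.
  by rewrite scale0r; case: (Ulow_closed B 1).
apply: lclosedZ; first exact: Ulow_closed.
have -> : uiota (e t) = wprod [:: t] by rewrite /wprod big_seq1.
by apply: Ulow_word => //=; rewrite (hB _ _ _ ha hb ht).
Qed.

(** Each exchange with a letter of [w] leaves a bracket, that is, one letter in place of two; so all
    the remainders have length at most [size w]. *)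
Lemma move_letter B a w : bclosed B -> B a -> all B w ->
  Ulow B (size w) (uiota (e a) * wprod w
    - (-1) ^+ (par a * count par w) *: (wprod w * uiota (e a))).
Proof.
move=> hB ha; elim: w => [_|b w IH /= /andP[hb hw]].
  rewrite wprod_nil mulr1 mul1r /= muln0 scale1r subrr.
  by case: (Ulow_closed B 0).
rewrite !wprod_cons; set ea := uiota (e a); set eb := uiota (e b).
pose s : F := (-1) ^+ (par a && par b); pose t : F := (-1) ^+ (par a * count par w).
have -> : ea * (eb * wprod w) - ((-1) ^+ (par a * (par b + count par w)) : F) *: (eb * wprod w * ea)
  = uiota (ls_br (e a) (e b)) * wprod w + s *: (eb * (ea * wprod w - t *: (wprod w * ea))).
  rewrite mulrA bracket_word -/ea -/eb -/s mulnDr exprD -/t.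
  have -> : (-1) ^+ (par a * par b) = s by rewrite /s mulnb.
  rewrite mulrDl mulrBr scalerBr -!scalerAl -!scalerAr !mulrA scalerA.
  by rewrite [X in X - _]addrC -addrA.
apply: lclosedD; first exact: Ulow_closed.
  by rewrite -[(size w).+1]add1n; apply: UlowM; [apply: Ulow_br | apply: Ulow_word].
apply: lclosedZ; first exact: Ulow_closed.
rewrite -[(size w).+1]add1n; apply: UlowM; last exact: IH.
have -> : eb = wprod [:: b] by rewrite /wprod big_seq1.
by apply: Ulow_word => //=; rewrite hb.
Qed.

(* The leading term of e_a e^m is the product by the generator in the
   supersymmetric algebra. *)
Lemma insert_letter B a m : bclosed B -> B a -> supported B m -> valid m ->
  Ulow B (mdeg m) (uiota (e a) * mono m
    - (if par a && (0 < m a)%N then 0 else sgn F par before a m *: mono (incr m a))).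
Proof.
move=> hB ha sm vm; have [W1 [W2 [hW cW n1 n2]]] := mword_split ts_uniq ts_all par m a.
have hm : mword m = W1 ++ nseq (m a) a ++ W2 by rewrite -hW upd_id.
have sW : all B (mword m) by rewrite (all_mword ts_all).
move: (sW); rewrite hm !all_cat => /and3P[b1 ba b2].
have szm : mdeg m = (size W1 + (m a + size W2))%N.
  by rewrite -(size_mword ts_uniq ts_all) hm !size_cat size_nseq.
set t := (X in _ - X).
have hs : sgn F par before a m = (-1) ^+ (par a * count par W1) by rewrite cW.
pose V := wprod (nseq (m a) a ++ W2).
have hV : Ulow B (m a + size W2) V.
  by apply: Ulow_word; rewrite ?all_cat ?ba ?b2 ?size_cat ?size_nseq.
have h1 := move_letter hB ha b1.
rewrite -hs in h1.
have e1 : uiota (e a) * mono m = (uiota (e a) * wprod W1 - sgn F par before a m *: (wprod W1 * uiota (e a))) * V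
   + sgn F par before a m *: (wprod W1 * (uiota (e a) * V)).
  by rewrite mulrBl -scalerAl !mulrA subrK /mono hm wprod_cat mulrA.
have cl := Ulow_closed B (mdeg m).
rewrite e1 -addrA; apply: lclosedD => //; first by rewrite szm; apply: UlowM.
rewrite /t; case: ifP => [/andP[pa ma]|hma]; last first.
  suff -> : wprod W1 * (uiota (e a) * V) = mono (incr m a) by rewrite subrr; case: cl.
  by rewrite /mono /incr hW -wprod_cons -wprod_cat.
have {}ma : m a = 1%N.
  by move: vm => /forallP/(_ a); rewrite pa /=; move: ma; case: (m a) => [|[|]].
rewrite subr0; apply: lclosedZ => //.
rewrite szm; apply: UlowM; first exact: Ulow_word.
rewrite /V ma /= wprod_cons mulrA.
(* For odd [a] the defining relation of [e a] with itself reads 2 e_a^2 = [e_a, e_a], so that a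
   repeated odd letter lowers the degree. *)
have -> : uiota (e a) * uiota (e a) = 2%:R^-1 *: uiota (ls_br (e a) (e a)).
  have := bracket_word a a; rewrite pa /= expr1 scaleN1r => h.
  have : 2%:R *: (uiota (e a) * uiota (e a)) = uiota (ls_br (e a) (e a)).
    by rewrite scaler_nat mulr2n {1}h addrAC addNr add0r.
  by move=> <-; rewrite scalerA mulVf ?scale1r //; exact: sb_two X.
rewrite -scalerAl; apply: lclosedZ; first exact: Ulow_closed.
by apply: UlowM; [apply: Ulow_br | apply: Ulow_word].
Qed.

Definition Uspan B p : set U :=
  linspan [set mono m | m in [set m | [/\ valid m, supported B m & (mdeg m <= p)%N]]].
Lemma Uspan_closed B p : lclosed (Uspan B p). Proof. exact: linspan_closed. Qed.
Lemma Uspan_leq B p q u : (p <= q)%N -> Uspan B p u -> Uspan B q u.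
Proof.
move=> pq; apply: linspan_sub => [|_ [m [vm sm hm] <-]]; first exact: Uspan_closed.
by apply: linspan_in; exists m => //; split=> //; apply: leq_trans pq.
Qed.

(** Sort the tail of the word by induction, then insert the first letter: the error of
    [insert_letter] consists of shorter words. *)
Lemma Ulow_span B p : bclosed B -> Ulow B p `<=` Uspan B p.
Proof.
move=> hB; suff H : forall w, all B w -> (size w <= p)%N -> Uspan B p (wprod w).
  by apply: linspan_sub => [|_ [w [hw hs] <-]]; [apply: Uspan_closed | apply: H].
elim: p => [|p IH] w hw hs.
  have -> : w = [::] by apply: size0nil; lia.
  apply: linspan_in; exists 0; first split.
  - by apply/forallP => a; rewrite ffunE implybT.
  - by apply/forallP => a; rewrite ffunE.
  - by rewrite /mdeg big1 // => a _; rewrite ffunE.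
  - rewrite /mono; suff -> : mword 0 = [::] by [].
    by apply: size0nil; rewrite (size_mword ts_uniq ts_all) /mdeg big1 // => a _; rewrite ffunE.
have IH' : Ulow B p `<=` Uspan B p.
  by apply: linspan_sub => [|_ [w' [hw' hs'] <-]]; [apply: Uspan_closed | apply: IH].
case: w hw hs => [_ _|a w /= /andP[ha hw] hs].
  by apply: (@Uspan_leq B p) => //; apply: IH.
rewrite wprod_cons; have := IH w hw hs; move: (wprod w); apply: linspan_sub => [|_ [m [vm sm hm] <-]].
  by split=> [|c x y hx hy]; rewrite /= ?mulr0 ?mulrDr -?scalerAr;
    case: (Uspan_closed B p.+1) => // _; apply.
rewrite /= -[X in Uspan _ _ X](subrK (if par a && (0 < m a)%N then 0 else sgn F par before a m *: mono (incr m a))).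
have cl := Uspan_closed B p.+1.
apply: lclosedD => //.
  by apply: (@Uspan_leq B p) => //; apply: IH'; apply: Ulow_leq hm _; apply: insert_letter.
case: ifP => [_|hma]; first by case: cl.
apply: lclosedZ => //; apply: linspan_in; exists (incr m a) => //; split.
- apply: valid_upd => // pa; move: hma; rewrite pa /=; lia.
- exact: supported_incr.
- by rewrite mdeg_incr.
Qed.
End Monomials.

(** * Linear independence of the ordered monomials *)

Section CCR.
Variables (F : fieldType) (T : finType) (par : T -> bool) (ts : seq T).
Hypothesis char0 : forall k, k.+1%:R != 0 :> F.
Hypothesis ts_uniq : uniq ts.
Hypothesis ts_all : forall a, a \in ts.
Variables (W : lmodType F) (R D : T -> W -> W) (vac : W).
Hypothesis R_lin : forall a, linear (R a).
Hypothesis D_lin : forall a, linear (D a).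
Hypothesis D_R : forall a b f, D a (R b f) =
  (a == b)%:R *: f + (-1) ^+ (par a && par b) *: R b (D a f).
Hypothesis D_vac : forall a, D a vac = 0.
Hypothesis vac_neq0 : vac != 0.
Implicit Types (m : mon T) (w : seq T) (a b : T) (f : W).
Local Notation mword := (mword ts).
Local Notation sgn := (sgn F par (before ts)).

HB.instance Definition _ a := GRing.isLinear.Build F W W _ (R a) (R_lin a).
HB.instance Definition _ a := GRing.isLinear.Build F W W _ (D a) (D_lin a).

Definition Rw w f := foldr R f w.
Lemma Rw_linear w : linear (Rw w).
Proof.
elim: w => // a w IH c f g; rewrite -[LHS]/(R a (Rw w _)) IH.
by rewrite linearP.
Qed.
HB.instance Definition _ w := GRing.isLinear.Build F W W _ (Rw w) (Rw_linear w).
Lemma Rw_cat w w' f : Rw (w ++ w') f = Rw w (Rw w' f).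
Proof. exact: foldr_cat. Qed.
Let DZ a c f : D a (c *: f) = c *: D a f. Proof. exact: linearZ. Qed.
Let RZ a c f : R a (c *: f) = c *: R a f. Proof. exact: linearZ. Qed.
Let RwZ w c f : Rw w (c *: f) = c *: Rw w f. Proof. exact: linearZ. Qed.

Lemma D_skip a w f : a \notin w ->
  D a (Rw w f) = (-1) ^+ (par a * count par w) *: Rw w (D a f).
Proof.
elim: w => [_|b w IH] /=; first by rewrite muln0 scale1r.
rewrite inE negb_or => /andP[/negPf ab /IH h].
by rewrite D_R ab scale0r add0r h RZ scalerA mulnDr exprD mulnb.
Qed.

Definition mult a k : F := (if par a then (0 < k)%N : nat else k)%:R.

Lemma D_pow a k f : (par a -> (k <= 1)%N) -> D a (Rw (nseq k a) f) =
  mult a k *: Rw (nseq k.-1 a) f + (-1) ^+ (par a * k) *: Rw (nseq k a) (D a f).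
Proof.
rewrite /mult; case pa: (par a) => hk.
  case: k hk => [|[|k]] hk /=; last by have := hk isT.
    by rewrite scale0r add0r scale1r.
  by rewrite D_R eqxx pa.
elim: k {hk} => [|k IH]; first by rewrite scale0r add0r scale1r.
rewrite /= D_R eqxx pa /= !scale1r IH scale1r linearD /= RZ addrA; congr (_ + _).
case: k {IH} => [|k]; first by rewrite scale0r addr0 scale1r.
by rewrite -[in RHS]natr1 scalerDl scale1r addrC.
Qed.

Lemma D_mono a m : valid par m -> D a (Rw (mword m) vac) =
  (mult a (m a) * sgn a m) *: Rw (mword (upd m a (m a).-1)) vac.
Proof.
move=> /forallP/(_ a)/implyP vm.
have [W1 [W2 [hW cW n1 n2]]] := @mword_split T ts ts_uniq ts_all par m a.
rewrite -{1}(upd_id m a) !hW !Rw_cat D_skip // D_pow // D_skip // D_vac.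
rewrite !linear0 ?scaler0 ?linear0 ?scaler0 addr0 RwZ scalerA mulrC.
by rewrite /sgn -cW.
Qed.

Lemma mult_neq0 a k : (0 < k)%N -> mult a k != 0.
Proof.
by rewrite /mult; case: (par a) => [->|]; [rewrite oner_eq0|case: k].
Qed.

(** Applying [D a] to a relation divides the monomials containing [a] by [a] and kills the others,
    with nonzero factors because the characteristic is 0 and the monomials are valid. So the degree
    drops, and only the constant monomial remains to be treated. *)
Lemma R_free d (s : seq (mon T)) (c : mon T -> F) : uniq s ->
  (forall m, m \in s -> valid par m) -> (forall m, m \in s -> (mdeg m <= d)%N) ->
  \sum_(m <- s) c m *: Rw (mword m) vac = 0 -> forall m, m \in s -> c m = 0.
Proof.
elim: d s c => [|d IH] s c us vs ds hs.
  have s0 m : m \in s -> m = 0.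
    move=> /ds h; apply/ffunP => a; rewrite ffunE.
    by move: h; rewrite /mdeg (bigD1 a) //=; lia.
  move=> m hm; move: hs; rewrite (bigD1_seq m) //= big1_seq ?addr0.
    rewrite (s0 m hm); have -> : mword 0 = [::].
      by apply: size0nil; rewrite (@size_mword _ ts) // /mdeg big1 // => a _; rewrite ffunE.
    by move=> /eqP; rewrite scaler_eq0 (negPf vac_neq0) orbF => /eqP.
  by move=> i /andP[hi his]; rewrite (s0 i his) (s0 m hm) eqxx in hi.
have hpos m a : m \in s -> (0 < m a)%N -> c m = 0.
  move=> hm ma; pose dn (m' : mon T) := upd m' a (m' a).-1.
  pose s' := [seq dn m' | m' <- s & (0 < m' a)%N].
  pose c' (m' : mon T) := c (incr m' a) * (mult a (m' a).+1 * sgn a (incr m' a)).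
  have dnK m' : (0 < m' a)%N -> incr (dn m') a = m'.
    by move=> h; rewrite /incr /dn upd_upd upd_eq prednK // upd_id.
  suff : c' (dn m) = 0.
    rewrite /c' dnK //= upd_eq prednK // => /eqP.
    by rewrite mulrA !mulf_eq0 signr_eq0 (negPf (mult_neq0 a ma)) !orbF => /eqP.
  apply: (IH s' c').
  - rewrite map_inj_in_uniq ?filter_uniq // => m1 m2; rewrite !mem_filter.
    by move=> /andP[h1 _] /andP[h2 _] h; rewrite -(dnK m1) // h dnK.
  - move=> _ /mapP[m' hm' ->]; move: hm'; rewrite mem_filter => /andP[h /vs v].
    apply: valid_upd => // pa; by move: v => /forallP/(_ a); rewrite pa /=; case: (m' a) => [|[|]].
  - move=> _ /mapP[m' hm' ->]; move: hm'; rewrite mem_filter => /andP[h /ds v].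
    move: h v (mdeg_upd m' a (m' a).-1); rewrite -/(dn m').
    by move: (m' a) (mdeg m') (mdeg (dn m')) => x y z; lia.
  - have := congr1 (D a) hs; rewrite linear0 linear_sum /= => h.
    rewrite big_map big_filter -[RHS]h [RHS](bigID (fun m' : mon T => (0 < m' a)%N)) /=.
    rewrite [X in _ = _ + X]big1_seq ?addr0.
      rewrite big_seq_cond [RHS]big_seq_cond; apply: eq_bigr => m' /andP[/vs vm' h'].
      by rewrite DZ D_mono // scalerA /c' dnK // upd_eq prednK.
    move=> m' /andP[h' /vs vm']; rewrite DZ D_mono //.
    by move: h'; rewrite lt0n negbK => /eqP ->; rewrite /mult if_same mul0r scale0r scaler0.
  - by apply: map_f; rewrite mem_filter ma.
move=> m hm; have [m0|] := boolP [forall a, m a == 0%N]; last first.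
  by move=> /forallPn[a]; rewrite -lt0n; apply: hpos.
have {}m0 : m = 0 by apply/ffunP => a; rewrite ffunE; apply/eqP/(forallP m0).
move: hs; rewrite (bigD1_seq m) //= big1_seq ?addr0.
  rewrite m0; have -> : mword 0 = [::].
    by apply: size0nil; rewrite (@size_mword _ ts) // /mdeg big1 // => a _; rewrite ffunE.
  by move=> /eqP; rewrite scaler_eq0 (negPf vac_neq0) orbF => /eqP.
move=> i /andP[hi his]; have [i0|] := boolP [forall a, i a == 0%N].
  by case/eqP: hi; rewrite m0; apply/ffunP => a; rewrite ffunE; apply/eqP/(forallP i0).
by move=> /forallPn[a]; rewrite -lt0n => ha; rewrite (hpos i a) ?scale0r.
Qed.
End CCR.

(** * Independence of PBW monomials from an oscillator module *)

Definition pbw_free (F : fieldType) (L : lieSuper F) (X : superBasis L) :=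
  forall (s : seq (mon (sb_idx X))) (c : mon (sb_idx X) -> F), uniq s ->
  (forall m, m \in s -> valid (@sb_par F L X) m) ->
  \sum_(m <- s) c m *: mono m = 0 -> forall m, m \in s -> c m = 0.

Section OscillatorFree.
Variables (F : fieldType) (L : lieSuper F) (I K : finType) (ipar : I -> bool).
Variables (r : L -> I -> I -> F) (v0 : I -> K -> F).
Hypothesis char0 : forall k, k.+1%:R != 0 :> F.
Hypothesis r_lin : forall a x y i j, r (a *: x + y) i j = a * r x i j + r y i j.
Hypothesis r_par : forall b x i j, homog (@ls_ev _ L) b x -> r x i j != 0 ->
  b = ipar i (+) ipar j.
Hypothesis r_br : forall a b x y i j,
  homog (@ls_ev _ L) a x -> homog (@ls_ev _ L) b y ->
  r (ls_br x y) i j = \sum_l r x i l * r y l j - (-1) ^+ (a && b) * \sum_l r y i l * r x l j.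
Hypothesis v0_par : forall i k, v0 i k != 0 -> ipar i = false.
Variable X : superBasis L.
Local Notation T := (sb_idx X).
Local Notation par := (@sb_par F L X).
Local Notation e := (@sb_elt F L X).
Local Notation ts := (@sb_seq F L X).
Let ts_uniq := @sb_uniq F L X.
Let ts_all := @sb_all F L X.
Let e_par := @sb_homog F L X.
(** Linear forms dual to the vectors e_b.v0; they express that the orbit map x -> x.v0 is injective
    on L. *)
Variable xi : T -> I * K -> F.
Hypothesis xi_par : forall a p, xi a p != 0 -> ipar p.1 = par a.
Hypothesis xi_dual : forall a b,
  \sum_p xi a p * (\sum_j r (e b) p.1 j * v0 j p.2) = (a == b)%:R.

Local Notation J := (I * K)%type.
Local Notation W := (fock F J).
Local Notation cr := (crea (F := F) (opar ipar) (@enum_before J)).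
Local Notation an := (anni (F := F) (opar ipar) (@enum_before J)).
Local Notation rho := (osc ipar r v0).
Implicit Types (f : W) (a b : T).

Let irr := @enum_before_irr J.
Let tot := @enum_before_tot J.

(** [img a] is the vector e_a.v0, [R a] the multiplication by it and [D a] the derivation along the
    dual form [xi a]; they satisfy the relations assumed for [R_free]. *)
Let img a p : F := \sum_j r (e a) p.1 j * v0 j p.2.
Let R a f : W := \sum_p img a p *: cr p f.
Let D a f : W := \sum_p xi a p *: an p f.

Let img_par a p : img a p != 0 -> ipar p.1 = par a.
Proof.
move=> h; have [h0|] := boolP [forall j, r (e a) p.1 j * v0 j p.2 == 0].
  by case/eqP: h; apply: big1 => j _; apply/eqP/(forallP h0).
move=> /forallPn[j]; rewrite mulf_eq0 negb_or => /andP[hr hv].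
by rewrite (r_par (e_par a) hr) (v0_par hv) addbF.
Qed.

Let R_lin a : linear (R a).
Proof.
move=> c f g; rewrite /R scaler_sumr -big_split; apply: eq_bigr => p _ /=.
by rewrite linearP /= scalerDr !scalerA mulrC.
Qed.
Let D_lin a : linear (D a).
Proof.
move=> c f g; rewrite /D scaler_sumr -big_split; apply: eq_bigr => p _ /=.
by rewrite linearP /= scalerDr !scalerA mulrC.
Qed.

Let crZ p (c : F) f : cr p (c *: f) = c *: cr p f. Proof. exact: linearZ. Qed.
Let anZ p (c : F) f : an p (c *: f) = c *: an p f. Proof. exact: linearZ. Qed.

Let D_R a b f : D a (R b f) =
  (a == b)%:R *: f + (-1) ^+ (par a && par b) *: R b (D a f).
Proof.
have -> : D a (R b f) = \sum_p \sum_q (xi a p * img b q) *: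
    ((p == q)%:R *: f + (-1) ^+ (par a && par b) *: cr q (an p f)).
  rewrite /D; apply: eq_bigr => p _; rewrite /R linear_sum /= scaler_sumr.
  apply: eq_bigr => q _; rewrite anZ scalerA.
  have [->|hp] := eqVneq (xi a p) 0; first by rewrite !mul0r !scale0r.
  have [->|hq] := eqVneq (img b q) 0; first by rewrite !mulr0 !scale0r.
  by rewrite anni_crea // /opar (xi_par hp) (img_par hq).
under eq_bigr do under eq_bigr do rewrite scalerDr.
under eq_bigr do rewrite big_split /=.
rewrite big_split /=; congr (_ + _).
  rewrite -(xi_dual a b) scaler_suml; apply: eq_bigr => p _.
  rewrite (bigD1 p) //= eqxx scale1r big1 ?addr0 // => q hq.
  by rewrite eq_sym (negPf hq) scale0r scaler0.
rewrite exchange_big /R scaler_sumr; apply: eq_bigr => q _ /=.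
rewrite /D linear_sum /= !scaler_sumr; apply: eq_bigr => p _.
by rewrite crZ !scalerA; congr (_ *: _); ring.
Qed.

Let hproj d f : W := fun m => if mdeg m == d then f m else 0.
Let hproj_lin d : linear (hproj d).
Proof.
move=> c f g; apply/funext => m; rewrite /hproj !fockE.
by case: ifP => // _; rewrite mulr0 addr0.
Qed.
Let hprojZ d (c : F) f : hproj d (c *: f) = c *: hproj d f.
Proof. by apply/funext => m; rewrite /hproj !fockE; case: ifP => // _; rewrite mulr0. Qed.
Let hproj_sum (N : Type) (l : seq N) d (G : N -> W) :
  hproj d (\sum_(p <- l) G p) = \sum_(p <- l) hproj d (G p).
Proof.
elim/big_rec2: _ => [|x f g _ <-]; first by apply/funext => m; rewrite /hproj if_same.
by have := hproj_lin d 1 (G x) g; rewrite !scale1r.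
Qed.
Let bounded d f := forall m, f m != 0 -> (mdeg m <= d)%N.

Let bounded_closed d : lclosed (bounded d).
Proof.
split=> [m|a f g hf hg m]; first by rewrite fockE eqxx.
rewrite !fockE => h; have [f0|] := eqVneq (f m) 0; last exact: hf.
by apply: hg; move: h; rewrite f0 mulr0 add0r.
Qed.
Let hproj_cr d p f : hproj d.+1 (cr p f) = cr p (hproj d f).
Proof.
apply/funext => m; rewrite /hproj /crea /fop.
case E: (m p) => [|k] /=; first by rewrite !mul0r if_same.
have -> : (mdeg m == d.+1) = (mdeg (upd m p k) == d).
  by have := mdeg_upd m p k; rewrite E; lia.
by case: ifP; rewrite // mulr0.
Qed.
Let bounded_cr d p f : bounded d f -> bounded d.+1 (cr p f).
Proof.
move=> hf m; rewrite /crea /fop; case E: (m p) => [|k] /=; first by rewrite !mul0r eqxx.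
rewrite mulf_eq0 negb_or => /andP[_ /hf].
by have := mdeg_upd m p k; rewrite E; move: (mdeg _) (mdeg _) => x y; lia.
Qed.
Let bounded_cran d p q f : bounded d f -> bounded d (cr p (an q f)).
Proof.
move=> hf m; rewrite /crea /fop; case E: (m p) => [|k] /=; first by rewrite !mul0r eqxx.
rewrite mulf_eq0 negb_or => /andP[_]; rewrite /anni /fop mulf_eq0 negb_or => /andP[_ /hf].
have := mdeg_upd m p k; rewrite E.
have := mdeg_upd (upd m p k) q (upd m p k q).+1.
by move: (upd m p k q) (mdeg _) (mdeg _) (mdeg _) => x y z t; lia.
Qed.
Let hproj0 q d f : (q < d)%N -> bounded q f -> hproj d f = 0.
Proof.
move=> qd hf; apply/funext => m; rewrite /hproj fockE; case: eqP => // h.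
by have [->//|/hf] := eqVneq (f m) 0; rewrite h leqNgt qd.
Qed.

(** The purpose of the translation: an element acts as the multiplication by its orbit vector, which
    raises the degree, plus an operator that preserves the degree. *)
Let rhoE a f : rho (e a) f =
  R a f + \sum_t rc r (e a) t *: cr (lo t) (an (hi t) f).
Proof.
rewrite /osc addrC; transitivity (\sum_t (rc r (e a) t *: cr (lo t) (an (hi t) f) +
    (rc r (e a) t * v0 t.1.2 t.2) *: cr (lo t) f)).
  by apply: eq_bigr => t _; rewrite /tan linearD /= scalerDr crZ scalerA.
rewrite big_split /=; congr (_ + _).
rewrite /R /img; under [RHS]eq_bigr do rewrite scaler_suml.
rewrite !pair_bigA /=.
rewrite (reindex (fun t : I * K * I => (t.1.1, t.2, t.1.2))) /=; last first.
  by exists (fun t => (t.1.1, t.2, t.1.2)) => -[[i j] k].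
by apply: eq_bigr => [[[i k] j] _].
Qed.

(** By [rhoE] a letter raises the degree by at most one, and reaches the new top degree only through
    [R]. *)
Let act_word w : bounded (size w) (act rho (wprod w) (@vac F J)) /\
  hproj (size w) (act rho (wprod w) (@vac F J)) = Rw R w (@vac F J).
Proof.
pose hl := osc_linl ipar v0 r_lin; pose hr := @osc_linr F L I K ipar r v0.
pose hb := @osc_br F L I K ipar r v0 r_par r_br v0_par.
elim: w => [|a w [IHb IHp]] /=.
  rewrite wprod_nil act1 //; split=> [m|].
    by rewrite /vac; case: (eqVneq m 0) => [->|]; rewrite ?eqxx // /mdeg big1 // => i _; rewrite ffunE.
  apply/funext => m; rewrite /hproj /vac; case: (eqVneq m 0) => [->|]; last by rewrite if_same.
  by rewrite /mdeg big1 // => i _; rewrite ffunE.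
rewrite wprod_cons actM // act_iota // rhoE.
set f := act rho _ _ in IHb IHp *.
have hb1 : bounded (size w) (\sum_t rc r (e a) t *: cr (lo t) (an (hi t) f)).
  apply: (lclosed_sum _ (bounded_closed _)) => t _.
  by apply: (lclosedZ _ (bounded_closed _)); apply: bounded_cran.
have hb2 : bounded (size w).+1 (R a f).
  apply: (lclosed_sum _ (bounded_closed _)) => p _.
  by apply: (lclosedZ _ (bounded_closed _)); apply: bounded_cr.
split.
  by apply: (lclosedD (bounded_closed _)) => // m /hb1 /leq_trans; apply.
have := hproj_lin (size w).+1 1 (R a f) (\sum_t rc r (e a) t *: cr (lo t) (an (hi t) f)).
rewrite !scale1r => ->; rewrite [X in _ + X](@hproj0 (size w)) // addr0 -IHp /R.
by rewrite hproj_sum; apply: eq_bigr => p _; rewrite hprojZ hproj_cr.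
Qed.

Let top_free d (s : seq (mon T)) c : uniq s -> (forall m, m \in s -> valid par m) ->
  (forall m, m \in s -> (mdeg m <= d)%N) -> \sum_(m <- s) c m *: mono m = 0 ->
  forall m, m \in s -> mdeg m = d -> c m = 0.
Proof.
move=> us vs ds hs m ms md.
pose hl := osc_linl ipar v0 r_lin; pose hr := @osc_linr F L I K ipar r v0.
pose hb := @osc_br F L I K ipar r v0 r_par r_br v0_par.
have vac0 : (@vac F J : W) != 0.
  by apply/eqP => /(congr1 (fun f : W => f 0)) /eqP; rewrite /vac eqxx fockE oner_eq0.
have cvac : \sum_(m' <- [seq m' <- s | mdeg m' == d]) c m' *: Rw R (mword ts m') (@vac F J) = 0.
  have /(congr1 (fun u => hproj d (act rho u (@vac F J)))) := hs.
  have actZ (k : F) u v w : act rho (k *: u + v) w = k *: act rho u w + act rho v w.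
    exact: act_linl hl hr hb w k u v.
  have act0 w : act rho 0 w = 0.
    by have := actZ (-1) 0 0 w; rewrite scaler0 addr0 scaleN1r addNr.
  have -> : act rho (\sum_(m' <- s) c m' *: mono m') (@vac F J) =
      \sum_(m' <- s) c m' *: act rho (mono m') (@vac F J).
    by elim/big_rec2: _ => // x f g _ <-; rewrite actZ.
  rewrite hproj_sum act0 => h; rewrite big_filter; transitivity (hproj d 0); last first.
    by apply/funext => m'; rewrite /hproj if_same.
  rewrite -h big_mkcond /= big_seq [RHS]big_seq; apply: eq_bigr => m' hm'.
  have [hb1 hp1] := act_word (mword ts m').
  rewrite hprojZ; case: eqP => hd.
    by rewrite -hp1 (@size_mword _ ts) // hd.
  rewrite (@hproj0 (mdeg m')) ?scaler0 //; last by move: hb1; rewrite (@size_mword _ ts).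
  by rewrite ltn_neqAle ds // andbT; apply/eqP.
have mf : m \in [seq m' <- s | mdeg m' == d] by rewrite mem_filter md eqxx.
apply: (@R_free F T par ts char0 ts_uniq ts_all W R D (@vac F J) R_lin D_lin D_R _ vac0 d _ c) mf => //.
- by move=> a; rewrite /D big1 // => p _; rewrite anni_vac scaler0.
- exact: filter_uniq.
- by move=> m'; rewrite mem_filter => /andP[_ /vs].
- by move=> m'; rewrite mem_filter => /andP[_ /ds].
Qed.

Lemma osc_free : pbw_free X.
Proof.
move=> s c us vs.
have : forall m, m \in s -> (mdeg m <= \sum_(m' <- s) mdeg m')%N.
  by move=> m hm; rewrite (bigD1_seq m) //= leq_addr.
move: (\sum_(m' <- s) _)%N => d; elim: d s us vs => [|d IH] s us vs ds hs m ms.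
  by apply: (top_free us vs ds hs) => //; apply/eqP; rewrite -leqn0 ds.
have top := top_free us vs ds hs.
have [md|md] := eqVneq (mdeg m) d.+1; first exact: top.
apply: (IH [seq m' <- s | mdeg m' != d.+1]); rewrite ?filter_uniq ?mem_filter ?md //.
- by move=> m'; rewrite mem_filter => /andP[_ /vs].
- by move=> m'; rewrite mem_filter => /andP[h1 /ds h2]; rewrite -ltnS ltn_neqAle h1.
- rewrite big_filter -[RHS]hs [RHS](bigID (fun m' : mon T => mdeg m' != d.+1)) /=.
  rewrite [X in _ = _ + X]big1_seq ?addr0 // => m' /andP[]; rewrite negbK => /eqP h hm'.
  by rewrite top ?scale0r.
Qed.
End OscillatorFree.

(** * Coordinates and symbols *)

Section Coordinates.
Variables (F : fieldType) (L : lieSuper F) (X : superBasis L).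
Hypothesis free : pbw_free X.
Local Notation T := (sb_idx X).
Local Notation par := (@sb_par F L X).
Local Notation e := (@sb_elt F L X).
Local Notation co := (@sb_co F L X).
Local Notation ts := (@sb_seq F L X).
Local Notation before := (before ts).
Local Notation valid := (valid par).
Let ts_uniq := @sb_uniq F L X.
Let ts_all := @sb_all F L X.
Let e_par := @sb_homog F L X.
Let co_sum := @sb_sum F L X.
Local Notation U := (uea L).
Local Notation mon := (mon T).
Implicit Types (m : mon) (w : seq T) (a b : T) (B : pred T) (u v : U).

Lemma bclosedT : bclosed (X := X) predT. Proof. by []. Qed.

Lemma Ulow_iota x : Ulow (X := X) predT 1 (uiota x).
Proof.
rewrite (uiota_sum X); apply: (lclosed_sum _ (Ulow_closed _ _)) => t _.
apply: (lclosedZ _ (Ulow_closed _ _)).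
have -> : uiota (e t) = wprod [:: t] by rewrite /wprod big_seq1.
exact: Ulow_word.
Qed.

Lemma Ulow_exhaust u : exists p, Ulow (X := X) predT p u.
Proof.
elim/uea_ind: u; elim=> [x|a|s [p hp] t [q hq]|s [p hp] t [q hq]].
- by exists 1%N; apply: Ulow_iota.
- exists 0%N; have -> : uea_pi (UCst L a) = a *: wprod (X := X) [::].
    by rewrite wprod_nil; apply/esym/(mulr1 (uea_cst L a)).
  by apply: (lclosedZ _ (Ulow_closed _ _)); apply: Ulow_word.
- exists (p + q)%N; have -> : uea_pi (UAdd s t) = uea_pi s + uea_pi t.
    by rewrite [RHS]uea_addE.
  by apply: (lclosedD (Ulow_closed _ _)); apply: Ulow_leq; [|exact: hp| |exact: hq]; lia.
- exists (p + q)%N; have -> : uea_pi (UMul s t) = uea_pi s * uea_pi t.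
    by rewrite [RHS]uea_mulE.
  exact: UlowM.
Qed.

(** The coefficients form a function on all monomials rather than a list, so that uniqueness is an
    equality of functions independent of the chosen finite support. *)
Definition expands u (c : mon -> F) := exists s : seq mon,
  [/\ uniq s, forall m, m \in s -> valid m, forall m, m \notin s -> c m = 0
    & u = \sum_(m <- s) c m *: mono m].

Lemma sum_support (V : lmodType F) (c : mon -> F) (f : mon -> V) (s t : seq mon) :
  uniq s -> uniq t -> {subset s <= t} -> (forall m, m \notin s -> c m = 0) ->
  \sum_(m <- t) c m *: f m = \sum_(m <- s) c m *: f m.
Proof.
move=> us ut st hc; rewrite (bigID (mem s)) /= [X in _ + X]big1 ?addr0; last first.
  by move=> m hm; rewrite hc // scale0r.
rewrite -big_filter; apply: perm_big; apply: uniq_perm; rewrite ?filter_uniq // => m.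
by rewrite mem_filter; case hm: (m \in s) => //=; rewrite st.
Qed.

Lemma expands_lin k u v c d : expands u c -> expands v d ->
  expands (k *: u + v) (fun m => k * c m + d m).
Proof.
move=> [s [us vs cs ->]] [t [ut vt dt ->]]; exists (undup (s ++ t)).
split; rewrite ?undup_uniq //.
- by move=> m; rewrite mem_undup mem_cat => /orP[/vs|/vt].
- move=> m; rewrite mem_undup mem_cat negb_or => /andP[/cs -> /dt ->].
  by rewrite mulr0 addr0.
under [RHS]eq_bigr do rewrite scalerDl -scalerA.
rewrite big_split -scaler_sumr /=; congr (_ *: _ + _).
- by apply/esym/sum_support; rewrite ?undup_uniq // => m; rewrite mem_undup mem_cat => ->.
- by apply/esym/sum_support; rewrite ?undup_uniq // => m; rewrite mem_undup mem_cat orbC => ->.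
Qed.

Lemma expands_mono m : valid m -> expands (mono m) (fun m' => (m' == m)%:R).
Proof.
move=> vm; exists [:: m]; split=> // [m'|m'|].
- by rewrite inE => /eqP ->.
- by rewrite inE => /negPf ->.
- by rewrite big_seq1 eqxx scale1r.
Qed.

Lemma expands0 : expands 0 (fun=> 0).
Proof. by exists [::]; split=> //; rewrite big_nil. Qed.

Lemma expands_ex u : exists c, expands u c.
Proof.
have [p hp] := Ulow_exhaust u.
have := Ulow_span bclosedT hp.
move: u {hp}; apply: linspan_sub => [|_ [m [vm _ _] <-]]; last first.
  by exists (fun m' => (m' == m)%:R); apply: expands_mono.
split=> [|k u v [c hc] [d hd]]; first by exists (fun=> 0); apply: expands0.
by exists (fun m => k * c m + d m); apply: expands_lin.
Qed.

Lemma expands_uniq u c d : expands u c -> expands u d -> c =1 d.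
Proof.
move=> hc hd m; have := expands_lin (-1) hc hd.
rewrite scaleN1r addNr => -[s [us vs hs h]].
have [ms|/hs] := boolP (m \in s); last by rewrite mulN1r addrC => /eqP; rewrite subr_eq0 => /eqP.
have := free us vs (esym h) ms.
by rewrite mulN1r addrC => /eqP; rewrite subr_eq0 => /eqP.
Qed.

Definition coord u : mon -> F := sval (cid (expands_ex u)).
Lemma coordP u : expands u (coord u). Proof. exact: svalP. Qed.
Lemma coord_lin k u v m : coord (k *: u + v) m = k * coord u m + coord v m.
Proof. exact: (expands_uniq (coordP _) (expands_lin k (coordP u) (coordP v))). Qed.
Lemma coord_mono m m' : valid m -> coord (mono m) m' = (m' == m)%:R.
Proof. by move=> vm; apply: (expands_uniq (coordP _) (expands_mono vm)). Qed.
Lemma coord0 m : coord 0 m = 0.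
Proof. exact: (expands_uniq (coordP _) expands0). Qed.
Lemma coordD u v m : coord (u + v) m = coord u m + coord v m.
Proof. by have := coord_lin 1 u v m; rewrite scale1r mul1r. Qed.
Lemma coordZ k u m : coord (k *: u) m = k * coord u m.
Proof. by have := coord_lin k u 0 m; rewrite addr0 coord0 addr0. Qed.
Lemma coordB u v m : coord (u - v) m = coord u m - coord v m.
Proof. by rewrite coordD -scaleN1r coordZ mulN1r. Qed.
Lemma coord_valid u m : coord u m != 0 -> valid m.
Proof.
have [s [_ vs cs _]] := coordP u; have [/vs //|/cs ->] := boolP (m \in s).
by rewrite eqxx.
Qed.
Lemma coord_inj u : (forall m, coord u m = 0) -> u = 0.
Proof.
move=> h; have [s [_ _ _ ->]] := coordP u.
by rewrite big1 // => m _; rewrite h scale0r.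
Qed.
Lemma coord_sum (N : Type) (l : seq N) (P : pred N) (f : N -> U) m :
  coord (\sum_(i <- l | P i) f i) m = \sum_(i <- l | P i) coord (f i) m.
Proof. by elim/big_rec2: _ => [|i x y _ <-]; rewrite ?coord0 ?coordD. Qed.

(** Because coordinates are unique, this is the span of the valid monomials satisfying [Q]. All the
    subspaces used below (degree, height, J'(nu), subalgebras) are put in this form and compared
    coordinatewise. *)
Definition cspan (Q : mon -> Prop) : set U := [set u | forall m, coord u m != 0 -> Q m].

Lemma cspan_closed Q : lclosed (cspan Q).
Proof.
split=> [m|k u v hu hv m]; first by rewrite coord0 eqxx.
rewrite coord_lin => h; have [h0|] := eqVneq (coord u m) 0; last exact: hu.
by apply: hv; move: h; rewrite h0 mulr0 add0r.
Qed.
Lemma cspan_mono (Q : mon -> Prop) m : valid m -> Q m -> cspan Q (mono m).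
Proof. by move=> vm qm m'; rewrite coord_mono //; case: (eqVneq m' m) => [->|_]; rewrite ?eqxx. Qed.
Lemma cspan_ind (Q : mon -> Prop) (P : set U) : lclosed P ->
  (forall m, valid m -> Q m -> P (mono m)) -> cspan Q `<=` P.
Proof.
move=> hP h u hu; have [s [_ vs _ ->]] := coordP u.
apply: (lclosed_sum_seq hP) => m /vs vm; have [->|hm] := eqVneq (coord u m) 0.
  by rewrite scale0r; case: hP.
by apply: (lclosedZ _ hP); apply: h => //; apply: hu.
Qed.
Lemma cspan_sub (Q Q' : mon -> Prop) : (forall m, Q m -> Q' m) -> cspan Q `<=` cspan Q'.
Proof. by move=> h u hu m /hu/h. Qed.

Lemma Uspan_cspan B p : Uspan (X := X) B p `<=` cspan (fun m => supported B m /\ (mdeg m <= p)%N).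
Proof.
apply: linspan_sub => [|_ [m [vm sm hm] <-]]; first exact: cspan_closed.
exact: cspan_mono.
Qed.
Lemma Ulow_cspan B p : bclosed (X := X) B ->
  Ulow (X := X) B p `<=` cspan (fun m => supported B m /\ (mdeg m <= p)%N).
Proof.
by move=> hB u /(Ulow_span hB) /Uspan_cspan.
Qed.

Definition degle p := cspan (fun m => (mdeg m <= p)%N).

Lemma degleE p : degle p = Ulow (X := X) predT p.
Proof.
apply/seteqP; split => u.
  apply: cspan_ind => [|m vm hm]; first exact: Ulow_closed.
  by apply: Ulow_word; rewrite ?all_predT ?(@size_mword _ ts).
by move=> /(Ulow_cspan bclosedT); apply: cspan_sub => m [].
Qed.

Lemma Ufilt_degle p : Ufilt p = degle p.
Proof.
rewrite degleE; apply/seteqP; split.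
  apply: linspan_sub => [|_ [s hs <-]]; first exact: Ulow_closed.
  apply: Ulow_leq hs _; elim: s => [|x s IH].
    by rewrite big_nil -(wprod_nil X); apply: Ulow_word.
  by rewrite big_cons /= -[(size s).+1]add1n; apply: UlowM => //; apply: Ulow_iota.
apply: linspan_sub => [|_ [w [_ hw] <-]]; first exact: linspan_closed.
apply: linspan_in; exists (map e w); first by rewrite /= size_map.
by rewrite big_map.
Qed.

Local Notation cr := (crea (F := F) par before).
Let irr := @before_irr T ts.
Let tot := @before_tot T ts ts_all.

(** The leading symbol when u has degree p, read in Fock space so that creation and annihilation
    operators apply to it. *)
Definition sym p u : fock F T := fun m => if mdeg m == p then coord u m else 0.
Lemma sym_lin p k u v : sym p (k *: u + v) = k *: sym p u + sym p v.
Proof.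
apply/funext => m; rewrite fockD fockZ /sym; case: ifP => _; first exact: coord_lin.
by rewrite mulr0 addr0.
Qed.
Lemma symD p u v : sym p (u + v) = sym p u + sym p v.
Proof. by have := sym_lin p 1 u v; rewrite !scale1r. Qed.
Lemma sym0 p : sym p 0 = 0.
Proof. by apply/funext => m; rewrite /sym coord0 if_same. Qed.
Lemma symZ p k u : sym p (k *: u) = k *: sym p u.
Proof. by have := sym_lin p k u 0; rewrite sym0 !addr0. Qed.
Lemma sym_sum p (N : Type) (l : seq N) (f : N -> U) :
  sym p (\sum_(i <- l) f i) = \sum_(i <- l) sym p (f i).
Proof. by elim/big_rec2: _ => [|i x y _ <-]; rewrite ?sym0 ?symD. Qed.
Lemma sym_low p q u : (q < p)%N -> degle q u -> sym p u = 0.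
Proof.
move=> qp hu; apply/funext => m; rewrite /sym; case: eqP => // hm.
by have [//|/hu] := eqVneq (coord u m) 0; rewrite hm leqNgt qp.
Qed.

Definition delta m : fock F T := fun m' => (m' == m)%:R.

Lemma sym_mono m p : valid m -> sym p (mono m) = (mdeg m == p)%:R *: delta m.
Proof.
move=> vm; apply/funext => m'; rewrite fockZ /sym coord_mono // /delta.
by have [->|_] := eqVneq m' m; case: (mdeg _ == p); rewrite ?mulr1 ?mulr0.
Qed.

Lemma crea_delta a m : cr a (delta m) =
  (if par a && odd (m a) then 0 else sgn F par before a m) *: delta (incr m a).
Proof.
apply/funext => m'; rewrite fockZ /crea /fop /delta.
have [->|hm'] := eqVneq m' (incr m a).
  rewrite /incr upd_eq upd_upd upd_id eqxx sgn_upd_self // /cr_coef /=.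
  by case: (par a) => /=; [case: (odd _)|]; rewrite /= ?(mul0r, mul1r, mulr1).
rewrite mulr0; case E: (m' a) => [|k] /=; first by rewrite mul0r mul0r.
case: eqP => [h|_]; last by rewrite mulr0.
by case/eqP: hm'; rewrite -h /incr upd_eq upd_upd -E upd_id.
Qed.

(** The error term of [insert_letter] has degree at most p and disappears in degree p + 1. *)
Lemma sym_letter p a u : degle p u -> sym p.+1 (uiota (e a) * u) = cr a (sym p u).
Proof.
move: u; apply: cspan_ind => [|m vm hm].
  split=> [|k u v hu hv]; first by rewrite mulr0 !sym0 linear0.
  by rewrite mulrDr -scalerAr !sym_lin hu hv linearP.
have := insert_letter bclosedT (isT : predT a)
  (_ : supported predT m) vm.
rewrite /supported; set t := (X in _ - X); move=> /(_ _)/[dup] h.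
have {}h : degle p (uiota (e a) * mono m - t).
  rewrite degleE; apply: Ulow_leq hm _; apply: h.
  by apply/forallP => b; rewrite implybT.
rewrite -[X in sym _ X](subrK t) symD (sym_low _ h) // add0r sym_mono // linearZ /= crea_delta.
have -> : par a && odd (m a) = par a && (0 < m a)%N.
  case pa: (par a) => //=.
  by move/forallP/(_ a): vm; rewrite pa; case: (m a) => [|[|]].
rewrite /t; case: ifP => [_|hma]; first by rewrite sym0 scale0r scaler0.
rewrite symZ sym_mono ?mdeg_incr ?eqSS; last first.
  by apply: valid_upd => // pa; move: hma; rewrite pa; case: (m a).
by move=> _; rewrite !scalerA; congr (_ *: _); exact: mulrC.
Qed.

Lemma sym_iota p x u : degle p u -> sym p.+1 (uiota x * u) = \sum_c co x c *: cr c (sym p u).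
Proof.
move=> hu; rewrite (uiota_sum X) mulr_suml sym_sum; apply: eq_bigr => c _.
by rewrite -scalerAl symZ sym_letter.
Qed.
End Coordinates.

(** * The adjoint action on symbols *)

Section SuperAdjoint.
Variables (F : fieldType) (L : lieSuper F) (X : superBasis L).
Hypothesis free : pbw_free X.
Local Notation U := (uea L).
Local Notation T := (sb_idx X).
Local Notation par := (@sb_par F L X).
Local Notation e := (@sb_elt F L X).
Local Notation co := (@sb_co F L X).
Local Notation ts := (@sb_seq F L X).
Local Notation before := (before ts).
Local Notation valid := (valid par).
Local Notation cr := (crea (F := F) par before).
Local Notation an := (anni (F := F) par before).
Local Notation sym := (@sym F L X).
Local Notation degle := (@degle F L X).
Local Notation wprod := (@wprod F L X).
Let irr := @before_irr T ts.
Let tot := @before_tot T ts (@sb_all F L X).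
Implicit Types (m : mon T) (w : seq T) (a b c t : T) (u v : U).

Lemma sb_co0 t : co 0 t = 0.
Proof. by have := @sb_co_lin F L X (-1) 0 0 t; rewrite scaler0 addr0 mulN1r addNr. Qed.
Lemma sb_coZ k x t : co (k *: x) t = k * co x t.
Proof. by have := @sb_co_lin F L X k x 0 t; rewrite addr0 sb_co0 addr0. Qed.
Lemma sb_coD x y t : co (x + y) t = co x t + co y t.
Proof. by have := @sb_co_lin F L X 1 x y t; rewrite scale1r mul1r. Qed.
Lemma sb_co_sum (N : Type) (l : seq N) (f : N -> L) t :
  co (\sum_(i <- l) f i) t = \sum_(i <- l) co (f i) t.
Proof. by elim/big_rec2: _ => [|i x y _ <-]; rewrite ?sb_co0 ?sb_coD. Qed.

Lemma sb_co_linear (f : L -> L) (om : T -> F) x t : linear f ->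
  (forall a, f (e a) = om a *: e a) -> co (f x) t = om t * co x t.
Proof.
move=> hf he; rewrite {1}(sb_sum X x).
have f0 : f 0 = 0 by have := hf (-1) 0 0; rewrite scaler0 addr0 scaleN1r addNr.
have -> : f (\sum_a co x a *: e a) = \sum_a (co x a * om a) *: e a.
  elim/big_rec2: _ => // a u v _ <-; rewrite hf he scalerA //.
rewrite sb_co_sum (bigD1 t) //= big1 => [|a hat].
  by rewrite sb_coZ sb_co_elt eqxx mulr1 addr0 mulrC.
by rewrite sb_coZ sb_co_elt (negPf hat) mulr0.
Qed.

Lemma sb_co_par (b : bool) x t : homog (@ls_ev _ L) b x -> co x t != 0 -> par t = b.
Proof.
have hev : co (ls_ev x) t = (~~ par t)%:R * co x t.
  apply: (@sb_co_linear (@ls_ev _ L) (fun a => (~~ par a)%:R)); first exact: ls_ev_lin.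
  by move=> a; have := @sb_homog F L X a; case: (par a) => /= ->; rewrite ?scale0r ?scale1r.
move=> hx h; move: hev; case: b hx => /= ->; rewrite ?sb_co0.
  by case: (par t) => //= /esym/eqP; rewrite mul1r (negPf h).
by case: (par t) => //= /eqP; rewrite mul0r (negPf h).
Qed.

Lemma br_par (b : bool) y a t : homog (@ls_ev _ L) b y ->
  co (ls_br y (e a)) t != 0 -> par t = b (+) par a.
Proof. by move=> hy; apply: sb_co_par; exact: (ls_br_homog hy (sb_homog a)). Qed.

(** The formula of [ad], for an arbitrary Lie superalgebra. *)
Definition superad (y : L) u : U :=
  uiota y * u - (u * uiota (ls_ev y) + @uparity F L u * uiota (y - ls_ev y)).

Definition twist (b : bool) u : U := if b then uparity u else u.

Lemma uparity_word w : @uparity F L (wprod w) = (-1) ^+ (count par w) *: wprod w.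
Proof.
elim: w => [|a w IH] /=.
  rewrite wprod_nil scale1r; rewrite [LHS](uliftE (@uiota_lparity_lin F L) (@uiota_lparity_br F L)).
  by rewrite /= scale1r.
rewrite wprod_cons uparityM IH uparity_iota (lparity_homog (@sb_homog F L X a)) linearZ /=.
by rewrite -scalerAl -scalerAr scalerA exprD.
Qed.
Lemma uparity_iota_elt a : @uparity F L (uiota (e a)) = (-1) ^+ (par a) *: uiota (e a).
Proof. by rewrite uparity_iota (lparity_homog (@sb_homog F L X a)) linearZ. Qed.

Lemma twistM (b : bool) u v : twist b (u * v) = twist b u * twist b v.
Proof. by case: b => //=; apply: uparityM. Qed.

Lemma superadE (b : bool) y u : homog (@ls_ev _ L) b y ->
  superad y u = uiota y * u - twist b u * uiota y.
Proof.
by rewrite /superad; case: b => /= ->;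
  rewrite ?subr0 ?subrr linear0 mulr0 ?add0r ?addr0.
Qed.

Lemma superad_lin y : linear (superad y).
Proof.
move=> k u v; rewrite /superad uparity_lin mulrDr !mulrDl -!scalerAr -!scalerAl.
by rewrite [X in _ - X]addrACA -scalerDr opprD addrACA -scalerBr.
Qed.
Lemma superad0 y : superad y 0 = 0.
Proof. by have := superad_lin y (-1) 0 0; rewrite scaler0 addr0 scaleN1r addNr. Qed.
Lemma superadD y u v : superad y (u + v) = superad y u + superad y v.
Proof. by have := superad_lin y 1 u v; rewrite !scale1r. Qed.

Lemma superad_letter (b : bool) y a u : homog (@ls_ev _ L) b y ->
  superad y (uiota (e a) * u) =
  uiota (ls_br y (e a)) * u + (-1) ^+ (b && par a) *: (uiota (e a) * superad y u).
Proof.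
move=> hy; rewrite !(superadE _ hy) twistM mulrA (uiota_br hy (@sb_homog F L X a)).
have -> : twist b (uiota (e a)) = (-1) ^+ (b && par a) *: uiota (e a).
  by rewrite /twist; case: b {hy}; rewrite ?scale1r // uparity_iota_elt.
rewrite mulrDl mulrBr scalerBr -!scalerAl !mulrA.
by rewrite [X in X - _]addrC addrA.
Qed.

(* The action of ad y on the supersymmetric algebra. *)
Definition Ad y (f : fock F T) : fock F T :=
  \sum_t \sum_c co (ls_br y (e t)) c *: cr c (an t f).

Let crZ a (k : F) f : cr a (k *: f) = k *: cr a f. Proof. exact: linearZ. Qed.

Lemma Ad_lin y : linear (Ad y).
Proof.
move=> k f g; rewrite /Ad scaler_sumr -big_split; apply: eq_bigr => t _ /=.
rewrite scaler_sumr -big_split; apply: eq_bigr => c _ /=.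
by rewrite !linearP.
Qed.
Lemma Ad0 y : Ad y 0 = 0.
Proof. by have := Ad_lin y (-1) 0 0; rewrite scaler0 addr0 scaleN1r addNr. Qed.

(** [Ad y] is a superderivation: moving [an t] past [cr a] either contracts the two, which gives the
    bracket with [e a], or produces a sign. *)
Lemma Ad_crea (b : bool) y a f : homog (@ls_ev _ L) b y ->
  Ad y (cr a f) = \sum_c co (ls_br y (e a)) c *: cr c f
    + (-1) ^+ (b && par a) *: cr a (Ad y f).
Proof.
move=> hy; rewrite /Ad linear_sum scaler_sumr /=.
transitivity (\sum_t (\sum_c ((t == a)%:R * co (ls_br y (e t)) c) *: cr c f
    + (-1) ^+ (b && par a) *: cr a (\sum_c co (ls_br y (e t)) c *: cr c (an t f)))).
  apply: eq_bigr => t _; rewrite linear_sum scaler_sumr -big_split; apply: eq_bigr => c _ /=.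
  have [->|h] := eqVneq (co (ls_br y (e t)) c) 0.
    by rewrite mulr0 !scale0r linear0 scaler0 addr0.
  rewrite anni_crea // linearD /= !crZ scalerDr !scalerA; congr (_ *: _ + _).
    by rewrite mulrC.
  rewrite (@crea_anti F T par before tot c a) !scalerA (br_par hy h); congr (_ *: _).
  rewrite -mulrA -signr_addb mulrC; congr (_ * _).
  by case: (par t); case: (par a); case: (b).
rewrite big_split /=; congr (_ + _); rewrite (bigD1 a) //= [X in _ + X]big1 ?addr0.
  by apply: eq_bigr => c _; rewrite eqxx mul1r.
by move=> t hta; apply: big1 => c _; rewrite (negPf hta) mul0r scale0r.
Qed.

(** Both [superad y] and [Ad y] are superderivations with the same values on letters
    ([superad_letter], [Ad_crea]), so they agree on symbols by induction on the word. *)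
Lemma superad_word (b : bool) y w : homog (@ls_ev _ L) b y ->
  degle (size w) (superad y (wprod w)) /\
  sym (size w) (superad y (wprod w)) = Ad y (sym (size w) (wprod w)).
Proof.
move=> hy; have dw (w' : seq T) : degle (size w') (wprod w').
  by rewrite (degleE free); apply: Ulow_word; rewrite ?all_predT.
elim: w => [|a w [IHd IHs]].
  rewrite wprod_nil (superadE _ hy); have -> : twist b 1 = 1.
    by case: b {hy} => //=; rewrite -(wprod_nil X) uparity_word scale1r.
  rewrite mulr1 mul1r subrr sym0 //; split; first by case: (cspan_closed free (fun m => (mdeg m <= 0)%N)).
  rewrite /Ad big1 // => t _; rewrite big1 // => c _.
  (* A derivation reads a coefficient of positive degree, where the symbol of degree 0 vanishes. *)
  suff -> : an t (sym 0 1) = 0 by rewrite linear0 scaler0.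
  apply/funext => m; rewrite /anni /fop /sym ifF ?mulr0 //; apply/negbTE.
  by have := mdeg_upd m t (m t).+1; move: (m t) (mdeg _) (mdeg _) => x z z' /=; lia.
rewrite wprod_cons (superad_letter _ _ hy) /=; split.
  apply: (lclosedD (cspan_closed free _)).
    rewrite -/(degle (size w).+1) (degleE free) -[(size w).+1]add1n; apply: UlowM.
      exact: Ulow_iota.
    by rewrite -(degleE free).
  apply: (lclosedZ _ (cspan_closed free _)).
  rewrite -/(degle (size w).+1) (degleE free) -[(size w).+1]add1n; apply: UlowM.
    exact: Ulow_iota.
  by rewrite -(degleE free).
rewrite symD // symZ // sym_iota // !sym_letter // IHs.
by rewrite (Ad_crea _ _ hy).
Qed.

Lemma sym_superad (b : bool) p y u : homog (@ls_ev _ L) b y -> degle p u ->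
  degle p (superad y u) /\ sym p (superad y u) = Ad y (sym p u).
Proof.
move=> hy; rewrite {1}(degleE free) => hu.
move: u hu; apply: linspan_sub => [|_ [w [_ hw] <-]].
  split=> [|k u v [hu hsu] [hv hsv]].
    rewrite /= superad0 sym0 // Ad0; split=> //.
    by case: (cspan_closed free (fun m => (mdeg m <= p)%N)).
  rewrite /= superad_lin !sym_lin // hsu hsv Ad_lin; split=> //.
  by case: (cspan_closed free (fun m => (mdeg m <= p)%N)) => _; apply.
have [hd hs] := superad_word w hy.
move: hw; rewrite leq_eqVlt => /orP[/eqP <- //|hw].
have dw : degle (size w) (wprod w).
  by rewrite (degleE free); apply: Ulow_word; rewrite ?all_predT.
rewrite /= !(@sym_low _ _ _ _ (size w)) // Ad0; split=> //.
by move: hd; apply: cspan_sub => m h; apply: leq_trans h (ltnW hw).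
Qed.
End SuperAdjoint.

(** * Weights of monomials and factorisation of PBW monomials *)

Section Weights.
Variables (F : fieldType) (L : lieSuper F) (X : superBasis L).
Hypothesis free : pbw_free X.
Local Notation U := (uea L).
Local Notation T := (sb_idx X).
Local Notation par := (@sb_par F L X).
Local Notation e := (@sb_elt F L X).
Local Notation co := (@sb_co F L X).
Local Notation ts := (@sb_seq F L X).
Local Notation valid := (valid par).
Local Notation coord := (@coord F L X).
Local Notation cspan := (@cspan F L X).
Local Notation wprod := (@wprod F L X).
Implicit Types (m : mon T) (w : seq T) (a b c t : T) (u v : U) (om : T -> F).

Definition is_weight (h : L) om := homog (@ls_ev _ L) false h /\
  forall t, ls_br h (e t) = om t *: e t.
Definition commutator (h : L) u : U := uiota h * u - u * uiota h.
Definition mweight om m : F := \sum_t (m t)%:R * om t.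
Definition wweight om w : F := \sum_(t <- w) om t.

Lemma commutator_lin h : linear (commutator h).
Proof.
move=> k u v; rewrite /commutator mulrDr mulrDl -scalerAr -scalerAl.
by rewrite opprD addrACA scalerBr.
Qed.

Lemma commutator_word h om w : is_weight h om ->
  commutator h (wprod w) = wweight om w *: wprod w.
Proof.
move=> [hh he]; rewrite /commutator /wweight; elim: w => [|a w IH].
  by rewrite wprod_nil big_nil mulr1 mul1r subrr scale0r.
have {}IH : uiota h * wprod w = (\sum_(t <- w) om t) *: wprod w + wprod w * uiota h.
  by rewrite -IH subrK.
rewrite wprod_cons big_cons mulrA (uiota_br hh (sb_homog a)) he scale1r linearZ /=.
rewrite mulrDl -mulrA IH mulrDr -scalerAr -scalerAl !mulrA.
by rewrite addrAC addrK scalerDl addrC.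
Qed.

Lemma wweight_mword om m : wweight om (mword ts m) = mweight om m.
Proof.
rewrite /wweight /mword /mweight big_flatten big_map.
have -> : \sum_t (m t)%:R * om t = \sum_(t <- ts) (m t)%:R * om t.
  apply: perm_big; apply: uniq_perm; rewrite ?index_enum_uniq ?sb_uniq //.
  by move=> t; rewrite sb_all mem_index_enum.
by apply: eq_bigr => t _; rewrite big_nseq -[LHS]/(iter _ _ _) iter_addr addr0 mulr_natl.
Qed.

(** Ordered monomials are eigenvectors of the commutator with h, so a weight condition on u is a
    condition on each monomial occurring in it. *)
Lemma coord_commutator h om u m : is_weight h om ->
  coord (commutator h u) m = mweight om m * coord u m.
Proof.
move=> hw; suff : [set v | coord (commutator h v) m = mweight om m * coord v m] u by [].
apply: (@cspan_ind F L X (fun=> True)) => [|m' vm' _|m' _] //.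
  split=> [|k v v' hv hv'].
    rewrite /= /commutator mulr0 mul0r subrr (coord0 free) //; ring.
  rewrite /= commutator_lin !(coord_lin free) hv hv'; ring.
rewrite /=; have -> : commutator h (mono m') = mweight om m' *: mono m'.
  by rewrite /mono (commutator_word _ hw) wweight_mword.
rewrite (coordZ free) (coord_mono free) //.
by case: (eqVneq m m') => [->|_]; rewrite ?mulr0.
Qed.

Lemma coord_word_weight h om w m : is_weight h om ->
  coord (wprod w) m != 0 -> mweight om m = wweight om w.
Proof.
move=> hw h0; have := coord_commutator (wprod w) m hw.
rewrite (commutator_word _ hw) (coordZ free) => /eqP.
by rewrite -subr_eq0 -mulrBl mulf_eq0 (negPf h0) orbF subr_eq0 => /eqP.
Qed.

Lemma br_weight h om a b t : is_weight h om ->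
  co (ls_br (e a) (e b)) t != 0 -> om t = om a + om b.
Proof.
move=> [hh he] h0.
have hl : co (ls_br h (ls_br (e a) (e b))) t = om t * co (ls_br (e a) (e b)) t.
  by apply: (sb_co_linear (f := ls_br h)) => //; apply: ls_br_linr.
move: hl; rewrite (ls_jacobi _ hh (sb_homog a)) !he scale1r.
have brZl k x y : ls_br (k *: x) y = k *: @ls_br _ L x y.
  have br0 : @ls_br _ L 0 y = 0.
    by have := @ls_br_linl _ L y (-1) 0 0; rewrite scaler0 addr0 scaleN1r addNr.
  by have := @ls_br_linl _ L y k x 0; rewrite br0 !addr0.
have brZr k x y : ls_br y (k *: x) = k *: @ls_br _ L y x.
  have br0 : @ls_br _ L y 0 = 0.
    by have := @ls_br_linr _ L y (-1) 0 0; rewrite scaler0 addr0 scaleN1r addNr.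
  by have := @ls_br_linr _ L y k x 0; rewrite br0 !addr0.
rewrite brZl brZr -scalerDl sb_coZ => /eqP.
by rewrite -subr_eq0 -mulrBl mulf_eq0 (negPf h0) orbF subr_eq0 => /eqP.
Qed.

Definition restr (B : pred T) m : mon T := [ffun a => if B a then m a else 0%N].
Definition madd (m m' : mon T) : mon T := [ffun a => (m a + m' a)%N].

Lemma restrK (B : pred T) m : madd (restr B m) (restr (predC B) m) = m.
Proof. by apply/ffunP=> a; rewrite !ffunE /=; case: (B a); rewrite ?addn0. Qed.
Lemma restr_supported (B : pred T) m : supported B (restr B m).
Proof. by apply/forallP => a; apply/implyP; rewrite ffunE; case: (B a). Qed.
Lemma restr_valid (B : pred T) m : valid m -> valid (restr B m).
Proof.
move=> /forallP h; apply/forallP => a; rewrite ffunE.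
by case: (B a); rewrite ?implybT.
Qed.

(** If the letters of [B] come first, the ordered word is a concatenation. Applied to the
    non-positive letters, this is the factorisation behind U(g) = U(b^-) U(n^+). *)
Lemma mono_madd (B : pred T) m m' : ts = [seq a <- ts | B a] ++ [seq a <- ts | ~~ B a] ->
  supported B m -> supported (predC B) m' -> mono (X := X) (madd m m') = mono m * mono m'.
Proof.
move=> tsB /forallP sm /forallP sm'; rewrite /mono -wprod_cat; congr (wprod _).
have nil (f : mon T) s : (forall a, a \in s -> f a = 0%N) ->
    flatten [seq nseq (f a) a | a <- s] = [::].
  elim: s => //= a s IH h; rewrite (h a) ?mem_head //= IH // => b hb.
  by apply: h; rewrite inE hb orbT.
rewrite /mword tsB !map_cat !flatten_cat.
rewrite [X in _ = (_ ++ X) ++ _]nil; last first.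
  move=> a; rewrite mem_filter => /andP[ha _]; apply/eqP; rewrite -leqn0 leqNgt.
  by apply: contra ha => /(implyP (sm a)).
rewrite [X in _ = _ ++ (X ++ _)]nil; last first.
  move=> a; rewrite mem_filter => /andP[ha _]; apply/eqP; rewrite -leqn0 leqNgt.
  by apply/negP => /(implyP (sm' a)); rewrite /= ha.
rewrite cats0; congr (flatten _ ++ flatten _); apply/eq_in_map => a; rewrite mem_filter ffunE.
  move=> /andP[ha _]; suff -> : m' a = 0%N by rewrite addn0.
  by apply/eqP; rewrite -leqn0 leqNgt; apply/negP => /(implyP (sm' a)); rewrite /= ha.
move=> /andP[ha _]; suff -> : m a = 0%N by [].
by apply/eqP; rewrite -leqn0 leqNgt; apply: contra ha => /(implyP (sm a)).
Qed.

Lemma madd_valid (B : pred T) m m' : supported B m -> supported (predC B) m' ->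
  valid m -> valid m' -> valid (madd m m').
Proof.
move=> /forallP sm /forallP sm' /forallP vm /forallP vm'; apply/forallP => a.
rewrite ffunE; have := vm a; have := vm' a; have := sm a; have := sm' a => /=.
by case: (m' a) => [|k]; [rewrite addn0 | case: (m a) => [|l] //=; case: (B a)].
Qed.

Lemma wprod_supported (B : pred T) m : bclosed (X := X) B -> supported B m ->
  forall w, all B w -> cspan (supported B) (mono m * wprod w).
Proof.
move=> hB sm w hw; rewrite /mono -wprod_cat.
have /(Ulow_cspan free hB) : Ulow (X := X) B (size (mword ts m ++ w)) (wprod (mword ts m ++ w)).
  by apply: Ulow_word; rewrite // all_cat hw (all_mword (sb_all (s := X))) sm.
by apply: cspan_sub => m' [].
Qed.
End Weights.

(** * The filtration by height *)

Section Height.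
Variables (F : numFieldType) (L : lieSuper F) (X : superBasis L).
Hypothesis free : pbw_free X.
Local Notation U := (uea L).
Local Notation T := (sb_idx X).
Local Notation par := (@sb_par F L X).
Local Notation e := (@sb_elt F L X).
Local Notation co := (@sb_co F L X).
Local Notation ts := (@sb_seq F L X).
Local Notation valid := (valid par).
Local Notation coord := (@coord F L X).
Local Notation cspan := (@cspan F L X).
Local Notation wprod := (@wprod F L X).
Variables (h0 : L) (ht : T -> int).
Hypothesis h0_weight : is_weight (X := X) h0 (fun t => (ht t)%:~R).
Definition pos : pred T := fun t => 0 < ht t.
Hypothesis ts_pos : ts = [seq a <- ts | ~~ pos a] ++ [seq a <- ts | ~~ ~~ pos a].
Implicit Types (m : mon T) (w : seq T) (a b c t : T) (u v : U) (j : int).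

Lemma br_height a b t : co (ls_br (e a) (e b)) t != 0 -> ht t = ht a + ht b.
Proof.
move=> /(br_weight h0_weight)/=; rewrite -intrD => /eqP.
by rewrite eqr_int => /eqP.
Qed.

Definition wht w : int := \sum_(t <- w) ht t.
(** Only positive letters count: this is the height of the component of the completion containing
    the monomial, not that of its total weight. *)
Definition nht m : int := \sum_(t | pos t) (m t)%:Z * ht t.

Lemma bclosed_pos : bclosed (X := X) pos.
Proof. by move=> a b t; rewrite /pos => ha hb /br_height ->; apply: addr_gt0. Qed.
Lemma bclosed_npos : bclosed (X := X) (predC pos).
Proof.
by move=> a b t; rewrite /pos /= -!leNgt => ha hb /br_height ->; move: ha hb; lia.
Qed.

Lemma nht_ge0 m : 0 <= nht m.
Proof. by apply: sumr_ge0 => t ht0; rewrite mulr_ge0 // ltW. Qed.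

Lemma nht_word_pos m w : supported pos m -> coord (wprod w) m != 0 -> nht m = wht w.
Proof.
move=> /forallP sm /(coord_word_weight free h0_weight) h; apply/eqP.
rewrite -(eqr_int F) /nht /wht !rmorph_sum /=; rewrite /mweight /wweight in h; rewrite -h.
rewrite [X in _ == X](bigID pos) /= [X in _ + X]big1 ?addr0 => [|t hp]; last first.
  suff -> : m t = 0%N by rewrite mul0r.
  by apply/eqP; rewrite -leqn0 leqNgt; apply: contra hp => /(implyP (sm t)).
by apply/eqP/eq_bigr => t _; rewrite intrM.
Qed.

(** The left ideal generated by the part of U(n^+) of height at least j. Generated by words, it is
    convenient for products; [GfiltE] passes to coordinates. *)
Definition Gfilt j : set U := linspan
  [set u * wprod w | u in setT & w in [set w | all pos w /\ (j <= wht w)%R]].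

Lemma Gfilt_closed j : lclosed (Gfilt j). Proof. exact: linspan_closed. Qed.
Lemma Gfilt_in j u w : all pos w -> (j <= wht w)%R -> Gfilt j (u * wprod w).
Proof. by move=> h h'; apply: linspan_in; exists u => //; exists w. Qed.
Lemma Gfilt_leq j j' u : (j' <= j)%R -> Gfilt j u -> Gfilt j' u.
Proof.
move=> jj; apply: linspan_sub => [|_ [v _ [w [hw hs] <-]]]; first exact: Gfilt_closed.
by apply: Gfilt_in => //; apply: le_trans hs.
Qed.
Lemma Gfilt_mull j v u : Gfilt j u -> Gfilt j (v * u).
Proof.
move: u; apply: linspan_sub => [|_ [u _ [w [hw hs] <-]]].
  split=> [|k x y hx hy]; rewrite /= ?mulr0 ?mulrDr -?scalerAr;
    by case: (Gfilt_closed j) => // _; apply.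
by rewrite /= mulrA; apply: Gfilt_in.
Qed.
Lemma Gfilt_mulr_pos j a u : pos a -> Gfilt j u -> Gfilt (j + ht a) (u * uiota (e a)).
Proof.
move=> ha; move: u; apply: linspan_sub => [|_ [u _ [w [hw hs] <-]]].
  split=> [|k x y hx hy]; rewrite /= ?mul0r ?mulrDl -?scalerAl;
    by case: (Gfilt_closed (j + ht a)) => // _; apply.
have -> : uiota (e a) = wprod [:: a] by rewrite /wprod big_seq1.
rewrite /= -mulrA -wprod_cat; apply: Gfilt_in; first by rewrite all_cat hw /= ha.
by rewrite /wht big_cat big_seq1 lerD2r.
Qed.

(** Move r to the left past the last letter x of the word: w x r is, up to sign, w r x plus w
    [x, r]. Heights are additive, so both terms follow by induction, and a letter r that has reached
    the left end is absorbed by the left ideal if it is not positive. *)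
Lemma Gfilt_word w r : all pos w -> Gfilt (wht w + ht r) (wprod w * uiota (e r)).
Proof.
elim/last_ind: w r => [|w x IH] r hw.
  rewrite wprod_nil mul1r /wht big_nil add0r.
  have [hr|hr] := boolP (pos r).
    by rewrite -[uiota _]mul1r -[ht r]add0r; apply: Gfilt_mulr_pos => //;
      rewrite -(wprod_nil X) -[wprod _]mul1r; apply: Gfilt_in; rewrite // /wht big_nil.
  rewrite -[uiota _]mulr1 -(wprod_nil X); apply: Gfilt_in => //.
  by rewrite /wht big_nil leNgt.
move: hw; rewrite all_rcons => /andP[hx hw].
have -> : wht (rcons w x) = wht w + ht x by rewrite /wht -cats1 big_cat big_seq1.
have -> : wprod (rcons w x) = wprod w * uiota (e x).
  by rewrite -cats1 wprod_cat /wprod big_seq1.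
rewrite -mulrA bracket_word mulrDr -scalerAr; apply: (lclosedD (Gfilt_closed _)).
  apply: (lclosedZ _ (Gfilt_closed _)); rewrite mulrA addrAC.
  by apply: Gfilt_mulr_pos => //; apply: IH.
rewrite (uiota_sum X) mulr_sumr; apply: (lclosed_sum _ (Gfilt_closed _)) => t _.
rewrite -scalerAr; have [->|h] := eqVneq (co (ls_br (e x) (e r)) t) 0.
  by rewrite scale0r; case: (Gfilt_closed (wht w + ht x + ht r)).
apply: (lclosedZ _ (Gfilt_closed _)).
by rewrite -addrA -(br_height h); apply: IH.
Qed.

Lemma Gfilt_mulr j r u : Gfilt j u -> Gfilt (j + ht r) (u * uiota (e r)).
Proof.
move: u; apply: linspan_sub => [|_ [u _ [w [hw hs] <-]]].
  split=> [|k x y hx hy]; rewrite /= ?mul0r ?mulrDl -?scalerAl;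
    by case: (Gfilt_closed (j + ht r)) => // _; apply.
rewrite /= -mulrA; apply: Gfilt_mull; apply: (Gfilt_leq (j := wht w + ht r)).
  by rewrite lerD2r.
exact: Gfilt_word.
Qed.

Lemma mono_split m : mono (X := X) m = mono (restr (predC pos) m) * mono (restr pos m).
Proof.
have e1 : restr pos m = restr (predC (predC pos)) m.
  by apply/ffunP => a; rewrite !ffunE /= negbK.
rewrite {1}e1 -(@mono_madd _ _ _ (predC pos)) ?restrK ?restr_supported //.
Qed.

Lemma nht_restr m : nht (restr pos m) = nht m.
Proof. by apply: eq_bigr => t hp; rewrite ffunE hp. Qed.
Lemma wht_mword m : supported pos m -> wht (mword ts m) = nht m.
Proof.
move=> /forallP sm; apply/eqP; rewrite -(eqr_int F) /wht /nht !rmorph_sum /=.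
have := wweight_mword (X := X) (fun t => (ht t)%:~R) m; rewrite /wweight => ->.
rewrite /mweight (bigID pos) /= [X in _ + X]big1 ?addr0 => [|t hp]; last first.
  suff -> : m t = 0%N by rewrite mul0r.
  by apply/eqP; rewrite -leqn0 leqNgt; apply: contra hp => /(implyP (sm t)).
by apply/eqP/eq_bigr => t _; rewrite intrM.
Qed.

(** Positive letters come last in the PBW order, so straightening a product of positive words stays
    at the right end and keeps its height, while the left factor does not count in [nht]. *)
Lemma GfiltE j : Gfilt j = cspan (fun m => (j <= nht m)%R).
Proof.
apply/seteqP; split; last first.
  apply: cspan_ind => [|m vm hm]; first exact: Gfilt_closed.
  rewrite mono_split /mono; apply: Gfilt_in; rewrite ?(all_mword (sb_all (s := X))) ?restr_supported //.
  by rewrite wht_mword ?restr_supported // nht_restr.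
apply: linspan_sub => [|_ [u _ [w [hw hs] <-]]]; first exact: cspan_closed.
suff : [set v | cspan (fun m => (j <= nht m)%R) (v * wprod w)] u by [].
apply: (@cspan_ind F L X (fun=> True)) => [|m vm _|m' _] //.
  split=> [|k x y hx hy]; rewrite /= ?mul0r ?mulrDl -?scalerAl;
    by case: (cspan_closed free (fun m => (j <= nht m)%R)) => // _; apply.
rewrite /= mono_split -mulrA.
have spm := restr_supported pos m.
have h1 : cspan (fun m' => supported pos m' /\ (j <= nht m')%R) (mono (restr pos m) * wprod w).
  move=> m' hm'; have sm' := wprod_supported free bclosed_pos spm hw hm'; split=> //.
  move: hm'; rewrite /mono -wprod_cat => /(nht_word_pos sm') ->.
  rewrite /wht big_cat /= -/(wht _) -/(wht _) wht_mword //.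
  by apply: le_trans hs _; rewrite lerDr nht_ge0.
move: (mono (restr pos m) * wprod w) h1; apply: cspan_ind => [|m' vm' [sm' hm']].
  split=> [|k x y hx hy]; rewrite /= ?mulr0 ?mulrDr -?scalerAr;
    by case: (cspan_closed free (fun m => (j <= nht m)%R)) => // _; apply.
have sm2 : supported (predC (predC pos)) m'.
  by apply/forallP => a; rewrite /= negbK; apply: (forallP sm').
rewrite /= -(@mono_madd _ _ _ (predC pos)) ?restr_supported //.
apply: (cspan_mono free).
  by apply: (@madd_valid _ _ _ (predC pos)); rewrite ?restr_supported ?restr_valid.
suff -> : nht (madd (restr (predC pos) m) m') = nht m' by [].
by apply: eq_bigr => t hp; rewrite !ffunE /= hp.
Qed.

Lemma Gfilt_uparity (b : bool) j u : Gfilt j u -> Gfilt j (twist b u).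
Proof.
case: b => //=; move: u; apply: linspan_sub => [|_ [u _ [w [hw hs] <-]]].
  split=> [|k x y hx hy].
    have -> : @uparity F L 0 = 0.
      by have := @uparity_lin F L (-1) 0 0; rewrite scaler0 addr0 scaleN1r addNr.
    by case: (Gfilt_closed j).
  by rewrite /= uparity_lin; case: (Gfilt_closed j) => // _; apply.
rewrite /= uparityM uparity_word -scalerAr; apply: (lclosedZ _ (Gfilt_closed _)).
exact: Gfilt_in.
Qed.

(** Left multiplication preserves the left ideal; only the right multiplication by [e r] shifts the
    height. *)
Lemma superad_height r j u : ht r <= 0 -> cspan (fun m => (j <= nht m)%R) u ->
  cspan (fun m => (j + ht r <= nht m)%R) (superad (e r) u).
Proof.
move=> hr; rewrite -!GfiltE => hu; rewrite (superadE _ (sb_homog r)).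
apply: (lclosedB (Gfilt_closed _)); last exact/Gfilt_mulr/Gfilt_uparity.
by apply: (Gfilt_leq (j := j)); [rewrite gerDl | apply: Gfilt_mull].
Qed.
End Height.

(** * Vanishing of symbols annihilated in the critical height *)

Section Symbols.
Variables (F : numFieldType) (L : lieSuper F) (X : superBasis L).
Local Notation T := (sb_idx X).
Local Notation par := (@sb_par F L X).
Local Notation e := (@sb_elt F L X).
Local Notation co := (@sb_co F L X).
Local Notation ts := (@sb_seq F L X).
Local Notation before := (before ts).
Local Notation valid := (valid par).
Local Notation cr := (crea (F := F) par before).
Local Notation an := (anni (F := F) par before).
Local Notation Ad := (@Ad F L X).
Let irr := @before_irr T ts.
Let tot := @before_tot T ts (@sb_all F L X).
Implicit Types (m : mon T) (a c s t : T) (f g : fock F T) (v : L).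

Definition smul v g : fock F T := \sum_c co v c *: cr c g.

Lemma smul_lin v : linear (smul v).
Proof.
move=> k f g; rewrite /smul scaler_sumr -big_split; apply: eq_bigr => c _ /=.
by rewrite !linearP.
Qed.
HB.instance Definition _ v :=
  GRing.isLinear.Build F (fock F T) (fock F T) _ (smul v) (smul_lin v).

Let crZ a (k : F) f : cr a (k *: f) = k *: cr a f. Proof. exact: linearZ. Qed.

Lemma smul_comm (p q : bool) v w g : homog (@ls_ev _ L) p v -> homog (@ls_ev _ L) q w ->
  smul v (smul w g) = (-1) ^+ (p && q) *: smul w (smul v g).
Proof.
move=> hv hw; rewrite /smul.
transitivity (\sum_c \sum_d (co v c * co w d) *: cr c (cr d g)).
  apply: eq_bigr => c _; rewrite linear_sum /= scaler_sumr; apply: eq_bigr => d _.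
  by rewrite crZ scalerA.
rewrite exchange_big scaler_sumr; apply: eq_bigr => d _ /=.
rewrite linear_sum /= !scaler_sumr; apply: eq_bigr => c _.
rewrite crZ (@crea_anti F T par before tot c d) !scalerA.
have [->|h] := eqVneq (co v c) 0; first by rewrite !(mul0r, mulr0).
have [->|h'] := eqVneq (co w d) 0; first by rewrite !(mul0r, mulr0).
by rewrite (sb_co_par hv h) (sb_co_par hw h'); congr (_ *: _); ring.
Qed.

Lemma smul_odd_sq v g : homog (@ls_ev _ L) true v -> smul v (smul v g) = 0.
Proof.
move=> hv; have := smul_comm g hv hv; rewrite /= expr1 scaleN1r => /eqP.
by rewrite -addr_eq0 -mulr2n -scaler_nat scaler_eq0 pnatr_eq0 => /eqP.
Qed.

(** Take a letter [c0] of v and a monomial [m1] of g with the largest exponent of [c0], which exists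
    by the degree bound. The coefficient of v g at [m1] times [c0] involves no other letter of v,
    since that would need a larger exponent of [c0] in g. *)
Lemma smul_inj v g p : homog (@ls_ev _ L) false v -> v != 0 ->
  (forall m, g m != 0 -> (mdeg m <= p)%N) -> smul v g = 0 -> g = 0.
Proof.
move=> hv v0 hg h.
have [c0 hc0] : exists c, co v c != 0.
  apply: contrapT => hn; case/eqP: v0; rewrite (sb_sum X v) big1 // => c _.
  by case: (eqVneq (co v c) 0) => [->|hc]; [rewrite scale0r | case: hn; exists c].
have pc0 := sb_co_par hv hc0.
apply/funext => m; apply: contrapT => /eqP gm.
pose P k := `[< exists m', g m' != 0 /\ m' c0 = k >].
have exP : exists k, P k by exists (m c0); apply/asboolP; exists m.
have bP k : P k -> (k <= p)%N.
  move=> /asboolP[m' [/hg hm' <-]]; apply: leq_trans hm'.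
  by rewrite /mdeg (bigD1 c0) //= leq_addr.
have [k /asboolP[m1 [gm1 <-]] max] := ex_maxnP exP bP.
have /eqP := congr1 (fun f : fock F T => f (incr m1 c0)) h.
rewrite /smul fock0 (bigD1 c0) //= fockD fockZ.
have -> : (\sum_(c | c != c0) co v c *: cr c g : fock F T) (incr m1 c0) = 0.
  have : forall c, c != c0 -> cr c g (incr m1 c0) = 0.
    move=> c hc; rewrite /crea /fop; set m2 := upd _ _ _.
    have [->|/eqP hm2] := eqVneq (g m2) 0; first by rewrite mulr0.
    have : P (m2 c0) by apply/asboolP; exists m2; split=> //; apply/eqP.
    by move=> /max; rewrite /m2 upd_neq 1?eq_sym // upd_eq ltnn.
  move=> hc; elim/big_rec: _ => // c f /hc h0 hf.
  by rewrite fockD fockZ h0 hf mulr0 addr0.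
rewrite addr0 /crea /fop upd_eq /= pc0 mul1r upd_upd upd_id.
by rewrite /sgn pc0 mul0n mul1r mulf_eq0 (negPf hc0) (negPf gm1).
Qed.

Variable ht : T -> int.
Hypothesis br_ht : forall a b t, co (ls_br (e a) (e b)) t != 0 -> ht t = ht a + ht b.
Local Notation nht := (nht ht).
Local Notation pos := (pos ht).

(* The four basis vectors attached to a positive root: even and odd root
   vectors x, xo for the root and y, yo for its opposite. *)
Definition root_pairing t := exists x xo y yo : T, exists H : L,
  [/\ [/\ t = x \/ t = xo, par x = false & par xo = true],
      [/\ ht x = ht t, ht xo = ht t, ht y = - ht t & ht yo = - ht t],
      forall s, ht s = ht t -> s != x -> s != xo ->
        ls_br (e y) (e s) = 0 /\ ls_br (e yo) (e s) = 0
    & [/\ ls_br (e y) (e xo) = H, ls_br (e yo) (e x) = H, par y = false, par yo = true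
        & ls_br (e y) (e x) != 0 /\ ls_br (e yo) (e xo) != 0]].
Hypothesis roots : forall t, pos t -> root_pairing t.

Let pht t := if pos t then ht t else 0.
Let nht_upd m a k : nht (upd m a k) = nht m + (k%:Z - (m a)%:Z) * pht a.
Proof.
rewrite /nht /pht; case: ifP => ha; last first.
  rewrite mulr0 addr0; apply: eq_bigr => t hp; rewrite upd_neq //.
  by apply: contraTneq hp => ->; rewrite ha.
rewrite (bigD1 a) //= upd_eq [X in _ = X + _](bigD1 a) //=.
rewrite (eq_bigr (fun t => (m t)%:Z * ht t)) => [|t /andP[_ hta]]; last by rewrite upd_neq.
by ring.
Qed.

Lemma cran_support c s f m : cr c (an s f) m != 0 ->
  exists m', [/\ f m' != 0, (0 < m' s)%N, mdeg m = mdeg m'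
    & nht m = nht m' - pht s + pht c].
Proof.
rewrite /crea /fop; case E: (m c) => [|k] /=; first by rewrite !mul0r eqxx.
rewrite mulf_eq0 negb_or => /andP[_]; set m1 := upd m c k.
rewrite /anni /fop mulf_eq0 negb_or => /andP[_ hf].
exists (upd m1 s (m1 s).+1); split=> //; first by rewrite upd_eq.
  have := mdeg_upd m1 s (m1 s).+1; have := mdeg_upd m c k; rewrite -/m1 E.
  by move: (m1 s) (mdeg m) (mdeg m1) (mdeg _) => x1 x2 x3 x4; lia.
rewrite nht_upd /m1 nht_upd E -/m1.
have -> : (m1 s).+1%:Z - (m1 s)%:Z = 1 by lia.
have -> : k%:Z - k.+1%:Z = -1 by lia.
by ring.
Qed.

(** Replacing a letter of height S by one of height C = S - B. For S < B the new letter no longer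
    counts, so the loss is S or 0; it is B only for S = B. A letter with S > B would lose S - C = B
    as well, and is excluded by the maximality of B. *)
Let height_shift (S C B K : int) : 0 < B -> C = - B + S -> (0 < S -> S <= B) ->
  S = B <-> K - (if 0 < S then S else 0) + (if 0 < C then C else 0) = K - B.
Proof.
move=> hB -> hS; case: ifP => hS0; first have := hS hS0; case: ifP => hC; lia.
Qed.

Lemma symbol_vanish p (k : int) f : 0 < k ->
  (forall m, f m != 0 -> [/\ valid m, mdeg m = p & nht m = k]) ->
  (forall y m, ht y < 0 -> mdeg m = p -> nht m = k + ht y -> Ad (e y) f m = 0) -> f = 0.
Proof.
move=> k0 hf hAd; apply/funext => m0; apply: contrapT => /eqP fm0.
pose P t := pos t && `[< exists m, f m != 0 /\ (0 < m t)%N >].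
have [t0 Pt0] : exists t, P t.
  apply: contrapT => hn; have [_ _ hk] := hf _ fm0.
  move: k0; rewrite -hk /nht big1 // => t hp.
  suff -> : m0 t = 0%N by rewrite mul0r.
  apply/eqP; rewrite -leqn0 leqNgt; apply/negP => hm; case: hn; exists t.
  by rewrite /P hp; apply/asboolP; exists m0.
have [t /andP[tpos /asboolP[mt [fmt mt0]]] tmax] := @arg_maxnP T t0 P (fun t => `|ht t|%N) Pt0.
set b := ht t; have b0 : 0 < b by [].
have smax s m : pos s -> f m != 0 -> (0 < m s)%N -> ht s <= b.
  move=> hs fm ms; have := tmax s; rewrite /P hs.
  move=> H; have : (`|ht s| <= `|ht t|)%N by apply: H; apply/asboolP; exists m.
  by rewrite /b; move: hs tpos; rewrite /pos; lia.
have [x [xo [y [yo [H [[htx px pxo] [h1 h2 h3 h4] hs [e1 e2 py pyo [n1 n2]]]]]]]] := roots tpos.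
have x_xo : x != xo by apply/eqP => h; move: px pxo; rewrite h => ->.
(* In degree p and height k - b, [hAd] applies and by [height_shift] only letters of height b
   contribute to [Ad], among which only x and xo have a nonzero bracket with z. At all other
   monomials the two terms on the left vanish separately. *)
have main z : ht z = - b ->
    (forall s, ht s = b -> s != x -> s != xo -> ls_br (e z) (e s) = 0) ->
    smul (ls_br (e z) (e x)) (an x f) + smul (ls_br (e z) (e xo)) (an xo f) = 0.
  move=> hz hzs.
  have term s c m : co (ls_br (e z) (e s)) c != 0 -> cr c (an s f) m != 0 ->
      mdeg m = p /\ ((ht s = b) <-> (nht m = k - b)).
    move=> /br_ht; rewrite hz => hc /cran_support[m' [fm' ms' dm nm]].
    have [_ dm' nm'] := hf _ fm'; split; first by rewrite dm.
    by rewrite nm nm' /pht; apply: height_shift => // hs0; apply: smax fm' ms'.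
  have single s m : ht s = b -> ~ (mdeg m = p /\ nht m = k - b) ->
      smul (ls_br (e z) (e s)) (an s f) m = 0.
    move=> hsb hm; rewrite /smul; elim/big_rec: _ => // c g _ hg; rewrite fockD fockZ hg addr0.
    have [->|hc] := eqVneq (co (ls_br (e z) (e s)) c) 0; first by rewrite mul0r.
    have [->|hn] := eqVneq (cr c (an s f) m) 0; first by rewrite mulr0.
    by case: hm; have [hd [hi _]] := term s c m hc hn; split=> //; apply: hi.
  apply/funext => m; rewrite fock0.
  have [hm|hm] := pselect (mdeg m = p /\ nht m = k - b); last first.
    by rewrite fockD !single ?addr0 // ?h1 ?h2.
  case: hm => dm nm; rewrite -(hAd z m) ?hz //; last by rewrite oppr_lt0.
  have -> : Ad (e z) f = \sum_s smul (ls_br (e z) (e s)) (an s f) by [].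
  rewrite (bigD1 x) //= (bigD1 xo) 1?eq_sym //= addrA [in RHS]fockD.
  rewrite -[LHS]addr0; congr (_ + _); apply/esym.
  elim/big_rec: _ => // s g /andP[sx sxo] hg; rewrite fockD hg addr0.
  have [hsb|hsb] := eqVneq (ht s) b.
    rewrite hzs // /smul big1 // => c _.
    by rewrite sb_co0 scale0r.
  rewrite /smul; elim/big_rec: _ => // c g' _ hg'; rewrite fockD fockZ hg' addr0.
  have [->|hc] := eqVneq (co (ls_br (e z) (e s)) c) 0; first by rewrite mul0r.
  have [->|hn] := eqVneq (cr c (an s f) m) 0; first by rewrite mulr0.
  by have [_ [_ hi]] := term s c m hc hn; case/eqP: hsb; apply: hi.
have m1 := main y h3 (fun s h q q' => (hs s h q q').1).
have m2 := main yo h4 (fun s h q q' => (hs s h q q').2).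
clear main; rewrite e1 in m1; rewrite e2 in m2.
set h := ls_br (e y) (e x) in m1 n1; set h' := ls_br (e yo) (e xo) in m2 n2.
have hom_h : homog (@ls_ev _ L) false h.
  by rewrite -[false]/(false (+) false) -{1}py -px; exact: (ls_br_homog (sb_homog y) (sb_homog x)).
have hom_h' : homog (@ls_ev _ L) false h'.
  by rewrite -[false]/(true (+) true) -{1}pyo -pxo; exact: (ls_br_homog (sb_homog yo) (sb_homog xo)).
have hom_H : homog (@ls_ev _ L) true H.
  rewrite -e1 -[true]/(false (+) true) -{1}py -pxo; exact: (ls_br_homog (sb_homog y) (sb_homog xo)).
have bcran s c m : cr c (an s f) m != 0 -> (mdeg m <= p)%N.
  by move=> /cran_support[m' [/hf[_ d _] _ -> _]]; rewrite d.
have ban s m : an s f m != 0 -> (mdeg m <= p)%N.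
  rewrite /anni /fop mulf_eq0 negb_or => /andP[_ /hf[_ d _]].
  have := mdeg_upd m s (m s).+1; rewrite d; move: (m s) (mdeg m) => z1 z2; lia.
have a0 : an x f = 0.
  apply: (smul_inj hom_h n1 (ban x)); apply: (smul_inj hom_h' n2 (p := p)).
    move=> m; apply: contraNT => hm; apply/eqP; rewrite /smul.
    elim/big_rec: _ => // c g _ hg; rewrite fockD fockZ hg addr0.
    have [->|/bcran hn] := eqVneq (cr c (an x f) m) 0; first by rewrite mulr0.
    by rewrite hn in hm.
  (* Multiply the first equation by h'. Then h' H d_xo f = H h' d_xo f, which by the second equation
     is - H H d_x f = 0. *)
  have := congr1 (smul h') m1; rewrite linear0 linearD /= (smul_comm _ hom_h' hom_H).
  rewrite scale1r -(@addrK _ (smul H (an x f)) (smul h' (an xo f))) addrC.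
  rewrite (_ : smul h' (an xo f) + smul H (an x f) = 0); last by rewrite addrC.
  rewrite sub0r linearN /= smul_odd_sq // oppr0 add0r => -> //.
have b0' : an xo f = 0.
  apply: (smul_inj hom_h' n2 (ban xo)).
  by move: m2; rewrite a0 linear0 add0r.
(* Read d_t f just below [mt]: the value is f at [mt] times a nonzero coefficient, as the exponent
   of t is positive and equals 1 if t is odd. *)
have : an t f (upd mt t (mt t).-1) = 0 by case: htx => ->; rewrite ?a0 ?b0'.
rewrite /anni /fop upd_eq upd_upd prednK // upd_id => /eqP.
rewrite !mulf_eq0 (negPf fmt) signr_eq0 !orbF /an_coef.
have [/forallP/(_ t) vm _ _] := hf _ fmt.
case: ifP vm => pt /=; last by rewrite pnatr_eq0.
by case: (mt t) mt0 => [|[|]] //= _ _; rewrite oner_eq0.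
Qed.
End Symbols.

(** * The Q-type Lie superalgebras *)

Section Images.
Variables (F : fieldType) (k : qkind) (n : nat).
Local Notation g := (qtypeLie F k n).
Implicit Types (M N : qmx F n) (x y : g).

Definition special := if k is (KSQ | KPSQ) then true else false.
Definition projective := if k is (KPQ | KPSQ) then true else false.

Lemma image_lin a M N x y :
  qtype_image M x -> qtype_image N y -> qtype_image (a *: M + N) (a *: x + y).
Proof.
case: k x y => /= x y.
- by move=> -> ->.
- by move=> <- <-.
- by move=> -> ->; rewrite linearP.
- move=> [x' <- ->] [y' <- ->]; exists (a *: x' + y') => //.
  by rewrite linearP.
Qed.
Lemma image_ev M x : qtype_image M x -> qtype_image (q_ev M) (ls_ev x).
Proof.
case: k x => /= x.
- by move=> ->.
- by move=> <-.
- by move=> ->; exact: (@quo_evE F _ _ (@qId_scale F n) (@qId_ev F n)).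
- move=> [x' <- ->]; exists (ls_ev (x' : sqLie F n)) => //.
  exact: (@quo_evE F _ _ (@sqId_scale F n) (@sqId_ev F n)).
Qed.
Lemma image_br M N x y :
  qtype_image M x -> qtype_image N y -> qtype_image (q_br M N) (ls_br x y).
Proof.
case: k x y => /= x y.
- by move=> -> ->.
- by move=> <- <-.
- by move=> -> ->; exact: (@quo_brE F _ _ (@qId_scale F n) (@qId_brl F n) (@qId_brr F n)).
- move=> [x' <- ->] [y' <- ->]; exists (ls_br (x' : sqLie F n) (y' : sqLie F n)) => //.
  exact: (@quo_brE F _ _ (@sqId_scale F n) (@sqId_brl F n) (@sqId_brr F n)).
Qed.
Lemma image_total x : exists M, qtype_image M x.
Proof.
case: k x => /= x; first by exists x.
- by exists (sval x).
- by elim/quo_ind: x => x; exists x.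
- by elim/quo_ind: x => x; exists (sval x); exists x.
Qed.
Lemma image_ex M : (special -> \tr M.2 = 0) -> exists x : g, qtype_image M x.
Proof.
rewrite /special; case: k => /= h; first by exists M.
- have hM : (M : qLie F n) \in @sq_pred F n by rewrite unfold_in h.
  by exists (exist _ M hM).
- by exists (quo_pi (@qId_scale F n) M).
- have hM : (M : qLie F n) \in @sq_pred F n by rewrite unfold_in h.
  exists (quo_pi (@sqId_scale F n) (exist _ M hM : sqLie F n)).
  by exists (exist _ M hM : sqLie F n).
Qed.
Lemma image_trace M x : qtype_image M x -> special -> \tr M.2 = 0.
Proof.
have sqP (y : sqLie F n) : \tr (sval y : qmx F n).2 = 0.
  by have := valP y; rewrite unfold_in => /eqP.
by rewrite /special; case: k x => //= x; [move=> <- _ | move=> [y <- _] _]; apply: sqP.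
Qed.
Lemma image_inj M x y : qtype_image M x -> qtype_image M y -> x = y.
Proof.
case: k x y => /= x y.
- by move=> -> ->.
- by move=> h h'; apply: val_inj; rewrite /= h h'.
- by move=> -> ->.
- by move=> [x' h ->] [y' h' ->]; congr quo_pi; apply: val_inj; rewrite /= h h'.
Qed.
Lemma image_ker M : qtype_image M (0 : g) ->
  if projective then exists a, M = (a%:M, 0) else M = 0.
Proof.
rewrite /projective; case: k => /=.
- by move=> <-.
- by move=> <-.
- move=> h; apply/qIdP; move/esym: h.
  have <- : quo_pi (@qId_scale F n) 0 = 0 by rewrite linear0.
  by move=> /quo_piP; rewrite subr0.
- move=> [y <- h]; apply/qIdP; move/esym: h.
  have <- : quo_pi (@sqId_scale F n) 0 = 0 by rewrite linear0.
  by move=> /quo_piP; rewrite subr0.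
Qed.
Lemma image_Id a : projective -> qtype_image (a%:M, 0) (0 : g).
Proof.
rewrite /projective; case: k => //= _.
- apply/esym; have <- : quo_pi (@qId_scale F n) 0 = 0 by rewrite linear0.
  by apply/quo_piP; rewrite subr0; apply/qIdP; exists a.
- have hM : ((a%:M, 0) : qLie F n) \in @sq_pred F n by rewrite unfold_in /= linear0.
  exists (exist _ (a%:M, 0) hM : sqLie F n) => //.
  apply/esym; have <- : quo_pi (@sqId_scale F n) 0 = 0 by rewrite linear0.
  by apply/quo_piP; rewrite subr0; apply/qIdP; exists a.
Qed.

Lemma image0 : qtype_image 0 (0 : g).
Proof.
have [M hM] := image_total (0 : g).
by have := image_lin (-1) hM hM; rewrite !scaleN1r !addNr.
Qed.
Lemma image_homog (b : bool) M x : qtype_image M x ->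
  homog (@q_ev F n) b M -> homog (@ls_ev _ g) b x.
Proof.
move=> h; have := image_ev h; case: b => /= h' e; rewrite e in h'.
  exact: image_inj h' image0.
exact: image_inj h' h.
Qed.
Lemma image_sum (I : Type) (s : seq I) (c : I -> F) (f : I -> qmx F n) (h : I -> g) :
  (forall i, qtype_image (f i) (h i)) ->
  qtype_image (\sum_(i <- s) c i *: f i) (\sum_(i <- s) c i *: h i).
Proof.
move=> hf; elim: s => [|i s IH]; first by rewrite !big_nil; apply: image0.
by rewrite !big_cons; apply: image_lin.
Qed.
End Images.

(** * A common basis of matrices for the four families *)

Section MatrixBasis.
Variables (F : fieldType) (n : nat) (l : 'I_n).
Definition qidx := ('I_n * 'I_n * bool)%type.
HB.instance Definition _ := Finite.on qidx.
Implicit Types (t : qidx) (M : qmx F n) (A B : 'M[F]_n) (i j : 'I_n).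

Local Notation E := (@delta_mx F n n).

(* The identity matrix replaces E_ll in the even part, and the odd diagonal
   matrices of trace 0 are spanned by the E_ii - E_ll. *)
Definition qmat t : qmx F n :=
  let: (i, j, b) := t in
  if b then (0, if i == j then (if i == l then E l l else E i i - E l l) else E i j)
  else (if (i == l) && (j == l) then 1%:M else E i j, 0).

(** Coordinates dual to [qmat]: [M.1 l l] is the coefficient of the identity and must be removed
    from the other diagonal entries; the trace is the coefficient of the odd E_ll, the other odd
    basis vectors being traceless. *)
Definition qco M t : F :=
  let: (i, j, b) := t in
  if b then (if (i == l) && (j == l) then \tr M.2 else M.2 i j)
  else (if (i == l) && (j == l) then M.1 l l else M.1 i j - (i == j)%:R * M.1 l l).

Lemma qco_lin a M N t : qco (a *: M + N) t = a * qco M t + qco N t.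
Proof.
case: t => [[i j] []] /=; case: ifP => _; rewrite ?mxE //; last by ring.
by rewrite linearD /= linearZ.
Qed.

Lemma deltaE i j i' j' : E i j i' j' = ((i == i') && (j == j'))%:R.
Proof. by rewrite mxE eq_sym [j' == j]eq_sym. Qed.
Lemma trace_delta i j : \tr (E i j) = (i == j)%:R.
Proof.
rewrite /mxtrace (bigD1 i) //= deltaE eqxx big1 ?addr0; first by rewrite eq_sym.
by move=> k /negPf hk; rewrite deltaE eq_sym hk.
Qed.

Lemma qco_mat t t' : qco (qmat t) t' = (t == t')%:R.
Proof.
case: t t' => [[i j] b] [[i' j'] b']; rewrite /qco /qmat.
have -> : ((i, j, b) == (i', j', b')) = [&& i == i', j == j' & b == b'].
  by rewrite -!pair_eqE /= -pair_eqE /= /pair_eq /= andbA.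
case: b; case: b'; rewrite /= ?andbF ?andbT; last first.
- case: (boolP ((i' == l) && (j' == l))) => [/andP[/eqP -> /eqP ->]|/negPf h'];
    case: (boolP ((i == l) && (j == l))) => [/andP[/eqP ei /eqP ej]|/negPf h].
  + by rewrite mxE !eqxx.
  + by rewrite deltaE h.
  + rewrite ei ej !mxE !eqxx mulr1 subrr; move: h'; rewrite ![l == _]eq_sym => ->.
    by [].
  + by rewrite !deltaE h mulr0 subr0.
- by case: ifP; rewrite ?linear0 ?mxE.
- by case: ifP; rewrite !mxE ?mulr0 ?subr0.
case: (boolP ((i' == l) && (j' == l))) => [/andP[/eqP -> /eqP ->]|/negPf h']; have [<-|ij] := eqVneq i j.
- have [e|il] := eqVneq i l; first by rewrite trace_delta ?e eqxx.
  by rewrite linearB /= !trace_delta !eqxx subrr.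
- rewrite trace_delta (negPf ij); case: eqP => //= e; rewrite -e eq_sym.
  by move: ij; rewrite e => /negPf ->.
- have [e|il] := eqVneq i l; first by rewrite deltaE ?e.
  rewrite !mxE ![_ == i]eq_sym; suff -> : (i' == l) && (j' == l) = false by rewrite subr0.
  exact: h'.
- by rewrite deltaE.
Qed.

Lemma qco0 t : qco 0 t = 0.
Proof. by have := qco_lin (-1) 0 0 t; rewrite scaler0 addr0 mulN1r addNr. Qed.

Lemma qco_inj M : (forall t, qco M t = 0) -> M = 0.
Proof.
move=> h; have hl : M.1 l l = 0 by have := h (l, l, false); rewrite /= eqxx.
have h1 i j : M.1 i j = 0.
  have := h (i, j, false) => /=; case: ifP => [/andP[/eqP -> /eqP ->] //|_].
  by rewrite hl mulr0 subr0.
have h2 i j : ~~ ((i == l) && (j == l)) -> M.2 i j = 0.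
  by move=> /negPf hij; have := h (i, j, true); rewrite /= hij.
have hll : M.2 l l = 0.
  have := h (l, l, true); rewrite /= eqxx /mxtrace (bigD1 l) //= big1 ?addr0 // => i il.
  by apply: h2; rewrite andbb.
rewrite [M]surjective_pairing; congr pair; apply/matrixP => i j; rewrite mxE //.
by case: (boolP ((i == l) && (j == l))) => [/andP[/eqP -> /eqP ->] //|/h2].
Qed.

Lemma qco_sum (I : Type) (s : seq I) (c : I -> F) (f : I -> qmx F n) t :
  qco (\sum_(i <- s) c i *: f i) t = \sum_(i <- s) c i * qco (f i) t.
Proof. by elim: s => [|i s IH]; rewrite ?big_nil ?qco0 // !big_cons qco_lin IH. Qed.

Lemma qmat_sum M : M = \sum_t qco M t *: qmat t.
Proof.
apply/eqP; rewrite -subr_eq0; apply/eqP/qco_inj => t.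
rewrite addrC -scaleN1r qco_lin qco_sum (bigD1 t) //= qco_mat eqxx mulr1 big1.
  by rewrite addr0 mulN1r addNr.
by move=> t' ht; rewrite qco_mat (negPf ht) mulr0.
Qed.

Lemma qmat_homog t : homog (@q_ev F n) t.2 (qmat t).
Proof. by case: t => [[i j] b]; apply/q_homogP; case: b. Qed.

Lemma q_br_even A M :
  q_br (A, 0) M = (A *m M.1 - M.1 *m A, A *m M.2 - M.2 *m A).
Proof. by rewrite /q_br /= !mul0mx !mulmx0 subr0 !addr0. Qed.
Lemma q_br_odd B M :
  q_br (0, B) M = (B *m M.2 + M.2 *m B, B *m M.1 - M.1 *m B).
Proof. by rewrite /q_br /= !mul0mx !mulmx0 subr0 !add0r. Qed.

Lemma qmat_diag_br (D : 'M[F]_n) t : is_diag_mx D ->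
  q_br (D, 0) (qmat t) = (D t.1.1 t.1.1 - D t.1.2 t.1.2) *: qmat t.
Proof.
move=> /diag_mxP[d ->]; rewrite q_br_even !mxE !eqxx !mulr1n.
have DE i j : diag_mx d *m E i j - E i j *m diag_mx d = (d 0 i - d 0 j) *: E i j.
  apply/matrixP => a b; rewrite mul_diag_mx mul_mx_diag !mxE.
  case: (eqVneq a i) => [->|_]; last by rewrite !(mulr0, mul0r) subrr.
  case: (eqVneq b j) => [->|_]; last by rewrite !(mulr0, mul0r) subrr.
  by rewrite !mulr1 mul1r.
case: t => [[i j] []]; rewrite /qmat /=; congr pair;
  rewrite ?mul0mx ?mulmx0 ?subrr ?scaler0 //; last first.
  case: ifP => [/andP[/eqP -> /eqP ->]|_]; last exact: DE.
  by rewrite mulmx1 mul1mx !subrr scale0r.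
have [<-|ij] := eqVneq i j; last exact: DE.
rewrite subrr scale0r; have D0 i' : diag_mx d *m E i' i' = E i' i' *m diag_mx d.
  by apply/eqP; rewrite -subr_eq0 DE subrr scale0r.
by case: ifP => _; rewrite ?mulmxBr ?mulmxBl !D0 subrr.
Qed.
End MatrixBasis.

Lemma filter_split (T : Type) (p : pred T) (s : seq T) (q := [seq x <- s | ~~ p x] ++ [seq x <- s | p x]) :
  q = [seq x <- q | ~~ p x] ++ [seq x <- q | ~~ ~~ p x].
Proof.
have e (a b c : pred T) : (forall x, a x && b x = c x) ->
    [seq x <- [seq x <- s | b x] | a x] = [seq x <- s | c x].
  by move=> h; rewrite -filter_predI; apply: eq_filter.
rewrite /q !filter_cat (e _ _ (fun x => ~~ p x)) => [|x]; last by rewrite andbb.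
rewrite (e _ _ pred0) => [|x]; last by rewrite andNb.
rewrite (e _ _ pred0) => [|x]; last by rewrite negbK andbN.
rewrite (e _ _ p) => [|x]; last by rewrite negbK andbb.
by rewrite filter_pred0 cats0.
Qed.

Section QBasis.
Variables (F : numFieldType) (k : qkind) (n : nat) (l : 'I_n).
Local Notation g := (qtypeLie F k n).
Implicit Types (M N : qmx F n) (x y : g).

(** The basis is adapted to all four families: trace zero drops the odd E_ll, the quotient drops the
    identity. *)
Definition qkeep (t : qidx n) := ~~ (special k && (t == (l, l, true)))
  && ~~ (projective k && (t == (l, l, false))).
Local Notation qT := {t : qidx n | qkeep t}.

Implicit Type t : qT.
Lemma qelt_ex (t : qT) : exists x : g, qtype_image (qmat F l (val t)) x.
Proof.
case: t => [[[i j] b] ht] /=; apply: image_ex => sp; case: b ht => /=; last by rewrite linear0.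
rewrite /qkeep sp /= => /andP[ht _]; have [ij|ij] := eqVneq i j; last first.
  by rewrite trace_delta (negPf ij).
case: eqP => il; last by rewrite linearB /= !trace_delta !eqxx subrr.
by move: ht; rewrite -ij il eqxx.
Qed.
Definition qelt (t : qT) : g := sval (cid (qelt_ex t)).
Lemma qeltP t : qtype_image (qmat F l (val t)) (qelt t).
Proof. exact: svalP. Qed.

Definition qrep x : qmx F n := sval (cid (image_total x)).
Lemma qrepP x : qtype_image (qrep x) x.
Proof. exact: (svalP (cid (image_total x))). Qed.
Definition qcoord x (t : qT) : F := qco l (qrep x) (val t).

Lemma qco_Id a (t : qT) : projective k -> qco l ((a%:M, 0) : qmx F n) (val t) = 0.
Proof.
case: t => [[[i j] b] /= ht] pk; case: b ht; first by rewrite mxE linear0 if_same.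
rewrite /qkeep pk /= => /andP[_]; rewrite -pair_eqE /= -pair_eqE /= andbT => /negPf ->.
by rewrite !mxE eqxx mulr1n mulr_natl subrr.
Qed.

(** Two matrices over x differ at most by a multiple of the identity, invisible to the kept
    coordinates, so the choice made in [qrep] is harmless. *)
Lemma qcoordE M x t : qtype_image M x -> qcoord x t = qco l M (val t).
Proof.
move=> hM; have := image_lin (-1) hM (qrepP x); rewrite !scaleN1r addNr => /image_ker hk.
have e : qrep x = 1 *: M + (- M + qrep x) by rewrite scale1r addrA subrr add0r.
rewrite /qcoord e qco_lin mul1r.
suff -> : qco l (- M + qrep x) (val t) = 0 by rewrite addr0.
by case: ifP hk => [pk [a ->]|_ ->]; [apply: qco_Id | apply: qco0].
Qed.

Lemma qcoord_lin a x y t : qcoord (a *: x + y) t = a * qcoord x t + qcoord y t.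
Proof. by rewrite (qcoordE _ (image_lin a (qrepP x) (qrepP y))) qco_lin. Qed.
Lemma qcoord_elt t t' : qcoord (qelt t) t' = (t == t')%:R.
Proof. by rewrite (qcoordE _ (qeltP t)) qco_mat. Qed.

Lemma qelt_homog t : homog (@ls_ev _ g) (val t).2 (qelt t).
Proof. exact: image_homog (qeltP t) (qmat_homog F l _). Qed.

Lemma qcoord_sum x : x = \sum_t qcoord x t *: qelt t.
Proof.
have h1 := image_sum (index_enum _) (qcoord x) qeltP.
apply: (image_inj _ h1); set S := \sum_t _.
(* The dropped terms: the trace coordinate is 0 in the special cases, and in the projective ones a
   multiple of the identity remains, whose image is 0. *)
pose K := \sum_(t | ~~ qkeep t) qco l (qrep x) t *: qmat F l t.
have big_keep (G : qidx n -> qmx F n) : \sum_(t | qkeep t) G t = \sum_(t : qT) G (val t).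
  rewrite (reindex_omap (val : qT -> _) insub) => [|t ht]; last by rewrite insubT.
  by apply: eq_bigl => -[t ht] /=; rewrite insubT /= ht eqxx.
have hS : qrep x = S + K by rewrite {1}(qmat_sum l (qrep x)) (bigID qkeep) /= big_keep.
have id0 : ((0 : F)%:M, 0) = 0 :> qmx F n by congr pair; rewrite raddf0.
suff : exists a, K = (a%:M, 0) /\ (~~ projective k -> a = 0).
  move=> [a [Ka ha]]; have hK : qtype_image K (0 : g).
    rewrite Ka; case pk: (projective k); first exact: image_Id.
    by rewrite ha ?pk // id0; apply: image0.
  by have := image_lin (-1) hK (qrepP x); rewrite hS scaleN1r scaler0 add0r addrC addrK.
exists (if projective k then (qrep x).1 l l else 0); split; last by move=> /negPf ->.
rewrite /K (eq_bigl (fun t : qidx n => (special k && (t == (l, l, true)))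
   || (projective k && (t == (l, l, false))))); last first.
  by move=> t; rewrite /qkeep negb_and !negbK.
have hsp : special k -> qco l (qrep x) (l, l, true) = 0.
  by move=> /(image_trace (qrepP x)) /=; rewrite eqxx.
rewrite (bigID (fun t : qidx n => t.2)) /= big1 => [|[[i j] b]]; last first.
  rewrite [_.2]/=; case: b => /andP[] // /orP[]/andP[h /eqP[]] // -> -> _.
  by rewrite hsp // scale0r.
case pk: (projective k); last first.
  rewrite add0r id0 big1 // => -[[i j] b] /andP[].
  by case: b => //; rewrite orbF => /andP[_ /eqP[]].
rewrite add0r (big_pred1 ((l, l, false) : qidx n)) => [|[[i j] b]] /=.
  by rewrite eqxx; congr pair; rewrite /= ?scaler0 ?scale_scalar_mx ?mulr1.
rewrite /pred1 /=; case: (b) => /=; last first.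
  rewrite andbT; case: (special k) => //=.
  by rewrite -pair_eqE /= -pair_eqE /= andbF.
by rewrite andbF -pair_eqE /= -pair_eqE /= andbF.
Qed.

Lemma two_neq0 : 2%:R != 0 :> F. Proof. by rewrite pnatr_eq0. Qed.

Definition qht t : int := (val t).1.2%:Z - (val t).1.1%:Z.
(** Non-positive letters first, as needed for U(b^-) U(n^+). *)
Definition qseq : seq qT :=
  [seq t <- enum {: qT} | ~~ (0 < qht t)] ++ [seq t <- enum {: qT} | 0 < qht t].
Lemma qseq_uniq : uniq qseq.
Proof.
rewrite cat_uniq; apply/and3P; split; [exact/filter_uniq/enum_uniq | | exact/filter_uniq/enum_uniq].
by apply/negP => /hasP[t]; rewrite /= !mem_filter => /andP[h _] /andP[]; rewrite h.
Qed.
Lemma qseq_all t : t \in qseq.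
Proof.
rewrite mem_cat; apply/orP; case: (boolP (0 < qht t)) => h; [right|left];
  by rewrite mem_filter h mem_enum.
Qed.
Definition qbasis : superBasis g := SuperBasis two_neq0 qelt_homog qcoord_lin qcoord_elt
  qcoord_sum qseq_uniq qseq_all.
Lemma qseq_pos : sb_seq qbasis =
  [seq t <- sb_seq qbasis | ~~ pos (X := qbasis) qht t] ++
  [seq t <- sb_seq qbasis | ~~ ~~ pos (X := qbasis) qht t].
Proof.
exact: filter_split.
Qed.

End QBasis.

(* The action of a matrix X on matrices by supercommutators, in matrix units; a P Q
   is the parity of the entry of X involved, which is constant if X is homogeneous. *)
Section AdjointMatrices.
Variables (F : fieldType) (I : finType) (p : I -> bool).
Local Notation mat := (I -> I -> F).
Implicit Types (X Y : mat) (P Q : I * I) (a b : bool).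

Definition gparity P := p P.1 (+) p P.2.
Definition adm (a : I * I -> I * I -> bool) X P Q : F :=
  X P.1 Q.1 * (P.2 == Q.2)%:R
  - (-1) ^+ (a P Q && gparity Q) * ((P.1 == Q.1)%:R * X Q.2 P.2).
Definition homog_mat a X := forall i j, X i j != 0 -> a = p i (+) p j.

Let sumr_delta (i : I) (G : I -> F) : \sum_j G j * (j == i)%:R = G i.
Proof.
rewrite (bigD1 i) //= eqxx mulr1 big1 ?addr0 // => j /negPf ->.
by rewrite mulr0.
Qed.
Let sumr_delta' (i : I) (G : I -> F) : \sum_j G j * (i == j)%:R = G i.
Proof. by rewrite -[RHS](sumr_delta i); apply: eq_bigr => j _; rewrite eq_sym. Qed.

(** [adm] is a left multiplication minus a signed right multiplication; the terms are left-left,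
    left-right, right-left and right-right. The mixed ones cancel in the supercommutator
    ([adm_br]). *)
Lemma adm_mul a b X Y P Q : homog_mat b Y ->
  let c := gparity Q in
  \sum_R adm (fun _ _ => a) X P R * adm (fun _ _ => b) Y R Q =
  (\sum_k X P.1 k * Y k Q.1) * (P.2 == Q.2)%:R
  - (-1) ^+ (b && c) * (X P.1 Q.1 * Y Q.2 P.2)
  - (-1) ^+ (a && b) * (-1) ^+ (a && c) * (X Q.2 P.2 * Y P.1 Q.1)
  + (-1) ^+ (a && b) * (-1) ^+ (a && c) * (-1) ^+ (b && c)
    * ((P.1 == Q.1)%:R * \sum_k Y Q.2 k * X k P.2).
Proof.
move=> hY c.
have -> : \sum_R adm (fun _ _ => a) X P R * adm (fun _ _ => b) Y R Q =
    \sum_i \sum_j (X P.1 i * Y i Q.1 * (P.2 == j)%:R * (j == Q.2)%:R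
      - (-1) ^+ (b && c) * (X P.1 i * Y Q.2 j) * (i == Q.1)%:R * (P.2 == j)%:R
      - (-1) ^+ (a && (p i (+) p j)) * X j P.2 * Y i Q.1 * (P.1 == i)%:R * (j == Q.2)%:R
      + (-1) ^+ (b && c) * ((-1) ^+ (a && (p i (+) p j)) * (X j P.2 * Y Q.2 j))
        * (P.1 == i)%:R * (i == Q.1)%:R).
  rewrite pair_bigA /=; apply: eq_bigr => [[i j] _].
  by rewrite /adm /gparity /= -/(gparity Q) -/c; ring.
under eq_bigr do rewrite !big_split /= !sumrN.
rewrite !big_split /= !sumrN; congr (_ - _ - _ + _).
- rewrite mulr_suml; apply: eq_bigr => i _.
  by rewrite (sumr_delta Q.2 (fun j => X P.1 i * Y i Q.1 * (P.2 == j)%:R)).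
- under eq_bigr do rewrite sumr_delta'.
  by rewrite (sumr_delta Q.1 (fun i => (-1) ^+ (b && c) * (X P.1 i * Y Q.2 P.2))).
- under eq_bigr do rewrite sumr_delta.
  rewrite (sumr_delta' P.1 (fun i => (-1) ^+ (a && (p i (+) p Q.2)) * X Q.2 P.2 * Y i Q.1)).
  have [->|/hY hb] := eqVneq (Y P.1 Q.1) 0; first by rewrite !mulr0.
  rewrite /c /gparity hb -signr_addb -andb_addr mulrA; congr ((-1) ^+ (_ && _) * _ * _).
  by case: (p _); case: (p _); case: (p _).
- rewrite exchange_big /= !mulr_sumr; apply: eq_bigr => j _.
  rewrite (sumr_delta Q.1 (fun i => (-1) ^+ (b && c) * ((-1) ^+ (a && (p i (+) p j)) *
    (X j P.2 * Y Q.2 j)) * (P.1 == i)%:R)).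
  have [->|/hY hb] := eqVneq (Y Q.2 j) 0; first by rewrite !(mulr0, mul0r).
  have -> : (-1) ^+ (a && (p Q.1 (+) p j)) = (-1) ^+ (a && b) * (-1) ^+ (a && c) :> F.
    rewrite -signr_addb -andb_addr /c /gparity hb; congr ((-1) ^+ (_ && _)).
    by case: (p _); case: (p _); case: (p _).
  by ring.
Qed.

Lemma adm_br a b X Y P Q : homog_mat a X -> homog_mat b Y ->
  adm (fun _ _ => a (+) b)
    (fun i j => \sum_k X i k * Y k j - (-1) ^+ (a && b) * \sum_k Y i k * X k j) P Q =
  \sum_R adm (fun _ _ => a) X P R * adm (fun _ _ => b) Y R Q
  - (-1) ^+ (a && b) * \sum_R adm (fun _ _ => b) Y P R * adm (fun _ _ => a) X R Q.
Proof.
move=> hX hY; rewrite !adm_mul // /adm; set c := gparity Q.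
have -> : (-1) ^+ ((a (+) b) && c) = (-1) ^+ (a && c) * (-1) ^+ (b && c) :> F.
  by rewrite -signr_addb -andb_addl.
rewrite [b && a]andbC; have := sqrr_sign F (a && b); rewrite expr2.
move: ((-1) ^+ (a && b)) ((-1) ^+ (a && c)) ((-1) ^+ (b && c)) => s sa sb hs.
move: (\sum_k X P.1 k * _) (\sum_k Y P.1 k * _) (\sum_k X Q.2 k * _) (\sum_k Y Q.2 k * _) => t1 t2 t3 t4.
apply/eqP; rewrite -subr_eq0.
(* s is a sign, unknown to [ring]: the difference is exhibited as a multiple of s * s - 1. *)
set lhs := (X in X == 0); have -> : lhs = (s * s - 1) *
  (sb * (- (X P.1 Q.1 * Y Q.2 P.2)) + sa * sb * (P.1 == Q.1)%:R * t3).
  by rewrite /lhs; ring.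
by rewrite hs subrr mul0r.
Qed.
End AdjointMatrices.

(** * PBW for the Q-type superalgebras *)

Section QFree.
Variables (F : numFieldType) (k : qkind) (n : nat) (l : 'I_n).
Local Notation g := (qtypeLie F k n).
Local Notation I := 'I_(n + n).
Implicit Types (M N : qmx F n) (x y : g) (i j : 'I_n).

Definition bpar (i : I) : bool := (n <= i)%N.
Lemma bpar_l i : bpar (lshift n i) = false. Proof. by rewrite /bpar /= leqNgt ltn_ord. Qed.
Lemma bpar_r i : bpar (rshift n i) = true. Proof. exact: leq_addr. Qed.

Lemma qX_lin a M N : qX (a *: M + N) = a *: qX M + qX N.
Proof. by rewrite /qX scale_block_mx add_block_mx. Qed.

Lemma qX_homog (b : bool) M : homog (@q_ev F n) b M -> homog_mat bpar b (qX M).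
Proof.
move=> /q_homogP hM i j; case: (split_ordP i) => i' ->; case: (split_ordP j) => j' ->;
  rewrite ?bpar_l ?bpar_r /qX ?(block_mxEul, block_mxEur, block_mxEdl, block_mxEdr) /=;
  by case: b hM => hM; rewrite ?hM ?mxE ?eqxx.
Qed.

Lemma qX_br (a b : bool) M N (i j : I) :
  homog (@q_ev F n) a M -> homog (@q_ev F n) b N ->
  qX (q_br M N) i j =
  \sum_c qX M i c * qX N c j - (-1) ^+ (a && b) * \sum_c qX N i c * qX M c j.
Proof. by move=> hM hN; rewrite (q_brX hM hN) !mxE. Qed.

Lemma image_homog_ex (b : bool) x : homog (@ls_ev _ g) b x ->
  exists2 M, homog (@q_ev F n) b M & qtype_image M x.
Proof.
have [M hM] := image_total x; have hev := image_ev hM.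
case: b => /= hx; rewrite hx in hev; last by exists (q_ev M).
exists (M - q_ev M); last first.
  by have := image_lin (-1) hev hM; rewrite scaleN1r scaler0 add0r addrC.
by congr pair; rewrite /= subrr.
Qed.

(** The first n columns of X_{A,B} are A above B; [unit_of p] is the pair (A, B) for which this
    block column has a single entry 1, at p. *)
Definition unit_of (p : I * 'I_n) : qmx F n :=
  match fintype.split p.1 with
  | inl i => (delta_mx i p.2, 0)
  | inr i => (0, delta_mx i p.2)
  end.

Lemma sum_unit_of (c : I * 'I_n -> F) : \sum_p c p *: unit_of p =
  (\matrix_(i, j) c (lshift n i, j), \matrix_(i, j) c (rshift n i, j)).
Proof.
transitivity (\sum_(i : I) \sum_j c (i, j) *: unit_of (i, j)).
  by rewrite pair_bigA; apply: eq_bigr => [[i j] _].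
rewrite big_split_ord /=.
rewrite /unit_of /=; under eq_bigr do under eq_bigr do rewrite (unsplitK (inl _)).
under [X in _ + X]eq_bigr do under eq_bigr do rewrite (unsplitK (inr _)).
rewrite [in RHS](matrix_sum_delta (\matrix_(i, j) c (lshift n i, j))).
rewrite [in RHS](matrix_sum_delta (\matrix_(i, j) c (rshift n i, j))).
have e1 (G : 'I_n -> 'I_n -> F) : \sum_i \sum_j G i j *: ((delta_mx i j, 0) : qmx F n) =
    (\sum_i \sum_j G i j *: delta_mx i j, 0).
  rewrite [LHS]surjective_pairing; congr pair.
    by rewrite (raddf_sum fst) /=; apply: eq_bigr => i _; rewrite (raddf_sum fst).
  by rewrite (raddf_sum snd) /= big1 // => i _; rewrite (raddf_sum snd) big1 // => j _; rewrite /= scaler0.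
have e2 (G : 'I_n -> 'I_n -> F) : \sum_i \sum_j G i j *: ((0, delta_mx i j) : qmx F n) =
    (0, \sum_i \sum_j G i j *: delta_mx i j).
  rewrite [LHS]surjective_pairing; congr pair.
    by rewrite (raddf_sum fst) /= big1 // => i _; rewrite (raddf_sum fst) big1 // => j _; rewrite /= scaler0.
  by rewrite (raddf_sum snd) /=; apply: eq_bigr => i _; rewrite (raddf_sum snd).
rewrite e1 e2; congr pair; rewrite /= ?addr0 ?add0r;
  by apply: eq_bigr => i _; apply: eq_bigr => j _; rewrite mxE.
Qed.

Lemma unit_of_par p (t : qidx n) : qco l (unit_of p) t != 0 -> bpar p.1 = t.2.
Proof.
case: t => [[i j] b]; rewrite /unit_of; case: p => p1 p2 /=.
case: splitP => q hq /=; rewrite /bpar hq ?leq_addr 1?leqNgt ?ltn_ord /=;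
  case: b; rewrite // ?mxE ?linear0 ?mulr0 ?subr0 ?if_same ?eqxx //.
Qed.

Let char0 m : m.+1%:R != 0 :> F. Proof. by rewrite pnatr_eq0. Qed.
Local Notation X := (qbasis F k l).

Lemma qrep_nonproj M x : ~~ projective k -> qtype_image M x -> qrep x = M.
Proof.
move=> /negPf np hM; have := image_lin (-1) hM (qrepP x).
rewrite !scaleN1r addNr => /image_ker; rewrite np => /eqP.
by rewrite addrC subr_eq0 => /eqP.
Qed.

(** The point [v0] consists of the even basis vectors, one in each of n copies of the natural
    module. Then x.v0 is the first block column of X_{A,B}, which determines A and B. *)
Lemma qfree_nonproj : ~~ projective k -> pbw_free X.
Proof.
move=> np; pose r x (i j : I) := qX (qrep x) i j.
pose v0 (i : I) (j : 'I_n) : F := (i == lshift n j)%:R.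
apply: (@osc_free F g I 'I_n bpar r v0 _ _ _ _ _ X
  (fun t p => qco l (unit_of p) (val t))) => //.
- move=> a x y i0 j0; rewrite /r (@qrep_nonproj (a *: qrep x + qrep y)) //.
    by rewrite qX_lin !mxE.
  by apply: image_lin; apply: qrepP.
- move=> b x i0 j0 /image_homog_ex[M hM hx]; rewrite /r (qrep_nonproj np hx).
  exact: qX_homog.
- move=> a b x y i0 j0 /image_homog_ex[M hM hx] /image_homog_ex[N hN hy].
  rewrite /r (qrep_nonproj np hx) (qrep_nonproj np hy).
  rewrite (@qrep_nonproj (q_br M N)) //; last exact: image_br.
  exact: qX_br.
- move=> i0 j; rewrite /v0; case: (eqVneq i0 (lshift n j)) => [->|]; rewrite ?eqxx //.
  by rewrite bpar_l.
- by move=> t p; apply: unit_of_par.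
move=> t t'; have <- : qcoord (qelt F t') t = (t == t')%:R.
  by rewrite eq_sym; exact: qcoord_elt.
rewrite (qcoordE _ (qrepP _)).
have -> : qrep (qelt F t') = \sum_p (\sum_j r (sb_elt (s := X) t') p.1 j * v0 j p.2) *: unit_of p.
  rewrite sum_unit_of [LHS]surjective_pairing; congr pair; apply/matrixP => i j; rewrite !mxE /=.
    rewrite (bigD1 (lshift n j)) //= big1 ?addr0 /v0 ?eqxx ?mulr1 /r /qX ?block_mxEul //.
    by move=> c /negPf ->; rewrite mulr0.
  rewrite (bigD1 (lshift n j)) //= big1 ?addr0 /v0 ?eqxx ?mulr1 /r /qX ?block_mxEdl //.
  by move=> c /negPf ->; rewrite mulr0.
by rewrite qco_sum; apply: eq_bigr => p _; rewrite mulrC.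
Qed.

(** Reading the parity off the indices makes the supercommutator linear in M. Scalar matrices act by
    0 ([adq_Id]), so the action descends to the quotients. *)
Definition adq M (P Q : I * I) : F :=
  adm bpar (fun P Q => bpar P.2 (+) bpar Q.2) (qX M) P Q.

Lemma adq_homog (b : bool) M P Q : homog (@q_ev F n) b M ->
  adq M P Q = adm bpar (fun _ _ => b) (qX M) P Q.
Proof.
move=> /qX_homog hM; rewrite /adq /adm; congr (_ - _).
have [->|/hM ->] := eqVneq (qX M Q.2 P.2) 0; first by rewrite !mulr0.
by rewrite [bpar Q.2 (+) _]addbC.
Qed.
Lemma adq_lin a M N P Q : adq (a *: M + N) P Q = a * adq M P Q + adq N P Q.
Proof. by rewrite /adq /adm qX_lin !mxE; ring. Qed.
Lemma adq_Id a P Q : adq (a%:M, 0) P Q = 0.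
Proof.
rewrite /adq /adm; have qXE (i j : I) : qX ((a%:M, 0) : qmx F n) i j = (i == j)%:R * a.
  by rewrite /qX -scalar_mx_block mxE mulr_natl.
rewrite !qXE; case: (eqVneq P.2 Q.2) => [<-|h]; rewrite ?addbb /=; last first.
  by rewrite !(mulr0, mul0r) subrr.
by rewrite expr0; ring.
Qed.
Lemma adq_image M x P Q : projective k -> qtype_image M x -> adq (qrep x) P Q = adq M P Q.
Proof.
move=> pk hM; have := image_lin (-1) hM (qrepP x); rewrite !scaleN1r addNr => /image_ker.
rewrite pk => -[a ha]; have -> : qrep x = 1 *: M + (- M + qrep x).
  by rewrite scale1r addrA subrr add0r.
by rewrite adq_lin mul1r ha adq_Id addr0.
Qed.

(** The point [v0] has the matrix unit E_jl in its j-th copy, for even indices j and l, and the dual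
    forms only look at column l of the supercommutator. *)
Lemma qfree_proj : projective k -> pbw_free X.
Proof.
move=> pk; pose r x (P Q : I * I) := adq (qrep x) P Q.
pose v0 (P : I * I) (j : 'I_n) : F := (P == (lshift n j, lshift n l))%:R.
apply: (@osc_free F g (I * I)%type 'I_n (gparity bpar) r v0 _ _ _ _ _ X
  (fun t p => (p.1.2 == lshift n l)%:R * qco l (unit_of (p.1.1, p.2)) (val t))) => //.
- move=> a x y P Q; rewrite /r (@adq_image (a *: qrep x + qrep y)) //.
    exact: adq_lin.
  by apply: image_lin; apply: qrepP.
- move=> b x P Q /image_homog_ex[M hM hx]; rewrite /r (adq_image _ _ pk hx) (adq_homog _ _ hM).
  have hX := qX_homog hM; rewrite /adm /gparity.
  have [e2|n2] := eqVneq P.2 Q.2; last first.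
    rewrite mulr0 sub0r oppr_eq0 mulf_eq0 signr_eq0 mulf_eq0 /=.
    case: (eqVneq P.1 Q.1) => [->|_] //=; rewrite ?eqxx // oner_eq0 /= => /hX ->.
    by case: (bpar Q.1); case: (bpar Q.2); case: (bpar P.2).
  case: (eqVneq P.1 Q.1) => [e1|n1]; last first.
    rewrite mul0r mulr0 subr0 mulr1 => /hX ->; rewrite e2.
    by case: (bpar P.1); case: (bpar Q.1); case: (bpar Q.2).
  rewrite e1 e2 !addbb mulr1 mul1r => h; have [h0|/hX ->] := eqVneq (qX M Q.1 Q.1) 0.
    move: h; rewrite h0 sub0r oppr_eq0 mulf_eq0 signr_eq0 /= => /hX ->.
    by case: (bpar Q.1); case: (bpar Q.2).
  by case: (bpar Q.1); case: (bpar Q.2).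
- move=> a b x y P Q /image_homog_ex[M hM hx] /image_homog_ex[N hN hy].
  rewrite /r (adq_image _ _ pk (image_br hx hy)) (adq_homog _ _ (q_br_homog hM hN)).
  have := adm_br P Q (qX_homog hM) (qX_homog hN); rewrite /adm !(qX_br _ _ hM hN) => ->.
  by congr (_ - _ * _); apply: eq_bigr => R _;
    rewrite !(adq_image _ _ pk hx) !(adq_image _ _ pk hy) !(adq_homog _ _ hM) !(adq_homog _ _ hN).
- move=> P j; rewrite /v0; case: (eqVneq P (lshift n j, lshift n l)) => [->|]; rewrite ?eqxx //.
  by rewrite /gparity /= !bpar_l.
- move=> t [[i q] j] /=; rewrite mulf_eq0 negb_or pnatr_eq0 eqb0 negbK => /andP[/eqP -> /unit_of_par].
  by rewrite /gparity /= bpar_l addbF.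
move=> t t'; have <- : qcoord (qelt F t') t = (t == t')%:R.
  by rewrite eq_sym; exact: qcoord_elt.
rewrite (qcoordE _ (qrepP _)).
set M := qrep _.
have hq P j : \sum_Q r (sb_elt (s := X) t') P Q * v0 Q j = adq M P (lshift n j, lshift n l).
  rewrite (bigD1 (lshift n j, lshift n l)) //= big1 ?addr0 /v0 ?eqxx ?mulr1 //.
  by move=> Q /negPf ->; rewrite mulr0.
under eq_bigr do rewrite hq.
transitivity (qco l (\sum_p adq M (p.1, lshift n l) (lshift n p.2, lshift n l) *: unit_of p) (val t)).
  rewrite qco_sum -(pair_bigA _ (fun P j => (P.2 == lshift n l)%:R * qco l (unit_of (P.1, j)) (val t)
    * adq M P (lshift n j, lshift n l))) /=.
  rewrite -(pair_bigA _ (fun (i q : I) => \sum_j (q == lshift n l)%:R * qco l (unit_of (i, j)) (val t)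
    * adq M (i, q) (lshift n j, lshift n l))) /=.
  rewrite -(pair_bigA _ (fun (i : I) j => adq M (i, lshift n l) (lshift n j, lshift n l)
     * qco l (unit_of (i, j)) (val t))) /=.
  apply: eq_bigr => i _; rewrite (bigD1 (lshift n l)) //= [X in _ + X]big1 ?addr0.
    by apply: eq_bigr => j _; rewrite eqxx mul1r mulrC.
  by move=> q /negPf ->; rewrite big1 // => j _; rewrite !mul0r.
(* Column l of [X, E_jl] has entries X_ij - delta_ij X_ll: the matrix M is recovered up to a scalar
   matrix, which the kept coordinates do not see. *)
rewrite sum_unit_of (_ : (_, _) = (- M.1 l l) *: ((1%:M, 0) : qmx F n) + M).
  by rewrite qco_lin qco_Id // mulr0 add0r.
rewrite [M in RHS]surjective_pairing; congr pair; apply/matrixP => i j; rewrite !mxE /adq /adm /=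
  ?bpar_l ?bpar_r /= ?eqxx ?(inj_eq (@lshift_inj _ _)) /qX ?(block_mxEul, block_mxEdl) ?mulr1 /gparity /=
  ?bpar_l ?bpar_r /= ?mul1r.
  by rewrite mulNr addrC mulrC.
by rewrite eq_rlshift mul0r subr0 mulr0 add0r.
Qed.

Lemma qfree : pbw_free X.
Proof. by case pk: (projective k); [apply: qfree_proj | apply: qfree_nonproj; rewrite pk]. Qed.
End QFree.

(** * Root vectors and their pairing *)

Section QRoots.
Variables (F : numFieldType) (k : qkind) (n : nat) (l : 'I_n).
Hypothesis hkn : qtype_rank k n.
Local Notation g := (qtypeLie F k n).
Local Notation Y := (qbasis F k l).
Local Notation T := (sb_idx Y).
Local Notation e := (@sb_elt F g Y).
Local Notation E := (@delta_mx F n n).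
Implicit Types (t s : T) (i j : 'I_n) (b : bool).

Definition source t : 'I_n := (val t).1.1.
Definition target t : 'I_n := (val t).1.2.

Lemma q_weight (D : 'M[F]_n) (h : g) : is_diag_mx D -> qtype_image (D, 0) h ->
  is_weight (X := Y) h (fun t => D (source t) (source t) - D (target t) (target t)).
Proof.
move=> hD hh; split; first by apply: (image_homog hh); apply/q_homogP.
move=> t; apply: (image_inj (image_br hh (qeltP F t))).
rewrite qmat_diag_br // -[X in qtype_image X]addr0 -[X in qtype_image _ X]addr0.
by apply: image_lin; [apply: qeltP | apply: image0].
Qed.

(** Its eigenvalue on E_ij is j - i, the height, so heights become weights of one even element. *)
Definition height_matrix : 'M[F]_n := diag_mx (\row_i - (i : nat)%:R).

Lemma height_weight : exists h : g, is_weight (X := Y) h (fun t => (qht t)%:~R).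
Proof.
have [h hh] : exists h : g, qtype_image (height_matrix, 0) h.
  by apply: image_ex => _; rewrite linear0.
exists h; have := q_weight (diag_mx_is_diag _) hh.
congr is_weight; apply/funext => t; rewrite !mxE !eqxx !mulr1n /qht /source /target.
by rewrite rmorphB /= opprK addrC.
Qed.

Lemma root_keep i j b : i != j -> qkeep k l (i, j, b).
Proof.
move=> ij; rewrite /qkeep; have h b' : ((i, j, b) == (l, l, b')) = false.
  by apply/eqP => -[hi hj _]; rewrite hi hj eqxx in ij.
by rewrite !h !andbF.
Qed.
Definition root_idx i j b (ij : i != j) : T := exist _ (i, j, b) (root_keep b ij).

Lemma root_elt i j b (ij : i != j) :
  qtype_image (if b then (0, E i j) else (E i j, 0)) (e (root_idx b ij)).
Proof.
have := qeltP F (root_idx b ij); rewrite /qmat /= (negPf ij).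
suff -> : (i == l) && (j == l) = false by case: b.
by apply/negP => /andP[/eqP hi /eqP hj]; rewrite hi hj eqxx in ij.
Qed.

Lemma image_neq0 A (x : g) i j : qtype_image (A, 0) x -> i != j ->
  A i i != A j j -> x != 0.
Proof.
move=> hx ij; apply: contraNneq => x0; rewrite x0 in hx; have := image_ker hx.
by case: ifP => _ => [[a]|] /(congr1 fst) /= ->; rewrite !mxE ?eqxx.
Qed.

Lemma delta_mul i j i' j' : E i j *m E i' j' = (j == i')%:R *: E i j'.
Proof. by rewrite mul_delta_mx_cond scaler_nat. Qed.

Lemma root_pairings t : pos (X := Y) (@qht k n l) t -> root_pairing (X := Y) (@qht k n l) t.
Proof.
case: t => [[[i j] b] ht]; rewrite /pos /qht /= subr_gt0 => lt_ij.
have ij : i != j by apply/eqP => h; rewrite h ltxx in lt_ij.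
have ji : j != i by rewrite eq_sym.
pose x := root_idx false ij; pose xo := root_idx true ij.
pose y := root_idx false ji; pose yo := root_idx true ji.
have hx := root_elt false ij; have hxo := root_elt true ij.
have hy := root_elt false ji; have hyo := root_elt true ji.
rewrite /= -/x -/xo -/y -/yo in hx hxo hy hyo.
have b1 := image_br hy hx; have b2 := image_br hy hxo.
have b3 := image_br hyo hx; have b4 := image_br hyo hxo.
rewrite q_br_even /= !delta_mul !eqxx !scale1r mulmx0 mul0mx subrr in b1.
rewrite q_br_even /= !delta_mul !eqxx !scale1r mulmx0 mul0mx subrr in b2.
rewrite q_br_odd /= !delta_mul !eqxx !scale1r mulmx0 mul0mx addr0 in b3.
rewrite q_br_odd /= !delta_mul !eqxx !scale1r mulmx0 mul0mx subrr in b4.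
exists x, xo, y, yo, (ls_br (e y) (e xo)); split.
- by split=> //; case: b ht => ht; [right|left]; apply: val_inj.
- by split=> //; rewrite /qht /= opprB.
(* Since j' - i' = j - i, a letter other than x and xo has i' != i and j' != j, so both products of
   E_ji with E_i'j' vanish. *)
- move=> s; case: s => [[[i' j'] b'] hs'] /=; rewrite /qht /= => hd sx sxo.
  set s : T := exist _ _ _.
  have nii : i != i'.
    apply/eqP => hi; subst i'; have hj : j' = j by apply: val_inj => /=; lia.
    subst j'; case: b' hs' @s sx sxo => hs' s sx sxo.
      by case/eqP: sxo; apply: val_inj.
    by case/eqP: sx; apply: val_inj.
  have njj : j' != j.
    apply: contra nii => /eqP hj; subst j'; apply/eqP/val_inj => /=; lia.
  have i'j' : i' != j'.
    by apply/eqP => h; subst j'; move: hd lt_ij; lia.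
  have hs : qtype_image (if b' then (0, E i' j') else (E i' j', 0)) (e s).
    have := root_elt b' i'j'; congr qtype_image; congr qelt; exact: val_inj.
  have c1 := image_br hy hs; have c2 := image_br hyo hs.
  rewrite q_br_even in c1; rewrite q_br_odd in c2.
  split; [apply: (image_inj c1) | apply: (image_inj c2)];
    case: b' {hs' s sx sxo hs c1 c2}; rewrite /= !(mulmx0, mul0mx, delta_mul) (negPf nii) (negPf njj)
      !scale0r ?subrr ?addr0; exact: image0.
split=> //.
  by apply: (image_inj b3).
split.
  apply: (image_neq0 b1 ij); rewrite !mxE !eqxx (negPf ij) (negPf ji) /=.
  by rewrite sub0r subr0 -subr_eq0 -opprD oppr_eq0 -(natrD _ 1 1) pnatr_eq0.
(* This h' is the image of E_jj + E_ii. Modulo the identity it is nonzero thanks to a third diagonal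
   position c, whence n >= 3; in the other families it suffices that the matrix is nonzero. *)
have [np|pk] := boolP (~~ projective k).
  apply/eqP => h0; rewrite h0 in b4; have := image_ker b4.
  rewrite (negPf np) => -[/matrixP/(_ j j)]; rewrite !mxE !eqxx (negPf ji) /= addr0.
  by move/eqP; rewrite oner_eq0.
have n3 : (3 <= n)%N by move: hkn pk; rewrite negbK /projective; case: (k).
have [c /andP[ci cj]] : exists c : 'I_n, (c != i) && (c != j).
  apply/existsP; rewrite -[[exists _, _]]negbK negb_exists; apply/negP => /forallP hc.
  have : (#|'I_n| <= #|pred2 i j|)%N.
    apply/subset_leq_card/fintype.subsetP => c _; rewrite !inE.
    by have := hc c; rewrite negb_and !negbK.
  by rewrite card_ord card2 ij; lia.
apply: (image_neq0 b4 ci); rewrite !mxE !eqxx (negPf ci) (negPf cj) (negPf ij) /=.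
by rewrite !addr0 add0r eq_sym oner_eq0.
Qed.
End QRoots.

(** * The completion and its centre *)

Section Completion.
Variables (R : realType) (k : qkind) (n : nat) (l : 'I_n).
Local Notation C := (R[i] : numFieldType).
Local Notation g := (qtypeLie R[i] k n).
Local Notation Y := (qbasis C k l).
Local Notation U := (uea g).
Local Notation T := (sb_idx Y).
Local Notation e := (@sb_elt C g Y).
Local Notation co := (@sb_co C g Y).
Local Notation par := (@sb_par C g Y).
Local Notation coord := (@coord C g Y).
Local Notation cspan := (@cspan C g Y).
Local Notation wprod := (@wprod C g Y).
Local Notation ht := (@qht k n l).
Local Notation pos := (@pos C g Y ht).
Local Notation source := (@source C k n l).
Local Notation target := (@target C k n l).
Local Notation Qp := (Qplus n).
Let free : pbw_free Y := @qfree C k n l.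
Implicit Types (t s : T) (m : mon T) (u v : U) (nu ka : Qp).

Definition null : pred T := fun t => ht t == 0.

Lemma htE t : ht t = (target t)%:Z - (source t)%:Z. Proof. by []. Qed.

Lemma g_of_co (P : 'M[R[i]]_n -> Prop) x t : g_of P x -> co x t != 0 ->
  exists M : qmx R[i] n, [/\ P M.1, P M.2 & qco l M (val t) != 0].
Proof.
move=> [A [B [hA hB hx]]]; rewrite /sb_co /= (qcoordE _ hx) => h.
by exists (A, B).
Qed.

Lemma nplus_co x t : nplus x -> co x t != 0 -> pos t.
Proof.
move=> hx /(g_of_co hx)[[A B] [/= hA hB]]; case: t => [[[i j] b] ht0] /=.
rewrite /pos htE /source /target /= subr_gt0 ltz_nat ltnNge; apply: contraNN => ji.
have tr0 : \tr B = 0 by rewrite /mxtrace big1 // => c _; apply: hB.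
case: b ht0 => _; first by rewrite hB // tr0 if_same.
by rewrite (hA i j) // (hA l l) // mulr0 subrr if_same.
Qed.
Lemma nminus_co x t : nminus x -> co x t != 0 -> ht t < 0.
Proof.
move=> hx /(g_of_co hx)[[A B] [/= hA hB]]; case: t => [[[i j] b] ht0] /=.
rewrite htE /source /target /= subr_lt0 ltz_nat ltnNge; apply: contraNN => ji.
have tr0 : \tr B = 0 by rewrite /mxtrace big1 // => c _; apply: hB.
case: b ht0 => _; first by rewrite hB // tr0 if_same.
by rewrite (hA i j) // (hA l l) // mulr0 subrr if_same.
Qed.
Lemma hh_co x t : hh x -> co x t != 0 -> null t.
Proof.
move=> hx /(g_of_co hx)[[A B] [/= /is_diag_mxP hA /is_diag_mxP hB]].
case: t => [[[i j] b] ht0] /=.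
rewrite /null htE /source /target /= subr_eq0 eqz_nat; apply: contraNT => ji.
have ij : i != j :> nat by rewrite eq_sym.
have nl : (i == l) && (j == l) = false.
  by apply/negP => /andP[/eqP hi /eqP hj]; rewrite hi hj eqxx in ij.
case: b ht0 => _; rewrite nl; first by rewrite hB.
by rewrite hA // -val_eqE /= (negPf ij) mul0r subr0.
Qed.
Lemma bminus_co x t : bminus x -> co x t != 0 -> predC pos t.
Proof.
move=> [y hy [z hz <-]]; rewrite sb_coD => h0.
suff : ht t <= 0 by rewrite /= /pos -leNgt.
have [h|h] := eqVneq (co y t) 0; last by rewrite (eqP (hh_co hy h)).
by move: h0; rewrite h add0r => /(nminus_co hz)/ltW.
Qed.

Lemma nplus_elt t : pos t -> nplus (e t).
Proof.
move=> ht0; exists (qmat C l (val t)).1, (qmat C l (val t)).2.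
split; last by rewrite -surjective_pairing; apply: qeltP.
  move: ht0; case: t => [[[i j] b] h]; rewrite /pos htE /source /target /=.
  rewrite subr_gt0 ltz_nat => ij a c ac; case: b h => h; rewrite /= ?mxE //.
  case: ifP => [/andP[/eqP hi /eqP hj]|_]; first by move: ij; rewrite hi hj ltnn.
  rewrite deltaE; case: eqP => //= hi; case: eqP => //= hj.
  by move: ij; rewrite hi hj ltnNge ac.
move: ht0; case: t => [[[i j] b] h]; rewrite /pos htE /source /target /=.
rewrite subr_gt0 ltz_nat => ij a c ac; case: b h => h; rewrite /= ?mxE //.
have -> : (i == j) = false by apply/eqP => hij; move: ij; rewrite hij ltnn.
rewrite deltaE; case: eqP => //= hi; case: eqP => //= hj.
by move: ij; rewrite hi hj ltnNge ac.
Qed.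
Lemma nminus_elt t : ht t < 0 -> nminus (e t).
Proof.
move=> ht0; exists (qmat C l (val t)).1, (qmat C l (val t)).2.
split; last by rewrite -surjective_pairing; apply: qeltP.
  move: ht0; case: t => [[[i j] b] h]; rewrite htE /source /target /=.
  rewrite subr_lt0 ltz_nat => ij a c ac; case: b h => h; rewrite /= ?mxE //.
  case: ifP => [/andP[/eqP hi /eqP hj]|_]; first by move: ij; rewrite hi hj ltnn.
  rewrite deltaE; case: eqP => //= hi; case: eqP => //= hj.
  by move: ij; rewrite hi hj ltnNge ac.
move: ht0; case: t => [[[i j] b] h]; rewrite htE /source /target /=.
rewrite subr_lt0 ltz_nat => ij a c ac; case: b h => h; rewrite /= ?mxE //.
have -> : (i == j) = false by apply/eqP => hij; move: ij; rewrite hij ltnn.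
rewrite deltaE; case: eqP => //= hi; case: eqP => //= hj.
by move: ij; rewrite hi hj ltnNge ac.
Qed.
Lemma hh_elt t : null t -> hh (e t).
Proof.
move=> ht0; exists (qmat C l (val t)).1, (qmat C l (val t)).2.
have dd i : is_diag_mx (delta_mx i i : 'M[R[i]]_n).
  apply/is_diag_mxP => a c ac; rewrite deltaE; case: eqP => //= ia; case: eqP => //= ic.
  by rewrite -ia -ic eqxx in ac.
have d0 : is_diag_mx (0 : 'M[R[i]]_n) by apply/is_diag_mxP => a c _; rewrite mxE.
split; last by rewrite -surjective_pairing; apply: qeltP.
  move: ht0; case: t => [[[i j] b] h]; rewrite /null htE /source /target /=.
  rewrite subr_eq0 eqz_nat => /eqP/val_inj ij; subst j; case: b h => //= h.
  by case: ifP => // _; apply: scalar_mx_is_diag.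
move: ht0; case: t => [[[i j] b] h]; rewrite /null htE /source /target /=.
rewrite subr_eq0 eqz_nat => /eqP/val_inj ij; subst j; case: b h => //= h.
rewrite eqxx; case: ifP => // _; apply/is_diag_mxP => a c ac.
move/is_diag_mxP: (dd i) => hi; move/is_diag_mxP: (dd l) => hl.
by rewrite mxE [X in _ + X]mxE hi // hl // subrr.
Qed.
Lemma bminus_elt t : predC pos t -> bminus (e t).
Proof.
rewrite /= /pos -leNgt le_eqVlt => /orP[h|h].
  exists (e t); first exact: hh_elt.
  exists 0; last by rewrite addr0.
  by exists 0, 0; split; [move=> a c _; rewrite mxE|move=> a c _; rewrite mxE|apply: image0].
exists 0; last by exists (e t); [apply: nminus_elt|rewrite add0r].
by exists 0, 0; split; [apply/is_diag_mxP => a c _; rewrite mxE..|apply: image0].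
Qed.

(** For a subalgebra spanned by basis vectors, a product of its elements expands into words in those
    letters, and straightening by [Ulow_cspan] does not leave them. *)
Lemma UofE (S : set g) (B : pred T) : bclosed (X := Y) B ->
  (forall x t, S x -> co x t != 0 -> B t) -> (forall t, B t -> S (e t)) ->
  Uof S = cspan (supported B).
Proof.
move=> hB h1 h2; apply/seteqP; split.
  apply: linspan_sub => [|_ [s hs <-]]; first exact: cspan_closed.
  suff [p /(Ulow_cspan free hB)] : exists p, Ulow (X := Y) B p (\prod_(x <- s) uiota x).
    by apply: cspan_sub => m [].
  elim: s hs => [_|x s IH hs].
    by exists 0%N; rewrite big_nil -(wprod_nil Y); apply: Ulow_word.
  have [p hp] : exists p, Ulow (X := Y) B p (\prod_(x <- s) uiota x).
    by apply: IH => y hy; apply: hs; rewrite inE hy orbT.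
  exists (1 + p)%N; rewrite big_cons; apply: UlowM => //.
  rewrite (uiota_sum Y); apply: (lclosed_sum _ (Ulow_closed _ _)) => t _.
  have [->|ht0] := eqVneq (co x t) 0.
    by rewrite scale0r; case: (Ulow_closed (X := Y) B 1).
  apply: (lclosedZ _ (Ulow_closed _ _)).
  have -> : uiota (e t) = wprod [:: t] by rewrite /wprod big_seq1.
  apply: Ulow_word => //=; rewrite andbT; apply: (h1 x) => //.
  by apply: hs; rewrite mem_head.
apply: cspan_ind => [|m vm sm]; first exact: linspan_closed.
apply: linspan_in; exists (map e (mword (sb_seq Y) m)); last first.
  by rewrite big_map.
move=> x /mapP[t htm ->]; apply: h2.
by move: sm; rewrite -(all_mword (sb_all (s := Y))) => /allP; apply.
Qed.

Lemma q_br_height t s r : co (ls_br (e t) (e s)) r != 0 -> ht r = ht t + ht s.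
Proof. by have [h hw] := height_weight C k l; apply: br_height hw _ _ _. Qed.

Lemma Uof_nplus : Uof (@nplus R k n) = cspan (supported pos).
Proof.
apply: UofE; [| exact: nplus_co | exact: nplus_elt].
by have [h hw] := height_weight C k l; apply: bclosed_pos hw.
Qed.
Lemma Uof_bminus : Uof (@bminus R k n) = cspan (supported (predC pos)).
Proof.
apply: UofE; [| exact: bminus_co | exact: bminus_elt].
by have [h hw] := height_weight C k l; apply: bclosed_npos hw.
Qed.
Lemma Uof_hh : Uof (@hh R k n) = cspan (supported null).
Proof.
apply: UofE; [| exact: hh_co | exact: hh_elt].
by move=> a b t; rewrite /null => /eqP ha /eqP hb /q_br_height ->; rewrite ha hb.
Qed.

(** The root eps_i - eps_j is the sum of the simple roots alpha_s with i <= s < j. *)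
Definition root_wt t : Qp := [ffun s : 'I_n.-1 => ((source t <= s) && (s < target t))%N : nat].
(** The [nu] such that the monomial lies in J'(nu) (see [JE]): letters of b^- do not count. *)
Definition posw m : Qp := [ffun s : 'I_n.-1 => (\sum_(t | pos t) m t * root_wt t s)%N].

Lemma telescope (D : 'M[R[i]]_n) (i j : 'I_n) : (i <= j)%N ->
  D i i - D j j = \sum_(s : 'I_n.-1) ((i <= s) && (s < j))%N%:R
     * (D (ord_lo s) (ord_lo s) - D (ord_hi s) (ord_hi s)).
Proof.
move=> ij; pose d (s : nat) : R[i] := if insub s is Some q then D q q else 0.
have dE (q : 'I_n) : d q = D q q by rewrite /d valK.
rewrite -!dE; transitivity (\sum_(i <= s < j) (d s - d s.+1)).
  by rewrite -[LHS]opprB -(telescope_sumr _ ij) -sumrN; apply: eq_bigr => s _; rewrite opprB.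
rewrite (eq_bigr (fun s : 'I_n.-1 => ((i <= s) && (s < j))%N%:R * (d s - d s.+1))); last first.
  by move=> s _; rewrite -!dE.
have jn : (j <= n.-1)%N by rewrite -ltnS (leq_trans (ltn_ord j)) // leqSpred.
rewrite -(big_mkord xpredT (fun s : nat => ((i <= s) && (s < j))%N%:R * (d s - d s.+1))).
rewrite [RHS](big_cat_nat (n := i)) ?(leq_trans ij) //= [X in _ = X + _]big1_seq ?add0r => [|s]; last first.
  by rewrite mem_index_iota => /andP[_ /andP[_ si]]; rewrite leqNgt si mul0r.
rewrite [RHS](big_cat_nat (n := j)) //= [X in _ = _ + X]big1_seq ?addr0 => [|s]; last first.
  by rewrite mem_index_iota => /andP[_ /andP[js _]]; rewrite [(s < j)%N]ltnNge js andbF mul0r.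
by rewrite big_nat [RHS]big_nat; apply: eq_bigr => s ->; rewrite mul1r.
Qed.

Lemma pos_lt t : pos t = (source t < target t)%N.
Proof. by rewrite /pos htE subr_gt0 ltz_nat. Qed.

Lemma mweight_posw (D : 'M[R[i]]_n) m : supported pos m ->
  mweight (X := Y) (fun t => D (source t) (source t) - D (target t) (target t)) m = Qval (posw m) D.
Proof.
move=> /forallP sm; rewrite /mweight (bigID pos) /= [X in _ + X]big1 ?addr0 => [|t hp]; last first.
  suff -> : m t = 0%N by rewrite mul0r.
  by apply/eqP; rewrite -leqn0 leqNgt; apply: contra hp => /(implyP (sm t)).
rewrite /Qval; under [RHS]eq_bigr do rewrite ffunE natr_sum mulr_suml.
rewrite exchange_big /=; apply: eq_bigr => t; rewrite pos_lt => /ltnW ht0.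
rewrite (telescope D ht0) mulr_sumr; apply: eq_bigr => s _.
by rewrite ffunE natrM mulrA.
Qed.

(** Test with the diagonal matrix having 1 in positions up to s and 0 after: it is the fundamental
    coweight dual to the simple root alpha_s. *)
Lemma Qval_inj nu ka : (forall D : 'M[R[i]]_n, is_diag_mx D -> Qval nu D = Qval ka D) -> nu = ka.
Proof.
move=> h; apply/ffunP => s.
pose D : 'M[R[i]]_n := diag_mx (\row_(i < n) (i <= s)%N%:R).
have DE (q : Qp) : Qval q D = (q s)%:R.
  rewrite /Qval (bigD1 s) //= big1 ?addr0 => [|r hr].
    by rewrite !mxE !eqxx !mulr1n leqnn ltnn subr0 mulr1.
  rewrite !mxE !eqxx !mulr1n /=; suff -> : (r <= s)%N = (r < s)%N by rewrite subrr mulr0.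
  by rewrite leq_eqVlt val_eqE (negPf hr).
have := h D (diag_mx_is_diag _); rewrite !DE => /eqP.
by rewrite eqr_nat => /eqP.
Qed.

Lemma diag_image (D : 'M[R[i]]_n) : exists h : g, qtype_image (D, 0) h.
Proof. by apply: image_ex => _; rewrite linear0. Qed.

Lemma Unplus_cspan nu u : Unplus nu u ->
  cspan (fun m => supported pos m /\ posw m = nu) u.
Proof.
move=> [hu hw] m hm; have sm : supported pos m.
  by move: hu; rewrite Uof_nplus => /(_ m hm).
split=> //; apply: Qval_inj => D hD; have [h hh] := diag_image D.
have := coord_commutator free u m (@q_weight C k n l _ _ hD hh).
have -> : commutator h u = Qval nu D *: u by apply: hw.
rewrite (coordZ free) mweight_posw // => /eqP; rewrite -subr_eq0 -mulrBl mulf_eq0.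
by rewrite (negPf hm) orbF subr_eq0 => /eqP ->.
Qed.

Lemma mono_Unplus m : valid par m -> supported pos m -> Unplus (posw m) (mono (X := Y) m).
Proof.
move=> vm sm; split.
  by rewrite Uof_nplus; apply: cspan_mono.
move=> D h hD hh; have := commutator_word (mword (sb_seq Y) m) (@q_weight C k n l _ _ hD hh).
by rewrite wweight_mword mweight_posw.
Qed.

Lemma posw_restr m : posw (restr pos m) = posw m.
Proof. by apply/ffunP => s; rewrite !ffunE; apply: eq_bigr => t hp; rewrite ffunE hp. Qed.

Definition qpos : sb_seq Y = [seq a <- sb_seq Y | ~~ pos a] ++ [seq a <- sb_seq Y | ~~ ~~ pos a]
  := @qseq_pos C k n l.

(** Both factors of J'(nu) have monomial bases, and by the order of the letters their products are
    again PBW monomials. So membership in the completion is a condition on coordinates. *)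
Lemma JE nu : @J R k n nu = cspan (fun m => posw m = nu).
Proof.
apply/seteqP; split; last first.
  apply: cspan_ind => [|m vm <-]; first exact: linspan_closed.
  rewrite (mono_split qpos); apply: linspan_in.
  exists (mono (X := Y) (restr (predC pos) m)).
    rewrite Uof_bminus; apply: (cspan_mono free); first exact: restr_valid.
    exact: restr_supported.
  exists (mono (X := Y) (restr pos m)) => //; rewrite -posw_restr.
  by apply: mono_Unplus; [apply: restr_valid | apply: restr_supported].
apply: linspan_sub => [|_ [a ha [b /Unplus_cspan hb <-]]]; first exact: cspan_closed.
have cl := cspan_closed free (fun m => posw m = nu).
move: a ha; rewrite Uof_bminus; apply: cspan_ind => [|m vm sm].
  split=> [|c x y hx hy]; rewrite /= ?mul0r ?mulrDl -?scalerAl; by case: cl => // _; apply.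
move: b hb; apply: cspan_ind => [|m' vm' [sm' pm']].
  split=> [|c x y hx hy]; rewrite /= ?mulr0 ?mulrDr -?scalerAr; by case: cl => // _; apply.
have sm2 : supported (predC (predC pos)) m'.
  by apply/forallP => t; rewrite /= negbK; apply: (forallP sm').
rewrite /= -(mono_madd qpos sm sm2); apply: (cspan_mono free).
  exact: (madd_valid sm sm2).
rewrite -pm'; apply/ffunP => s; rewrite !ffunE; apply: eq_bigr => t hp.
rewrite ffunE; suff -> : m t = 0%N by [].
by apply/eqP; rewrite -leqn0 leqNgt; apply/negP => /(implyP (forallP sm t)); rewrite /= hp.
Qed.

Lemma nht_posw m : @nht C g Y ht m = (height (posw m))%:Z.
Proof.
rewrite /nht /height (eq_bigr (fun s : 'I_n.-1 => \sum_(t | pos t) m t * root_wt t s)%N) => [|s _]; last by rewrite ffunE.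
rewrite exchange_big /= (big_morph Posz PoszD (erefl : Posz 0 = 0)).
apply: eq_bigr => t hp; rewrite -big_distrr /= PoszM; congr (_ * _).
move: hp; rewrite pos_lt => ht0; have -> : ht t = (target t)%:Z - (source t)%:Z by [].
rewrite (eq_bigr (fun s : 'I_n.-1 => ((source t <= s) && (s < target t))%N : nat)); last first.
  by move=> s _; rewrite ffunE.
rewrite -(big_mkord xpredT (fun s : nat => ((source t <= s) && (s < target t))%N : nat)).
have jn : (target t <= n.-1)%N by rewrite -ltnS (leq_trans (ltn_ord _)) // leqSpred.
rewrite (big_cat_nat (n := source t)) ?(leq_trans (ltnW ht0)) //= big1_seq ?add0n => [|s]; last first.
  by rewrite mem_index_iota => /andP[_ /andP[_ si]]; rewrite leqNgt si.
rewrite (big_cat_nat (n := target t)) ?(ltnW ht0) //= [X in (_ + X)%N]big1_seq ?addn0 => [|s]; last first.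
  by rewrite mem_index_iota => /andP[_ /andP[js _]]; rewrite [(s < _)%N]ltnNge js andbF.
rewrite big_nat (eq_bigr (fun=> 1%N)) => [|s ->//].
by rewrite -big_nat sum_nat_const_nat muln1; lia.
Qed.

Lemma nbhs0E (d : nat) : @nbhs0 R k n d = cspan (fun m => (d <= height (posw m))%N).
Proof.
apply/seteqP; split.
  apply: linspan_sub => [|u [nu hnu]]; first exact: cspan_closed.
  by rewrite JE; apply: cspan_sub => m ->.
apply: cspan_ind => [|m vm hm]; first exact: linspan_closed.
by apply: linspan_in; exists (posw m) => //; rewrite JE; apply: (cspan_mono free).
Qed.

(** Only finitely many [nu] have height below d, so the finitely supported sum in [trunc] is an
    honest sum. *)
Lemma trunc_seq (d : nat) : exists s : seq Qp, [/\ uniq s,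
  forall nu, (nu \in s) = (height nu < d)%N & forall u : Qp -> U, trunc d u = \sum_(nu <- s) u nu].
Proof.
have [s us hs] : exists2 s : seq Qp, uniq s & forall nu, (nu \in s) = (height nu < d)%N.
  pose c (f : {ffun 'I_n.-1 -> 'I_d.+1}) : Qp := [ffun s => nat_of_ord (f s)].
  exists (undup [seq nu <- map c (enum {ffun 'I_n.-1 -> 'I_d.+1}) | (height nu < d)%N]).
    exact: undup_uniq.
  move=> nu; rewrite mem_undup mem_filter; case: ltnP => //= hnu.
  apply/mapP; exists [ffun s => inord (nu s)]; first by rewrite mem_enum.
  apply/ffunP => s; rewrite !ffunE inordK //; apply: ltn_trans (ltnSn d).
  by apply: leq_ltn_trans hnu; rewrite /height (bigD1 s) //= leq_addr.
exists s; split=> // u; rewrite fsbig_seq // /trunc.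
suff -> : [set nu : Qp | (height nu < d)%N] = [set` s] by [].
by apply/seteqP; split => nu /=; rewrite hs.
Qed.

Lemma Uhat_coord (u : Qp -> U) nu m : Uhat u -> coord (u nu) m != 0 -> posw m = nu.
Proof. by move=> /(_ nu); rewrite JE => /(_ m). Qed.

Lemma coord_trunc (d : nat) (u : Qp -> U) m : Uhat u ->
  coord (trunc d u) m = if (height (posw m) < d)%N then coord (u (posw m)) m else 0.
Proof.
move=> hu; have [s [us hs ->]] := trunc_seq d.
rewrite (coord_sum free); case: ifP => hm.
  rewrite (bigD1_seq (posw m)) ?hs //= big1 ?addr0 // => nu hnu.
  by apply: contraTeq hnu => h; rewrite (Uhat_coord hu h) eqxx.
rewrite big1_seq // => nu /andP[_]; rewrite hs => hd.
by apply: contraTeq hd => h; rewrite -(Uhat_coord hu h) hm.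
Qed.

Lemma trunc0 (d : nat) : trunc d (fun=> 0 : U) = 0 :> U.
Proof. by have [s [_ _ ->]] := trunc_seq d; rewrite big1. Qed.

Lemma Zhat_ad (z : Qp -> U) x (d : nat) : Zhat z ->
  exists N, forall p, (N <= p)%N -> cspan (fun m => (d <= height (posw m))%N) (superad x (trunc p z)).
Proof.
move=> [_ /(_ x)[_ /(_ d)[N hN]]]; exists N => p /hN.
by rewrite trunc0 subr0 nbhs0E.
Qed.

Hypothesis hkn : qtype_rank k n.

(** The bound is strict so that q = 0 covers z(0) = 0, in which case it says that every component
    vanishes. *)
Lemma degree_bound (z : Qp -> U) (q : nat) : Zhat z ->
  (forall m, coord (z 0) m != 0 -> (mdeg m < q)%N) ->
  forall nu m, coord (z nu) m != 0 -> (mdeg m < q)%N.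
Proof.
move=> hz hz0; have hU := hz.1.
suff H : forall (N : nat) m, height (posw m) = N -> coord (z (posw m)) m != 0 -> (mdeg m < q)%N.
  by move=> nu m hm; have e1 := Uhat_coord hU hm; apply: (H (height (posw m))); rewrite // e1.
elim/ltn_ind => N IH m0 hm0 c0; rewrite ltnNge; apply/negP => q0.
have [N0|Npos] := posnP N.
  have p0 : posw m0 = 0.
    apply/ffunP => s; move: hm0; rewrite N0 /height (bigD1 s) //= => /eqP.
    by rewrite addn_eq0 => /andP[/eqP -> _]; rewrite ffunE.
  by move: q0; rewrite leqNgt hz0 // -p0.
(* All heights up to N are kept. Those below N have degree < q by induction, so they are absent from
   the symbol of degree p >= q, which is concentrated in height N. *)
set u := trunc N.+1 z.
have cu m : coord u m = if (height (posw m) < N.+1)%N then coord (z (posw m)) m else 0.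
  exact: coord_trunc.
pose P p := `[< exists m, [/\ height (posw m) = N, coord (z (posw m)) m != 0 & mdeg m = p] >].
have exP : exists p, P p by exists (mdeg m0); apply/asboolP; exists m0.
have [b hb] : exists b, @degle C g Y b u.
  by have [b] := Ulow_exhaust Y u; rewrite -(degleE free); exists b.
have bP p : P p -> (p <= b)%N.
  move=> /asboolP[m [hm cm <-]]; apply: hb; by rewrite cu hm ltnSn.
have [p /asboolP[m1 [hm1 c1 d1]] pmax] := ex_maxnP exP bP.
have qp : (q <= p)%N.
  by apply: leq_trans q0 _; apply: pmax; apply/asboolP; exists m0.
have du : @degle C g Y p u.
  move=> m; rewrite cu; case: ifP => [|_]; last by rewrite eqxx.
  rewrite ltnS leq_eqVlt => /orP[/eqP hm|hm] cm.
    by apply: pmax; apply/asboolP; exists m.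
  by apply: leq_trans qp; apply: ltnW; apply: IH hm _ erefl cm.
have symN m : @sym C g Y p u m != 0 ->
    [/\ valid par m, mdeg m = p, height (posw m) = N & coord u m != 0].
  rewrite /sym; case: ifP => [/eqP dm|_]; last by rewrite eqxx.
  move=> cm; split=> //; first exact: coord_valid cm.
  move: (cm); rewrite cu; case: ifP => [|_]; last by rewrite eqxx.
  rewrite ltnS leq_eqVlt => /orP[/eqP //|hm] cm'.
  by have := IH _ hm _ erefl cm'; rewrite dm ltnNge qp.
have f0 : @sym C g Y p u = 0.
  have [h hw] := height_weight C k l.
  apply: (@symbol_vanish C g Y ht _ _ p (N%:Z)).
  - by move=> a a' t; apply: q_br_height.
  - by move=> t; apply: root_pairings.
  - by rewrite ltz_nat.
  - by move=> m /symN[v dm hm _]; split; rewrite // nht_posw hm.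
  move=> y m hy dm nm.
  have [_ <-] := sym_superad free (sb_homog y) du.
  rewrite /sym dm eqxx; apply: contrapT => /eqP cm.
  suff : cspan (fun m => (N.+1%:Z + ht y <= @nht C g Y ht m)%R) (superad (e y) u).
    by move=> /(_ m cm); rewrite nm; lia.
  (* Compare u with a longer truncation w: [superad (e y) w] has height above N since z is central,
     and w - u starts at height N + 1, so its image starts at N + 1 + ht y. Hence [superad (e y) u]
     has no term at height N + ht y. *)
  have [M hM] := Zhat_ad (e y) N.+1 hz.
  pose M' := maxn M N.+1; have := hM M' (leq_maxl _ _); set w := trunc M' z.
  move=> hw1; have -> : superad (e y) u = superad (e y) w - superad (e y) (w - u).
    by have := superadD (e y) u (w - u); rewrite [u + _]addrC subrK => ->; rewrite addrK.
  have cl := cspan_closed free (fun m => (N.+1%:Z + ht y <= @nht C g Y ht m)%R).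
  apply: (lclosedB cl).
    move: hw1; apply: cspan_sub => m' hm'; rewrite nht_posw; lia.
  apply: (superad_height free hw qpos); first exact: ltW.
  move=> m'; rewrite (coordB free) cu coord_trunc // nht_posw.
  case: ltnP => [h1|h1]; case: ltnP => [h2|h2]; rewrite ?subrr ?eqxx ?subr0 //.
  by move: (leq_trans h2 (leq_trans (leq_maxr M N.+1) h1)); rewrite ltnn.
have /eqP := congr1 (fun f : fock C T => f m1) f0.
rewrite fock0 /sym d1 eqxx cu hm1 ltnSn => /eqP c1'.
by rewrite c1' eqxx in c1.
Qed.

(** * The component of weight 0 and the projection HC *)

Lemma root_wt_neq0 t : pos t -> exists s : 'I_n.-1, root_wt t s = 1%N.
Proof.
rewrite pos_lt => st; have hs : (source t < n.-1)%N.
  by apply: (leq_trans st); rewrite -ltnS (leq_trans (ltn_ord _)) // leqSpred.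
by exists (Ordinal hs); rewrite ffunE /= leqnn st.
Qed.

Lemma posw0 m t : posw m = 0 -> pos t -> m t = 0%N.
Proof.
move=> h ht0; have [s hs] := root_wt_neq0 ht0.
move/ffunP/(_ s): h; rewrite !ffunE (bigD1 t) //= hs muln1 => /eqP.
by rewrite addn_eq0 => /andP[/eqP].
Qed.

(** Centrality against the height element gives z(0) total height 0. As z(0) involves no positive
    letter, all its letters have non-positive height, so each of them has height 0. *)
Lemma Zhat_weight0 (z : Qp -> U) : Zhat z -> cspan (supported null) (z 0).
Proof.
move=> hz m hm; have hU := hz.1; have pm := Uhat_coord hU hm.
have [h hw] := height_weight C k l.
have [N hN] := Zhat_ad h 1 hz.
have /(_ m) : cspan (fun m => (1 <= height (posw m))%N) (superad h (trunc N.+1 z)) by apply: hN.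
have -> : superad h (trunc N.+1 z) = commutator h (trunc N.+1 z).
  by rewrite (superadE _ hw.1).
have h0 : height (0 : Qp) = 0%N by rewrite /height big1 // => s _; rewrite ffunE.
rewrite (coord_commutator free _ _ hw) coord_trunc // pm h0 /= => hc.
have {hc} : mweight (X := Y) (fun t => (ht t)%:~R) m = 0.
  apply: contrapT => /eqP hne; have := hc _.
  by rewrite mulf_eq0 negb_or hne hm => /(_ isT).
rewrite /mweight => /eqP; have -> : \sum_t (m t)%:R * (ht t)%:~R = (\sum_t (m t)%:Z * ht t)%:~R :> C.
  by rewrite rmorph_sum /=; apply: eq_bigr => t _; rewrite intrM.
rewrite intr_eq0 => hs.
apply/forallP => t; apply/implyP => mt; rewrite /null.
have np s : pos s -> m s = 0%N by apply: posw0.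
have le0 s : (m s)%:Z * ht s <= 0.
  case: (boolP (pos s)) => [/np ->|]; first by rewrite mul0r.
  by rewrite /pos -leNgt => hs0; rewrite mulr_ge0_le0.
move: hs; rewrite -oppr_eq0 -sumrN psumr_eq0 => [/allP/(_ t (mem_index_enum _))|s _]; last by rewrite oppr_ge0.
by rewrite /= oppr_eq0 mulf_eq0 eqz_nat -leqn0 leqNgt mt.
Qed.

Lemma QplusE nu ka (s : 'I_n.-1) : (nu + ka) s = (nu s + ka s)%N.
Proof. by rewrite ffunE. Qed.

(** Words are needed besides monomials because appending a letter on the right breaks the order. *)
Definition wposw (w : seq T) : Qp := [ffun s => (\sum_(t <- w) root_wt t s)%N].

Lemma wweight_wposw (D : 'M[R[i]]_n) (w : seq T) : all pos w ->
  wweight (X := Y) (fun t => D (source t) (source t) - D (target t) (target t)) w = Qval (wposw w) D.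
Proof.
move=> /allP hw; rewrite /Qval; under [RHS]eq_bigr do rewrite ffunE natr_sum mulr_suml.
rewrite exchange_big /= /wweight big_seq [RHS]big_seq; apply: eq_bigr => t /hw.
rewrite pos_lt => /ltnW ht0; rewrite (telescope D ht0); apply: eq_bigr => s _.
by rewrite ffunE.
Qed.

Lemma wprod_Unplus (w : seq T) : all pos w -> Unplus (wposw w) (wprod w).
Proof.
move=> hw; split; last first.
  move=> D h hD hh; have := commutator_word w (@q_weight C k n l _ _ hD hh).
  by rewrite wweight_wposw.
have hB : bclosed (X := Y) pos.
  by have [h h1] := height_weight C k l; apply: bclosed_pos h1.
rewrite Uof_nplus; have /(Ulow_cspan free hB) := Ulow_word hw (leqnn _).
by apply: cspan_sub => m [].
Qed.

Lemma wposw_mword m : supported pos m -> wposw (mword (sb_seq Y) m) = posw m.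
Proof.
move=> sm; apply: Qval_inj => D hD.
have hw : all pos (mword (sb_seq Y) m) by rewrite (all_mword (sb_all (s := Y))).
exact: etrans (esym (wweight_wposw D hw)) (etrans (wweight_mword _ _) (mweight_posw D sm)).
Qed.
Lemma wposw_rcons w t : wposw (rcons w t) = wposw w + root_wt t.
Proof.
apply/ffunP => s; rewrite QplusE [LHS]ffunE [wposw w s]ffunE.
by rewrite -cats1 big_cat big_seq1.
Qed.

Lemma mono_bminus m : valid par m -> Uof (@bminus R k n) (mono (X := Y) (restr (predC pos) m)).
Proof.
move=> vm; rewrite Uof_bminus; apply: (cspan_mono free); first exact: restr_valid.
exact: restr_supported.
Qed.
Lemma J_word m w nu : valid par m -> all pos w -> wposw w = nu ->
  @J R k n nu (mono (X := Y) (restr (predC pos) m) * wprod w).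
Proof.
move=> vm hw <-; apply: linspan_in; exists (mono (X := Y) (restr (predC pos) m)).
  exact: mono_bminus.
by exists (wprod w) => //; apply: wprod_Unplus.
Qed.

Lemma J_mulr ka t u : pos t -> @J R k n ka u -> J (ka + root_wt t) (u * uiota (e t)).
Proof.
move=> ht0; rewrite {1}JE; move: u; apply: cspan_ind => [|m vm pm].
  have cl : lclosed (@J R k n (ka + root_wt t)) by apply: linspan_closed.
  split=> [|c x y hx hy]; rewrite /= ?mul0r ?mulrDl -?scalerAl; by case: cl => // _; apply.
rewrite /= (mono_split qpos) -mulrA.
have -> : uiota (e t) = wprod [:: t] by rewrite /wprod big_seq1.
have srm := restr_supported pos m.
rewrite [mono (restr pos m)]/mono -wprod_cat cats1; apply: J_word => //.
  by rewrite all_rcons ht0 (all_mword (sb_all (s := Y))).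
by rewrite wposw_rcons wposw_mword // posw_restr pm.
Qed.

(** A monomial of J'(nu) with nu != 0 ends with a positive letter, since positive letters come last;
    split it off. *)
Lemma split_last nu u : nu <> 0 -> @J R k n nu u -> exists v : T -> U,
  [/\ forall t, cspan (fun m => posw m + root_wt t = nu) (v t),
      forall t, ~~ pos t -> v t = 0 & u = \sum_t v t * uiota (e t)].
Proof.
move=> nu0; rewrite JE; move: u; apply: cspan_ind => [|m vm pm].
  split=> [|c x y [v [v1 v2 ->]] [v' [v1' v2' ->]]].
    exists (fun=> 0); split=> // [t|]; first by case: (cspan_closed free (fun m => posw m + root_wt t = nu)).
    by rewrite big1 // => t _; rewrite mul0r.
  exists (fun t => c *: v t + v' t); split=> [t|t ht0|].
  - by case: (cspan_closed free (fun m => posw m + root_wt t = nu)) => _; apply.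
  - by rewrite v2 // v2' // scaler0 addr0.
  - rewrite scaler_sumr -big_split; apply: eq_bigr => t _.
    by rewrite mulrDl -scalerAl.
have srm := restr_supported pos m.
have hw : all pos (mword (sb_seq Y) (restr pos m)) by rewrite (all_mword (sb_all (s := Y))).
have pw := wposw_mword srm; rewrite posw_restr pm in pw.
have em := mono_split qpos m.
rewrite [mono (restr pos m)]/mono in em.
move: (mword _ (restr pos m)) hw pw em => w; case/lastP: w => [_ h _|w t].
  by case: nu0; rewrite -h; apply/ffunP => s; rewrite !ffunE big_nil.
rewrite all_rcons wposw_rcons => /andP[ht0 hw] pw em.
exists (fun t' => if t' == t then mono (X := Y) (restr (predC pos) m) * wprod w else 0); split.
- move=> t'; case: eqP => [->|_]; last by case: (cspan_closed free (fun m => posw m + root_wt t' = nu)).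
  have := J_word vm hw erefl; rewrite JE; apply: cspan_sub => m' ->.
  exact: pw.
- by move=> t'; case: eqP => [->|//]; rewrite ht0.
rewrite (bigD1 t) //= eqxx big1 ?addr0 => [|t' /negPf ->]; last by rewrite mul0r.
by rewrite em -cats1 wprod_cat mulrA; congr (_ * _); rewrite /wprod big_seq1.
Qed.

Lemma height0 : height (0 : Qp) = 0%N.
Proof. by rewrite /height big1 // => s _; rewrite ffunE. Qed.

Lemma root_wt0 ka t : pos t -> ka + root_wt t <> 0.
Proof.
move=> ht0; have [s hs] := root_wt_neq0 ht0 => /ffunP/(_ s).
by rewrite QplusE hs ffunE addn1.
Qed.

(** Right multiplication by a positive letter shifts components by its root, injectively, so at most
    one component reaches a given coordinate. *)
Lemma trunc_mulr (d : nat) (u : Qp -> U) t m : pos t -> Uhat u ->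
  coord (trunc d u * uiota (e t)) m != 0 ->
  exists2 ka, posw m = ka + root_wt t & (height ka < d)%N
    /\ coord (trunc d u * uiota (e t)) m = coord (u ka * uiota (e t)) m.
Proof.
move=> ht0 hu; have [s [us hs ->]] := trunc_seq d.
rewrite mulr_suml (coord_sum free) => hne.
have hc ka : coord (u ka * uiota (e t)) m != 0 -> posw m = ka + root_wt t.
  by have := J_mulr ht0 (hu ka); rewrite JE => /(_ m).
have [ka hka nka] : exists2 ka, ka \in s & coord (u ka * uiota (e t)) m != 0.
  apply: contrapT => hn; case/eqP: hne; rewrite big1_seq // => ka /andP[_ hka].
  by apply: contrapT => /eqP h; case: hn; exists ka.
exists ka; first exact: hc.
split; first by rewrite -hs.
rewrite (bigD1_seq ka) //= big1 ?addr0 // => ka' hk; apply: contraNeq hk => h.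
apply/eqP/ffunP => r; have := hc _ h; rewrite (hc _ nka) => /ffunP/(_ r).
by rewrite !QplusE => /addIn.
Qed.

(** Right multiplication by n^+ adds a positive root, so it never reaches weight 0. *)
Lemma Uhat_nplus0 (w : Qp -> U) : Uhat_nplus w -> w 0 = 0.
Proof.
move: w; apply: linspan_sub => [|w [u [x [hu hx [hw /(_ 1%N)[N hN]]]]]].
  by split=> [//|a v v' hv hv']; rewrite /= -[LHS]/(a *: v 0 + v' 0) hv hv' scaler0 addr0.
apply: (coord_inj (X := Y)) => m; apply: contrapT => /eqP hm.
have pm := Uhat_coord hw hm.
have := hN N (leqnn _); rewrite nbhs0E => /(_ m).
rewrite (coordB free) (coord_trunc _ _ hw) pm height0 /= => h.
suff hx0 : coord (trunc N u * uiota x) m = 0.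
  by have := h; rewrite hx0 sub0r oppr_eq0 hm => /(_ isT).
rewrite (uiota_sum Y) mulr_sumr (coord_sum free) big1 // => t _.
rewrite -scalerAr (coordZ free); have [->|ht0] := eqVneq (co x t) 0; first by rewrite mul0r.
have tpos := nplus_co hx ht0; apply: contrapT => /eqP.
rewrite mulf_eq0 negb_or => /andP[_ /(trunc_mulr tpos hu)[ka hka _]].
by apply: (root_wt0 (ka := ka) tpos); rewrite -hka pm.
Qed.

(** Split off last letters in every component and collect by letter: this leaves finitely many
    products u e_t, each u being an infinite sum that exists in the completion. *)
Lemma Uhat_tail (z : Qp -> U) : Uhat z ->
  Uhat_nplus (fun nu => if nu == 0 then 0 else z nu).
Proof.
move=> hz.
have ex nu : exists v : T -> U, nu <> 0 ->
    [/\ forall t, cspan (fun m => posw m + root_wt t = nu) (v t),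
        forall t, ~~ pos t -> v t = 0 & z nu = \sum_t v t * uiota (e t)].
  have [->|/eqP nu0] := eqVneq nu 0; first by exists (fun=> 0).
  by have [v hv] := split_last nu0 (hz nu); exists v.
pose v nu := sval (cid (ex nu)).
have vP nu : nu <> 0 -> [/\ forall t, cspan (fun m => posw m + root_wt t = nu) (v nu t),
    forall t, ~~ pos t -> v nu t = 0 & z nu = \sum_t v nu t * uiota (e t)].
  exact: (svalP (cid (ex nu))).
pose w t (nu : Qp) : U := if nu == 0 then 0 else v nu t * uiota (e t).
have -> : (fun nu => if nu == 0 then 0 else z nu) = \sum_(t | pos t) w t.
  apply/funext => nu; have sumE : (\sum_(t | pos t) w t) nu = \sum_(t | pos t) w t nu.
    by elim/big_rec2: _ => // t y1 y2 _ <-.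
  rewrite sumE /w; case: eqP => [_|nu0]; first by rewrite big1.
  have [_ v0 ->] := vP _ nu0; rewrite (bigID pos) /= [X in _ + X]big1 ?addr0 // => t /v0 ->.
  by rewrite mul0r.
apply: (lclosed_sum _ (linspan_closed _)) => t tpos; apply: linspan_in.
(* Splitting off t lowers the weight by its root; hence the shifted index. *)
pose u (ka : Qp) := v (ka + root_wt t) t.
have hu : Uhat u.
  move=> ka; rewrite JE; have [h _ _] := vP _ (root_wt0 (ka := ka) tpos).
  move: (h t); apply: cspan_sub => m /ffunP hm; apply/ffunP => r.
  by have := hm r; rewrite !QplusE => /addIn.
have wE ka : w t (ka + root_wt t) = u ka * uiota (e t).
  by rewrite /w; case: eqP => // /(root_wt0 tpos).
have w0 nu m : coord (w t nu) m != 0 -> exists2 ka, nu = ka + root_wt t & posw m = nu.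
  rewrite /w; case: ifP => [_|/eqP nu0]; first by rewrite (coord0 free) eqxx.
  have [h _ _] := vP _ nu0 => hm.
  have [ka hka] : exists ka, nu = ka + root_wt t.
    apply: contrapT => hn; case/eqP: hm; have -> : v nu t = 0.
      apply: (coord_inj (X := Y)) => m'; apply: contrapT => /eqP /(h t) h'.
      by case: hn; exists (posw m').
    by rewrite mul0r (coord0 free).
  exists ka => //; move: hm; have := J_mulr tpos (hu ka).
  by rewrite JE /u -hka => /(_ m).
have hw : Uhat (w t).
  move=> nu; rewrite JE => m hm; by have [ka _] := w0 _ _ hm.
exists u, (e t); split=> //; first exact: nplus_elt.
split=> // d; exists d => p dp; rewrite nbhs0E => m.
rewrite (coordB free) (coord_trunc _ _ hw); case: ltnP => // hd; rewrite subr_eq0 => /negP; case.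
have [h0|hne] := eqVneq (coord (trunc p u * uiota (e t)) m) 0; last first.
  have [ka hka [_ ->]] := trunc_mulr tpos hu hne.
  by rewrite hka wE.
apply: contrapT => /negP h1; rewrite eq_sym h0 in h1.
have [ka hka _] := w0 _ _ h1.
have hk : (height ka < p)%N.
  apply: leq_trans dp; apply: leq_ltn_trans hd; rewrite hka /height.
  by apply: leq_sum => s _; rewrite QplusE leq_addr.
move: h1; rewrite hka wE => h1; case/eqP: h1; rewrite -h0.
have [s [us hs ->]] := trunc_seq p.
rewrite mulr_suml (coord_sum free) (bigD1_seq ka) ?hs //= big1 ?addr0 // => ka' hk'.
apply: contraNeq hk' => h; have := J_mulr tpos (hu ka'); rewrite JE => /(_ m h).
rewrite hka => /ffunP hq; apply/eqP/ffunP => r; have := hq r.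
by rewrite !QplusE => /addIn ->.
Qed.

(** A letter of n^- followed by letters of b^- has negative total height, whereas a monomial in
    letters of h has height 0. *)
Lemma nminusU_coord a m : nminusU a -> supported null m -> coord a m = 0.
Proof.
move=> ha sm; apply: contrapT => /eqP hm; move: a ha m hm sm.
suff H : @nminusU R k n `<=` cspan (fun m => ~ supported null m).
  by move=> a /H ha m /ha.
have cl := cspan_closed free (fun m => ~ supported null m).
apply: linspan_sub => // _ [y hy [a ha <-]].
rewrite (uiota_sum Y) mulr_suml; apply: (lclosed_sum _ cl) => t _; rewrite -scalerAl.
have [->|ht0] := eqVneq (co y t) 0; first by rewrite scale0r; case: cl.
have tneg := nminus_co hy ht0; apply: (lclosedZ _ cl).
move: a ha; rewrite Uof_bminus; apply: cspan_ind => [|m vm sm].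
  split=> [|c x x' hx hx']; rewrite /= ?mulr0 ?mulrDr -?scalerAr; by case: cl => // _; apply.
have [h hw] := height_weight C k l.
change (cspan (fun m => ~ supported null m) (uiota (e t) * wprod (mword (sb_seq Y) m))).
rewrite -wprod_cons => m' /(coord_word_weight free hw) e1 /forallP sm'.
move: e1; rewrite /wweight big_cons -/(wweight _ _) wweight_mword /mweight big1 => [|r _]; last first.
  have := sm' r; rewrite /null; case: (m' r) => [|d]; first by rewrite mul0r.
  by move=> /eqP ->; rewrite mulr0.
move=> /esym/eqP; apply/negP; rewrite lt_eqF // -[X in _ < X]addr0.
apply: ltr_leD; first by rewrite ltrz0.
apply: sumr_le0 => r _; have := forallP sm r; case: (m r) => [|d]; first by rewrite mul0r.
by rewrite /= /pos -leNgt => hr; rewrite mulr_ge0_le0 ?ler0n // lerz0.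
Qed.

(** The decomposition with h = z(0), a = 0 and the tail in [Uhat_nplus] exists; uniqueness
    identifies it with the one picked by [xget]. *)
Lemma HC_Zhat (z : Qp -> U) : Zhat z -> HC z = z 0.
Proof.
move=> hz; have hU := hz.1; have h0 := Zhat_weight0 hz.
have ex : exists h, [set h | Uof (@hh R k n) h /\
    exists a w, [/\ nminusU a, Uhat_nplus w & z = in0 h + (in0 a + w)]] h.
  exists (z 0); split; first by rewrite Uof_hh.
  exists 0, (fun nu => if nu == 0 then 0 else z nu); split.
  - by case: (linspan_closed [set uiota y * a | y in @nminus R k n & a in Uof (@bminus R k n)]).
  - exact: Uhat_tail.
  apply/funext => nu; rewrite -[RHS]/(in0 (z 0) nu + (in0 0 nu + _)) /in0.
  by case: eqP => [->|_]; rewrite ?addr0 ?add0r.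
have [hh' [a [w [ha hw hzE]]]] := xgetPex 0 ex.
rewrite -/(HC z) in hh' hzE; move: (HC z) hh' hzE => h hh' hzE.
have z0E : z 0 = h + a.
  by rewrite hzE -[LHS]/(in0 h 0 + (in0 a 0 + w 0)) /in0 eqxx (Uhat_nplus0 hw) addr0.
rewrite Uof_hh in hh'.
(* Both h and z(0) = h + a only have coordinates in letters of height 0, where a has none. *)
apply/eqP; rewrite -subr_eq0; apply/eqP; apply: (coord_inj (X := Y)) => m.
rewrite (coordB free); case: (boolP (supported null m)) => sm.
  by rewrite z0E (coordD free) (nminusU_coord ha sm) addr0 subrr.
have -> : coord h m = 0.
  by apply: contrapT => /eqP /(hh' m) sm'; rewrite sm' in sm.
have -> : coord (z 0) m = 0.
  by apply: contrapT => /eqP /(h0 m) sm'; rewrite sm' in sm.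
by rewrite subrr.
Qed.

Lemma degU_le (z : Qp -> U) nu : Zhat z -> (degU (z nu) <= degU (z 0)%R)%E.
Proof.
move=> hz; rewrite /degU; case: (eqVneq (z nu) 0) => [_|hnu]; first exact: leNye.
(* Here [degU (z 0)] is -oo, so z(nu) has to vanish: [degree_bound] with q = 0. *)
case: (eqVneq (z 0) 0) => [z0|_].
  case/eqP: hnu; apply: (coord_inj (X := Y)) => m; apply: contrapT => /eqP hm.
  have hb m' : coord (z 0) m' != 0 -> (mdeg m' < 0)%N by rewrite z0 (coord0 free) eqxx.
  by have := degree_bound hz hb hm; rewrite ltn0.
(* Every filtration bound p of z(0) is one of z(nu), by [degree_bound] with q = p + 1, so the
   infimum for z(nu) is over a larger set. *)
apply: le_ereal_inf => _ [p hp <-]; exists p => //.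
move: hp; rewrite /= !(Ufilt_degle free) => hp m hm; rewrite -ltnS.
by apply: (degree_bound hz _ hm) => m' /hp.
Qed.

End Completion.

Theorem theorem12p2p1 (R : realType) (k : qkind) (n : nat)
    (hkn : qtype_rank k n)
    (z : Qplus n -> uea (qtypeLie R[i] k n)) (hz : Zhat z) :
  deg z = degU (HC z) /\
  (forall nu : Qplus n, (degU (z nu) <= degU (z 0%R))%E).
Proof.
(* The distinguished index l of the basis is arbitrary; index 0 is taken. *)
have n0 : (0 < n)%N by case: k hkn {z hz} => /ltnW // /ltnW.
have le nu : (degU (z nu) <= degU (z 0%R))%E by apply: (degU_le (Ordinal n0) hkn).
split=> //; rewrite (HC_Zhat (Ordinal n0) hz); apply/eqP; rewrite eq_le; apply/andP; split.
  by apply: ge_ereal_sup => _ [nu _ <-]; apply: le.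
by apply: ereal_sup_ubound; exists 0.
Qed.
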